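(* Let $p\in\,]1,\infty[$, $\alpha>-1$, $X=H^p$ or $X=A^p_\alpha$, and let $g_t\in\mathcal{A}$ for $t\in\,]0,1[$. If $\{M_{g_t}:t\in\,]0,1[\}$ satisfies $W(X)$, then the inequality \[ \mathrm{EN}\Big(\int_0^1 M_{g_t}\,dt\Big)\le\int_0^1\mathrm{EN}(M_{g_t})\,dt \] is an equality if and only if there exist $\xi,\theta\in\partial\mathbb{D}$ such that $\theta g_t(\xi)=\|g_t\|_\infty$ for almost every $t\in\,]0,1[$.
   Context: $\mathbb{D}$ is the open unit disk, $m$ normalized arc length on $\partial\mathbb{D}$, $A$ normalized area measure on $\mathbb{D}$. $H^p$ is the Hardy space of analytic $f$ on $\mathbb{D}$ with $\|f\|_{H^p}=\lim_{r\to1}(\int_{\partial\mathbb{D}}|f(rz)|^p\,dm(z))^{1/p}<\infty$; $A^p_\alpha$ is the weighted Bergman space of analytic $f$ on $\mathbb{D}$ with $\|f\|_{A^p_\alpha}=(\int_{\mathbb{D}}|f(z)|^p(\alpha+1)(1-|z|^2)^\alpha\,dA(z))^{1/p}<\infty$. $H^\infty$ is the space of bounded analytic functions on $\mathbb{D}$ with $\|g\|_\infty=\sup_{z\in\mathbb{D}}|g(z)|$; $\mathcal{A}$ is the disk algebra, the functions in $H^\infty$ that extend continuously to $\overline{\mathbb{D}}$ (so $g_t(\xi)$ for $\xi\in\partial\mathbb{D}$ is the value of the extension). $M_gf=gf$. A family $\{S_t:t\in\,]0,1[\}$ of bounded operators on $X$ satisfies $W(X)$ if for every $f\in X$, $t\mapsto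 S_tf$ is norm continuous on $]0,1[$ and $\int_0^1\|S_tf\|_X\,dt<\infty$; then $\int_0^1S_t\,dt$ is the operator $f\mapsto\int_0^1S_tf\,dt$. For a bounded operator $S$ on $X$, $\mathrm{EN}(S)=\sup_{(f_n)}\limsup_n\|Sf_n\|_X$, the supremum over all sequences $(f_n)\subset X$ with $\|f_n\|_X=1$ converging weakly to $0$. *)

(* Defs.v *)
From HB Require Import structures.
From mathcomp Require Import all_boot all_order all_algebra.
From mathcomp Require Import all_classical all_reals all_analysis.
From mathcomp Require Import complex.
Import Order.TTheory GRing.Theory Num.Theory.
Import numFieldNormedType.Exports.
Set Implicit Arguments. Unset Strict Implicit. Unset Printing Implicit Defensive.
Local Open Scope classical_set_scope.
Local Open Scope ring_scope.

Section Defs.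
Variable R : realType.
Local Notation C := R[i].

Definition cabs (z : C) : R := Normc.normc z.

Definition disk : set C := [set z | cabs z < 1].

Definition analytic_D (f : C -> C) : Prop :=
  exists a : nat -> C, forall z, cabs z < 1 ->
    (fun n : nat => cabs (f z - \sum_(k < n) a k * z ^+ k)) @ \oo --> (0 : R).

Definition expi (th : R) : C := (cos th +i* sin th)%C.

Definition Mp (p : R) (f : C -> C) (r : R) : \bar R :=
  ((2 * pi)^-1)%:E *
  (\int[lebesgue_measure]_(th in `[0%R, (2 * pi)%R]) ((cabs (f (r%:C%C * expi th))) `^ p)%R%:E)%E.

Definition hardy_mem (p : R) (f : C -> C) : Prop :=
  analytic_D f /\ exists L : R, Mp p f @ 1^'- --> L%:E.
Definition hardy_norm (p : R) (f : C -> C) : R :=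
  (fine (lim (Mp p f @ 1^'-))) `^ p^-1.

(* weighted Bergman space A^p_alpha, dA = dx dy / pi *)
Definition Bint (p alpha : R) (f : C -> C) : \bar R :=
  (\int[(@lebesgue_measure R) \x (@lebesgue_measure R)]_(xy in
       [set xy : R * R | (xy.1 ^+ 2 + xy.2 ^+ 2 < 1)%R])
     ((cabs (f (xy.1 +i* xy.2)%C)) `^ p * (alpha + 1) *
      (1 - (xy.1 ^+ 2 + xy.2 ^+ 2)) `^ alpha / pi)%R%:E)%E.
Definition bergman_mem (p alpha : R) (f : C -> C) : Prop :=
  analytic_D f /\ (Bint p alpha f < +oo)%E.
Definition bergman_norm (p alpha : R) (f : C -> C) : R :=
  (fine (Bint p alpha f)) `^ p^-1.

Record fspace := FSpace { fmem : (C -> C) -> Prop; fnorm : (C -> C) -> R }.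
Definition Hardy (p : R) := FSpace (hardy_mem p) (hardy_norm p).
Definition Bergman (p alpha : R) := FSpace (bergman_mem p alpha) (bergman_norm p alpha).

Definition bounded_functional (X : fspace) (phi : (C -> C) -> C) : Prop :=
  (forall (f g : C -> C) (a b : C), fmem X f -> fmem X g ->
     phi (fun z => a * f z + b * g z) = a * phi f + b * phi g) /\
  exists K : R, forall f, fmem X f -> cabs (phi f) <= K * fnorm X f.

Definition unit_weakly_null (X : fspace) (fs : nat -> C -> C) : Prop :=
  (forall n, fmem X (fs n) /\ fnorm X (fs n) = 1) /\
  forall phi, bounded_functional X phi ->
    (fun n => cabs (phi (fs n))) @ \oo --> (0 : R).

Definition EN (X : fspace) (S : (C -> C) -> (C -> C)) : \bar R :=
  ereal_sup [set limn_esup (fun n => (fnorm X (S (fs n)))%:E) |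
             fs in unit_weakly_null X].

Definition Mop (g : C -> C) (f : C -> C) : C -> C := fun z => g z * f z.

Definition disk_algebra (g : C -> C) : Prop :=
  analytic_D g /\ (exists M : R, forall z, cabs z < 1 -> cabs (g z) <= M) /\
  forall z, cabs z <= 1 -> forall e : R, 0 < e -> exists2 d : R, 0 < d &
    forall w, cabs w <= 1 -> cabs (w - z) < d -> cabs (g w - g z) < e.

Definition supnorm (g : C -> C) : R := sup [set cabs (g z) | z in disk].

Definition condW (X : fspace) (S : R -> (C -> C) -> (C -> C)) : Prop :=
  forall f, fmem X f ->
    (forall t, t \in `]0%R, 1%R[ -> fmem X (S t f)) /\
    (forall t0, t0 \in `]0%R, 1%R[ ->
       (fun t => fnorm X (fun z => S t f z - S t0 f z)) @ t0 --> (0 : R)) /\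
    (\int[lebesgue_measure]_(t in `]0%R, 1%R[) (fnorm X (S t f))%:E < +oo)%E.

Definition cint01 (h : R -> C) : C :=
  (Rintegral lebesgue_measure `]0%R, 1%R[ (fun t => complex.Re (h t)) +i*
   Rintegral lebesgue_measure `]0%R, 1%R[ (fun t => complex.Im (h t)))%C.

Definition int_op (S : R -> (C -> C) -> (C -> C)) (f : C -> C) : C -> C :=
  fun z => cint01 (fun t => S t f z).

End Defs.

(* Main.v *)
(* Both spaces carry a functional [N f] (the [p]-th power of the norm, infinite off the space)
   with the properties collected in [gauge], together with a lower bound on monomials and the
   smallness of [N (((1 + z) / 2) ^ m)]; the rest of the argument uses nothing else.
   For a bounded analytic [h], [EN (M_h)] is at most [sup |h|], and it is at least [|c|] whenever
   [h] tends to [c] at a point [xi] of the circle: normalized powers of the peak function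
   [(1 + conj xi z) / 2] along a sparse sequence behave like the unit vectors of [l^p], hence are
   weakly null, while they concentrate at [xi].  By the maximum principle
   [EN (M_{g_t}) = ||g_t||].
   The integral operator is multiplication by [G z = \int g_t z dt].  A gliding hump argument
   shows that [\int |g_t z| dt], hence [G], is bounded on the disk.  If equality holds, then
   [\int ||g_t|| dt] is finite, [|G|] comes close to it along a sequence tending to some [xi] on
   the circle, and dominated convergence gives [|\int g_t xi dt| = \int ||g_t|| dt]: the phases
   align almost everywhere.  Conversely, if the phases align at [xi], then Fatou's lemma makes
   [\int ||g_t|| dt] finite and dominated convergence gives [G] the limit [\int g_t xi dt]
   at [xi], whose modulus is [\int ||g_t|| dt]. *)

(* [analytic_D] supplies a power series, and the classical theorems are drawn from it by one device:
   finite sums of rotations [c_j f(w_j z)] of total weight at most 1 that act on Taylor coefficients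
   as a multiplier. Discrete Fourier weights isolate a coefficient; discrete Poisson weights give
   the dilation [f(q z)]. A gauge is rotation invariant, convex through [gauge_dom] and lower
   semicontinuous through [gauge_fatou], so such sums never increase it. Coefficient bounds, bounded
   point evaluations and the monotonicity of circle means all come from this. [condW] controls the
   integral of the norms of [g_t f] for each [f] separately and does not make the integral of the
   sup norms finite. Hence the hump function must be a single [f] that serves every [t]. Weak
   nullness is proved against arbitrary bounded functionals, from the growth of norms of finite
   sums. The peak powers must therefore be almost disjoint. Their norms are compared without
   asymptotics: they tend to 0, but slower than every geometric sequence. *)
Require Import Defs.
From HB Require Import structures.
From mathcomp Require Import all_boot all_order all_algebra.
From mathcomp Require Import all_classical all_reals all_analysis.
From mathcomp Require Import measurable_realfun complex ring lra zify.
Import Order.TTheory GRing.Theory Num.Theory.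
Import numFieldNormedType.Exports.
Set Implicit Arguments. Unset Strict Implicit. Unset Printing Implicit Defensive.
Local Open Scope classical_set_scope.
Local Open Scope ring_scope.

(** * Complex numbers and power series on the disk *)

Arguments cabs : simpl never.

Section Modulus.
Variable R : realType.
Local Notation C := R[i].
Implicit Types (x y z w : C) (u v : nat -> C).

Lemma cabs_ge0 z : 0 <= cabs z.
Proof. by case: z => a b; rewrite /cabs /= sqrtr_ge0. Qed.

Lemma cabs0 : cabs (0 : C) = 0. Proof. exact: Normc.normc0. Qed.

Lemma cabs1 : cabs (1 : C) = 1. Proof. exact: Normc.normc1. Qed.

Lemma cabsM z w : cabs (z * w) = cabs z * cabs w.
Proof. exact: Normc.normcM. Qed.

Lemma cabsV z : cabs z^-1 = (cabs z)^-1.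
Proof. exact: Normc.normcV. Qed.

Lemma cabsN z : cabs (- z) = cabs z. Proof. exact: normcN. Qed.

Lemma cabsD z w : cabs (z + w) <= cabs z + cabs w.
Proof. exact: le_normcD. Qed.

Lemma cabsB z w : cabs (z - w) <= cabs z + cabs w.
Proof. by rewrite -(cabsN w); exact: cabsD. Qed.

Lemma cabsC z w : cabs (z - w) = cabs (w - z).
Proof. by rewrite -cabsN opprB. Qed.

Lemma cabs_tri y z w : cabs (z - w) <= cabs (z - y) + cabs (y - w).
Proof. by have := cabsD (z - y) (y - w); rewrite addrA subrK. Qed.

Lemma ler_cabsB z w : cabs z - cabs w <= cabs (z - w).
Proof. by rewrite lerBlDr; have := cabsD (z - w) w; rewrite subrK. Qed.

Lemma cabs_dist z w : `|cabs z - cabs w| <= cabs (z - w).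
Proof. by rewrite ler_norml lerNl opprB ler_cabsB andbT cabsC ler_cabsB. Qed.

Lemma cabs_eq0 z : (cabs z == 0) = (z == 0).
Proof.
by apply/eqP/eqP => [|->]; [exact: Normc.eq0_normc|exact: cabs0].
Qed.

Lemma cabsX z n : cabs (z ^+ n) = cabs z ^+ n.
Proof. by elim: n => [|n IH]; rewrite ?expr0 ?cabs1// !exprS cabsM IH. Qed.

Lemma cabs_sum (I : Type) (r : seq I) (P : pred I) (F : I -> C) :
  cabs (\sum_(i <- r | P i) F i) <= \sum_(i <- r | P i) cabs (F i).
Proof.
elim/big_rec2: _ => [|i a b _ h]; first by rewrite cabs0.
by apply: (le_trans (cabsD _ _)); rewrite lerD2l.
Qed.

Lemma cabs_real (a : R) : cabs (a%:C)%C = `|a|.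
Proof. by rewrite /cabs /= expr0n addr0 sqrtr_sqr. Qed.

Lemma cabs_nat n : cabs (n%:R : C) = n%:R.
Proof.
have -> : (n%:R : C) = ((n%:R : R)%:C)%C by rewrite rmorph_nat.
by rewrite cabs_real ger0_norm.
Qed.

Lemma cabs_sqr z : cabs z ^+ 2 = complex.Re z ^+ 2 + complex.Im z ^+ 2.
Proof. by case: z => a b; rewrite /cabs /= sqr_sqrtr// addr_ge0 ?sqr_ge0. Qed.

Lemma Re_le_cabs z : `|complex.Re z| <= cabs z.
Proof.
rewrite -[leLHS]sqrtr_sqr -[leRHS](ger0_norm (cabs_ge0 z)) -[leRHS]sqrtr_sqr.
by rewrite ler_wsqrtr// cabs_sqr lerDl sqr_ge0.
Qed.

Lemma Im_le_cabs z : `|complex.Im z| <= cabs z.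
Proof.
rewrite -[leLHS]sqrtr_sqr -[leRHS](ger0_norm (cabs_ge0 z)) -[leRHS]sqrtr_sqr.
by rewrite ler_wsqrtr// cabs_sqr lerDr sqr_ge0.
Qed.

Lemma cabs_le_ReIm z : cabs z <= `|complex.Re z| + `|complex.Im z|.
Proof.
rewrite -(@ler_pXn2r _ 2)// ?nnegrE ?cabs_ge0 ?addr_ge0// cabs_sqr sqrrD.
by rewrite !real_normK ?num_real// addrAC lerDl mulrn_wge0// mulr_ge0.
Qed.

Lemma cabs_conj z : cabs (conjc z) = cabs z.
Proof. by case: z => a b; rewrite /cabs /= sqrrN. Qed.

Lemma mul_conjc z : z * conjc z = ((cabs z ^+ 2)%:C)%C.
Proof.
rewrite cabs_sqr; case: z => a b /=.
by apply/eqP; rewrite eq_complex /=; apply/andP; split; apply/eqP; ring.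
Qed.

Lemma unimodular_conj z : cabs z = 1 -> z * conjc z = 1.
Proof. by move=> h; rewrite mul_conjc h expr1n. Qed.

(** Replaces the modulus of a sum or an integral by the real part of a rotated one, which is
    linear. *)
Lemma phase_exists z : exists2 u : C, cabs u = 1 & u * z = ((cabs z)%:C)%C.
Proof.
have [->|z0] := eqVneq z 0.
  by exists 1; rewrite ?cabs1// mulr0 cabs0.
have cz0 : cabs z != 0 by rewrite cabs_eq0.
exists (conjc z * ((cabs z)^-1%:C)%C).
  by rewrite cabsM cabs_conj cabs_real ger0_norm ?invr_ge0 ?cabs_ge0// mulfV.
rewrite mulrAC [conjc z * z]mulrC mul_conjc -rmorphM /=.
by congr (_%:C)%C; field.
Qed.

Lemma cabs_expi (t : R) : cabs (expi t) = 1.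
Proof. by rewrite /cabs /= cos2Dsin2 sqrtr1. Qed.

Lemma expiD (s t : R) : expi (s + t) = expi s * expi t.
Proof.
rewrite /expi cosD sinD; apply/eqP; rewrite eq_complex /=.
by apply/andP; split; apply/eqP; ring.
Qed.

Lemma expi0 : expi (0 : R) = 1.
Proof. by rewrite /expi cos0 sin0. Qed.

Lemma expiX (t : R) n : expi t ^+ n = expi (t *+ n).
Proof. by elim: n => [|n IH]; rewrite ?expi0// exprS IH -expiD mulrS. Qed.

Lemma expi2pi : expi (2 * pi : R) = 1.
Proof. by rewrite /expi mulr_natl cos2pi sin2pi. Qed.

(** Half-angle formula: [cos t = 1] would force [sin (t / 2) = 0], while [t / 2] lies strictly
    between 0 and [pi]. *)
Lemma expi_eq1 (t : R) : 0 < t < 2 * pi -> expi t != 1.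
Proof.
move=> /andP[t0 t2]; apply/eqP => h.
have c1 : cos t = 1 by have := congr1 (@complex.Re R) h.
have : cos t = 1 - sin (t / 2) ^+ 2 *+ 2.
  rewrite {1}(_ : t = t / 2 + t / 2); last by field.
  by rewrite cosD; have := cos2Dsin2 (t / 2); rewrite -mulr_natr; lra.
rewrite c1 => h2; have s0 : sin (t / 2) = 0.
  by apply/eqP; rewrite -sqrf_eq0; apply/eqP; move: h2; rewrite -mulr_natr; lra.
have : 0 < sin (t / 2) by apply: sin_gt0_pi; lra.
by rewrite s0 ltxx.
Qed.

Lemma polar_exists z : exists2 t : R, 0 <= t <= 2 * pi & z = ((cabs z)%:C)%C * expi t.
Proof.
have [->|z0] := eqVneq z 0.
  by exists 0; rewrite ?lexx ?mulr_ge0 ?pi_ge0// cabs0 mul0r.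
have cz0 : cabs z != 0 by rewrite cabs_eq0.
have czp : 0 < cabs z by rewrite lt_def cz0 cabs_ge0.
pose a := complex.Re z / cabs z; pose b := complex.Im z / cabs z.
have ab : a ^+ 2 + b ^+ 2 = 1.
  by rewrite !expr_div_n -mulrDl -cabs_sqr divff// expf_neq0.
have a1 : -1 <= a <= 1.
  rewrite -ler_norml -(@ler_pXn2r _ 2)// ?nnegrE// expr1n real_normK ?num_real//.
  by rewrite -ab lerDl sqr_ge0.
have sa : sin (acos a) = `|b|.
  by rewrite sin_acos// -sqrtr_sqr -ab addrAC subrr add0r.
have ra := @acos_ge0 R a; have rb := @acos_lepi R a.
have eqz t : cos t = a -> sin t = b -> z = ((cabs z)%:C)%C * expi t.
  move=> ha hb; rewrite /expi ha hb /a /b; case: (z) cz0 => c d cz0.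
  by apply/eqP; rewrite eq_complex /= !mul0r subr0 addr0; apply/andP; split; apply/eqP; field.
have [b0|b0] := leP 0 b.
  exists (acos a); first by rewrite ra//=; have := rb a1; have := @pi_ge0 R; lra.
  by apply: eqz; rewrite ?acosK ?in_itv// sa ger0_norm.
(* [acos] covers the upper half circle only. The reflected angle stays in [[0, 2 pi]], the range
   that the periodicity argument for circle means accepts. *)
exists (2 * pi - acos a).
  by have := ra a1; have := rb a1; have := @pi_ge0 R; lra.
rewrite mulr_natl addrC; apply: eqz.
  by rewrite cosD cos2pi sin2pi mulr1 mulr0 subr0 cosN acosK// in_itv.
by rewrite sinD cos2pi sin2pi mulr1 mulr0 addr0 sinN sa ltr0_norm// opprK.
Qed.

(** Complex limits are kept as null sequences of reals, the form in which [analytic_D] and weak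
    convergence are stated. *)
Definition ccvg u (l : C) : Prop := (fun n => cabs (u n - l)) @ \oo --> (0 : R).

Lemma real_cvg0P (x : nat -> R) : (forall n, 0 <= x n) ->
  x @ \oo --> (0 : R) <-> forall e : R, 0 < e ->
    exists N, forall n, (N <= n)%N -> x n < e.
Proof.
move=> x0; split.
  move/cvgrPdist_lt => h e e0; have [N _ hN] := h _ e0.
  by exists N => n Nn; have := hN n Nn; rewrite /= sub0r normrN ger0_norm.
move=> h; apply/cvgrPdist_lt => e e0; have [N hN] := h e e0.
by exists N => // n Nn /=; rewrite sub0r normrN ger0_norm// hN.
Qed.

Lemma ccvgP u (l : C) : ccvg u l <-> forall e : R, 0 < e ->
    exists N, forall n, (N <= n)%N -> cabs (u n - l) < e.
Proof. by apply: real_cvg0P => n; exact: cabs_ge0. Qed.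

Lemma ccvg_cst (l : C) : ccvg (fun=> l) l.
Proof. by apply/ccvgP => e e0; exists 0%N => n _; rewrite subrr cabs0. Qed.

Lemma ccvg_le u (l : C) (x : nat -> R) : x @ \oo --> (0 : R) ->
  (forall n, cabs (u n - l) <= x n) -> ccvg u l.
Proof.
move=> x0 h; apply: (@squeeze_cvgr _ _ _ _ (fun=> 0) x) => //; last exact: cvg_cst.
by apply: nearW => n; rewrite cabs_ge0 h.
Qed.

Lemma ccvgD u v (a b : C) : ccvg u a -> ccvg v b -> ccvg (fun n => u n + v n) (a + b).
Proof.
move=> ua vb; apply: (@ccvg_le _ _ (fun n => cabs (u n - a) + cabs (v n - b))).
  by rewrite -[0]addr0; exact: cvgD.
by move=> n; rewrite opprD addrACA cabsD.
Qed.

Lemma ccvgZ u (c a : C) : ccvg u a -> ccvg (fun n => c * u n) (c * a).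
Proof.
move=> ua; apply: (@ccvg_le _ _ (fun n => cabs c * cabs (u n - a))).
  by rewrite -[0](mulr0 (cabs c)); apply: cvgM => //; exact: cvg_cst.
by move=> n; rewrite -mulrBr cabsM.
Qed.

Lemma ccvgN u (a : C) : ccvg u a -> ccvg (fun n => - u n) (- a).
Proof. by move=> /(ccvgZ (-1)); rewrite mulN1r; under eq_fun do rewrite mulN1r. Qed.

Lemma ccvgB u v (a b : C) : ccvg u a -> ccvg v b -> ccvg (fun n => u n - v n) (a - b).
Proof. by move=> ua /ccvgN; exact: ccvgD. Qed.

Lemma ccvg_cabs u (a : C) : ccvg u a -> (fun n => cabs (u n)) @ \oo --> cabs a.
Proof.
move=> /ccvgP h; apply/cvgrPdist_lt => e /h[N hN]; exists N => // n Nn /=.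
by apply: le_lt_trans (cabs_dist _ _) _; rewrite cabsC; exact: hN.
Qed.

Lemma ccvg_Re u (a : C) : ccvg u a -> (fun n => complex.Re (u n)) @ \oo --> complex.Re a.
Proof.
move=> /ccvgP h; apply/cvgrPdist_lt => e /h[N hN]; exists N => // n Nn /=.
apply: le_lt_trans (hN n Nn); rewrite cabsC; apply: le_trans (Re_le_cabs _).
by rewrite raddfB.
Qed.

Lemma ccvg_Im u (a : C) : ccvg u a -> (fun n => complex.Im (u n)) @ \oo --> complex.Im a.
Proof.
move=> /ccvgP h; apply/cvgrPdist_lt => e /h[N hN]; exists N => // n Nn /=.
apply: le_lt_trans (hN n Nn); rewrite cabsC; apply: le_trans (Im_le_cabs _).
by rewrite raddfB.
Qed.

Lemma ccvg_ReIm u (a : C) :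
  (fun n => complex.Re (u n)) @ \oo --> complex.Re a ->
  (fun n => complex.Im (u n)) @ \oo --> complex.Im a -> ccvg u a.
Proof.
move=> hr hi; apply: (@ccvg_le _ _ (fun n =>
   `|complex.Re (u n) - complex.Re a| + `|complex.Im (u n) - complex.Im a|)).
  rewrite -[0]addr0; apply: cvgD; rewrite -[0](@normr0 R R).
    by apply: cvg_norm; rewrite -(subrr (complex.Re a)); apply: cvgB => //; exact: cvg_cst.
  by apply: cvg_norm; rewrite -(subrr (complex.Im a)); apply: cvgB => //; exact: cvg_cst.
by move=> n; apply: le_trans (cabs_le_ReIm _) _; rewrite !raddfB.
Qed.

Lemma ccvg_unique u (a b : C) : ccvg u a -> ccvg u b -> a = b.
Proof.
move=> ua ub; have := ccvgB ua ub.
move=> /ccvg_cabs; under eq_fun do rewrite subrr cabs0.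
move/cvg_lim => /(_ (@norm_hausdorff _ _)); rewrite lim_cst; last exact: norm_hausdorff.
by move/esym/eqP; rewrite cabs_eq0 subr_eq0 => /eqP.
Qed.

Lemma ccvg_lim_le u (a : C) (M : R) : ccvg u a ->
  (exists N, forall n, (N <= n)%N -> cabs (u n) <= M) -> cabs a <= M.
Proof.
move=> /ccvg_cabs h [N hN]; rewrite -(cvg_lim (@norm_hausdorff _ _) h).
apply: limr_le; first by apply/cvg_ex; exists (cabs a).
by exists N => // n; exact: hN.
Qed.

Lemma ccauchy u : (forall e : R, 0 < e -> exists N, forall n m,
    (N <= n)%N -> (N <= m)%N -> cabs (u n - u m) < e) -> exists l, ccvg u l.
Proof.
move=> h.
have aux (T : C -> R) : (forall z w, `|T z - T w| <= cabs (z - w)) ->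
    cvgn (fun n => T (u n)).
  move=> hT; apply/cauchy_cvgP/cauchy_exP => e e0.
  have [N hN] := h e e0; exists (T (u N)), N => // n /= Nn.
  by rewrite /ball /=; apply: le_lt_trans (hT _ _) _; exact: hN.
have hr : forall z w, `|complex.Re z - complex.Re w| <= cabs (z - w).
  by move=> z w; rewrite -raddfB; exact: Re_le_cabs.
have hi : forall z w, `|complex.Im z - complex.Im w| <= cabs (z - w).
  by move=> z w; rewrite -raddfB; exact: Im_le_cabs.
exists ((limn (fun n => complex.Re (u n)) +i* limn (fun n => complex.Im (u n)))%C).
by apply: ccvg_ReIm; exact: aux.
Qed.

End Modulus.

(** * Power series: coefficient bounds, averages over rotations, maximum principle, closure
    properties *)

Section PowerSeries.
Variable R : realType.
Local Notation C := R[i].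
Implicit Types (a : nat -> C) (f h : C -> C) (z : C).

Lemma expr_small (q K e : R) : 0 <= q -> q < 1 -> 0 <= K -> 0 < e ->
  exists N, forall n, (N <= n)%N -> K * q ^+ n < e.
Proof.
move=> q0 q1 K0 e0.
have h : (fun n => K * q ^+ n) @ \oo --> (0 : R).
  rewrite -[0](mulr0 K); apply: cvgM; first exact: cvg_cst.
  by apply: cvg_expr; rewrite ger0_norm.
by have /real_cvg0P := h; apply => // n; rewrite mulr_ge0// exprn_ge0.
Qed.

Lemma geom_sum_le (q : R) n : 0 <= q -> q < 1 -> \sum_(k < n) q ^+ k <= (1 - q)^-1.
Proof.
move=> q0 q1; have q1' : 0 < 1 - q by rewrite subr_gt0.
rewrite -(ler_pM2l q1') mulfV ?gt_eqF// -opprB mulNr -subrX1 opprB.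
by rewrite gerBl exprn_ge0.
Qed.

Definition psum a n z : C := \sum_(k < n) a k * z ^+ k.

Definition has_series a f : Prop :=
  forall z, cabs z < 1 -> ccvg (fun n => psum a n z) (f z).

Lemma analyticP f : analytic_D f <-> exists a, has_series a f.
Proof.
by split=> -[a h]; exists a => z /h; rewrite /ccvg; under eq_fun do rewrite cabsC.
Qed.

Lemma series_eq a f h : has_series a f ->
  (forall z, cabs z < 1 -> f z = h z) -> has_series a h.
Proof. by move=> af fh z z1; rewrite -fh//; exact: af. Qed.

Lemma analytic_eq f h : analytic_D f ->
  (forall z, cabs z < 1 -> f z = h z) -> analytic_D h.
Proof.
by move=> /analyticP[a af] fh; apply/analyticP; exists a; exact: series_eq fh.
Qed.

(** Terms of a convergent series are bounded: once the partial sums at [r] are within 1 of the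
    limit, consecutive ones differ by less than 2; the finitely many earlier terms are simply added
    up. *)
Lemma coef_growth a f (r : R) : has_series a f -> 0 <= r -> r < 1 ->
  exists2 K : R, 0 <= K & forall k, cabs (a k) * r ^+ k <= K.
Proof.
move=> af r0 r1.
have rc : cabs (r%:C)%C = r by rewrite cabs_real ger0_norm.
have /ccvgP/(_ 1 ltr01)[N hN] : ccvg (fun n => psum a n (r%:C)%C) (f (r%:C)%C).
  by apply: af; rewrite rc.
have s0 : 0 <= \sum_(k < N) cabs (a k) * r ^+ k.
  by apply: sumr_ge0 => i _; rewrite mulr_ge0 ?cabs_ge0 ?exprn_ge0.
exists (2 + \sum_(k < N) cabs (a k) * r ^+ k); first lra.
move=> k; have [Nk|kN] := leqP N k; last first.
  rewrite (bigD1 (Ordinal kN)) //= addrCA lerDl.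
  by rewrite addr_ge0// sumr_ge0// => i _; rewrite mulr_ge0 ?cabs_ge0 ?exprn_ge0.
have h1 := hN k Nk; have h2 := hN k.+1 (leqW Nk).
have -> : cabs (a k) * r ^+ k = cabs (psum a k.+1 (r%:C)%C - psum a k (r%:C)%C).
  by rewrite /psum big_ord_recr /= addrAC subrr add0r cabsM cabsX rc.
have := cabs_tri (f (r%:C)%C) (psum a k.+1 (r%:C)%C) (psum a k (r%:C)%C).
by rewrite (cabsC (f _)); lra.
Qed.

(** Comparison with a geometric series of ratio [cabs z / r]. The bound does not depend on [m], so
    it survives the passage to the full tail. *)
Lemma psum_diff a (r K : R) z n m : 0 < r -> (forall k, cabs (a k) * r ^+ k <= K) ->
  cabs z < r ->
  cabs (psum a (n + m) z - psum a n z) <= K * (cabs z / r) ^+ n / (1 - cabs z / r).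
Proof.
move=> r0 aK zr; set q := cabs z / r.
have q0 : 0 <= q by rewrite divr_ge0 ?cabs_ge0// ltW.
have q1 : q < 1 by rewrite ltr_pdivrMr ?mul1r.
have K0 : 0 <= K by apply: le_trans (aK 0%N); rewrite expr0 mulr1 cabs_ge0.
rewrite /psum big_split_ord /= addrAC subrr add0r.
apply: le_trans (cabs_sum _ _ _) _.
apply: (@le_trans _ _ (\sum_(k < m) K * q ^+ n * q ^+ k)).
  apply: ler_sum => k _; rewrite cabsM cabsX -mulrA -exprD.
  have -> : cabs z = r * q by rewrite /q mulrC divfK// gt_eqF.
  by rewrite exprMn mulrA ler_wpM2r ?exprn_ge0.
rewrite -mulr_sumr; apply: ler_wpM2l; first by rewrite mulr_ge0// exprn_ge0.
exact: geom_sum_le.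
Qed.

Lemma series_tail a f (r K : R) z n : has_series a f -> 0 < r -> r <= 1 ->
  (forall k, cabs (a k) * r ^+ k <= K) -> cabs z < r ->
  cabs (f z - psum a n z) <= K * (cabs z / r) ^+ n / (1 - cabs z / r).
Proof.
move=> af r0 r1 aK zr.
have z1 : cabs z < 1 by exact: lt_le_trans r1.
apply: (ccvg_lim_le (u := fun m => psum a m z - psum a n z)).
  by apply: ccvgB; [exact: af|exact: ccvg_cst].
exists n => m nm; rewrite -(subnKC nm); exact: psum_diff.
Qed.

Lemma series_unif a f (s : R) : has_series a f -> 0 <= s -> s < 1 ->
  forall e : R, 0 < e -> exists N, forall n, (N <= n)%N ->
  forall z, cabs z <= s -> cabs (f z - psum a n z) < e.
Proof.
(* A radius strictly between [s] and 1 makes the ratio [s / r] smaller than 1 while the coefficients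
   remain controlled at [r]. *)
move=> af s0 s1 e e0; pose r := (1 + s) / 2.
have r0 : 0 < r by rewrite /r; lra.
have r1 : r < 1 by rewrite /r; lra.
have sr : s < r by rewrite /r; lra.
have [K K0 aK] := coef_growth af (ltW r0) r1.
pose q := s / r.
have q0 : 0 <= q by rewrite divr_ge0// ltW.
have q1 : q < 1 by rewrite ltr_pdivrMr ?mul1r.
have q1' : 0 < 1 - q by rewrite subr_gt0.
have [N hN] := @expr_small q (K / (1 - q)) e q0 q1 (divr_ge0 K0 (ltW q1')) e0.
exists N => n Nn z zs; apply: le_lt_trans (hN n Nn).
have zr : cabs z < r by exact: le_lt_trans sr.
apply: le_trans (series_tail n af r0 (ltW r1) aK zr) _.
rewrite [leRHS]mulrAC.
have zq : cabs z / r <= q by rewrite ler_pM2r ?invr_gt0.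
have zq0 : 0 <= cabs z / r by rewrite divr_ge0 ?cabs_ge0 ?ltW.
apply: ler_pM.
- by rewrite mulr_ge0// exprn_ge0.
- by rewrite invr_ge0 subr_ge0; exact: ltW (le_lt_trans zq q1).
- by apply: ler_wpM2l => //; rewrite lerXn2r ?nnegrE.
- by rewrite lef_pV2 ?posrE ?lerD2l ?lerN2// subr_gt0 (le_lt_trans zq q1).
Qed.

Lemma series_poly (P : {poly C}) : has_series (fun k => P`_k) (horner P).
Proof.
move=> z _; apply/ccvgP => e e0; exists (size P) => n Pn.
suff -> : psum (fun k => P`_k) n z = P.[z] by rewrite subrr cabs0.
by rewrite /psum (horner_coef_wide z Pn).
Qed.

Lemma psum_poly a n z : psum a n z = (\poly_(i < n) a i).[z].
Proof. by rewrite horner_poly. Qed.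

Lemma series_lin a b f h (c d : C) : has_series a f -> has_series b h ->
  has_series (fun k => c * a k + d * b k) (fun z => c * f z + d * h z).
Proof.
move=> af bh z z1.
have -> : (fun n => psum (fun k => c * a k + d * b k) n z) =
          (fun n => c * psum a n z + d * psum b n z).
  apply/funext => n; rewrite /psum !mulr_sumr -big_split /=.
  by apply: eq_bigr => k _; ring.
by apply: ccvgD; apply: ccvgZ; [exact: af|exact: bh].
Qed.

Lemma series_dilate a f (w : C) : cabs w <= 1 -> has_series a f ->
  has_series (fun k => a k * w ^+ k) (fun z => f (w * z)).
Proof.
move=> w1 af z z1.
have -> : (fun n => psum (fun k => a k * w ^+ k) n z) = (fun n => psum a n (w * z)).
  by apply/funext => n; apply: eq_bigr => k _; rewrite exprMn mulrA.
apply: af; rewrite cabsM; apply: le_lt_trans z1.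
by rewrite ler_piMl// cabs_ge0.
Qed.

Lemma ccvg_sum (n : nat) (u : 'I_n -> nat -> C) (l : 'I_n -> C) :
  (forall i, ccvg (u i) (l i)) -> ccvg (fun m => \sum_(i < n) u i m) (\sum_(i < n) l i).
Proof.
elim: n u l => [|n IH] u l ul.
  by under eq_fun do rewrite big_ord0; rewrite big_ord0; exact: ccvg_cst.
under eq_fun do rewrite big_ord_recr; rewrite big_ord_recr.
by apply: ccvgD => //; apply: IH.
Qed.

(** Discrete substitute for convolution with a kernel on the circle: [mu] is the sequence of its
    Fourier multipliers, and [avg_mass] says that its total variation is at most 1. *)
Record averaging (L : nat -> nat) (c w : nat -> nat -> C) (mu : nat -> C) : Prop := {
  avg_unimodular : forall n j, cabs (w n j) = 1;
  avg_mass : forall n, \sum_(j < L n) cabs (c n j) <= 1;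
  avg_mult : forall m, ccvg (fun n => \sum_(j < L n) c n j * w n j ^+ m) (mu m) }.

(** All points [w n j * z] lie on one circle, where the tail of [f] is uniformly small; mass at most
    1 keeps the averaged tail small, and the remaining finitely many coefficients converge by
    [avg_mult]. *)
Lemma averaging_cvg a f h L c w mu : averaging L c w mu ->
  has_series a f -> has_series (fun m => a m * mu m) h ->
  forall z, cabs z < 1 -> ccvg (fun n => \sum_(j < L n) c n j * f (w n j * z)) (h z).
Proof.
move=> [w1 c1 cmu] af ah z z1; apply/ccvgP => e e0.
have e3 : 0 < e / 3 by lra.
have [M1 hM1] := series_unif af (cabs_ge0 z) z1 e3.
have [M2 hM2] := series_unif ah (cabs_ge0 z) z1 e3.
pose M := maxn M1 M2.
have : ccvg (fun n => \sum_(m < M) (a m * z ^+ m) * \sum_(j < L n) c n j * w n j ^+ m)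
            (\sum_(m < M) (a m * z ^+ m) * mu m).
  by apply: ccvg_sum => m; apply: ccvgZ; exact: cmu.
move=> /ccvgP/(_ _ e3)[N hN]; exists N => n /hN {}hN.
have hM1' := hM1 M (leq_maxl _ _).
have hM2' := hM2 M (leq_maxr _ _) z (lexx _).
have eqh : psum (fun m => a m * mu m) M z = \sum_(m < M) (a m * z ^+ m) * mu m.
  by apply: eq_bigr => m _; ring.
have eqf : \sum_(j < L n) c n j * psum a M (w n j * z) =
           \sum_(m < M) (a m * z ^+ m) * \sum_(j < L n) c n j * w n j ^+ m.
  under [LHS]eq_bigr do rewrite mulr_sumr; rewrite exchange_big /=.
  apply: eq_bigr => m _; rewrite mulr_sumr; apply: eq_bigr => j _.
  by rewrite exprMn; ring.
have h1 : cabs (\sum_(j < L n) c n j * f (w n j * z) -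
                \sum_(j < L n) c n j * psum a M (w n j * z)) <= e / 3.
  rewrite -sumrB; apply: le_trans (cabs_sum _ _ _) _.
  apply: (@le_trans _ _ (\sum_(j < L n) cabs (c n j) * (e / 3))).
    apply: ler_sum => j _; rewrite -mulrBr cabsM ler_wpM2l ?cabs_ge0//.
    by apply/ltW/hM1'; rewrite cabsM w1 mul1r.
  by rewrite -mulr_suml ler_piMl// ltW.
rewrite eqf in h1; rewrite eqh cabsC in hM2'.
set A := (X in cabs (X - h z)) in h1 *.
set B := (X in cabs (_ - X)) in h1; set D := (X in cabs (_ - X)) in hN.
have := cabs_tri B A (h z); have := cabs_tri D B (h z).
lra.
Qed.

(** Geometric sum of an [L]-th root of unity [x]: it vanishes unless [x = 1], and exponents below
    [L] exclude [x = 1] when [a] and [b] differ. *)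
Lemma root_orth (L a b : nat) : (a < L)%N -> (b < L)%N ->
  \sum_(j < L) (expi (2 * pi / L%:R : R) ^+ a * conjc (expi (2 * pi / L%:R : R)) ^+ b) ^+ j
  = (if a == b then L%:R else 0 : C).
Proof.
move=> aL bL; set w := expi _.
have L0 : (0 < L%:R :> R) by rewrite ltr0n (leq_ltn_trans _ aL).
have w1 : w * conjc w = 1 by rewrite unimodular_conj ?cabs_expi.
have wL : w ^+ L = 1.
  rewrite /w expiX -expi2pi; congr expi; rewrite -mulr_natr; field.
  by rewrite gt_eqF.
have cwL : conjc w ^+ L = 1 by rewrite -rmorphXn wL rmorph1.
have key d : (0 < d < L)%N -> w ^+ d != 1.
  move=> /andP[d0 dL]; rewrite /w expiX; apply: expi_eq1; rewrite -[_ *+ d]mulr_natr.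
  have p0 := @pi_gt0 R; apply/andP; split.
    by rewrite mulr_gt0 ?ltr0n// divr_gt0// mulr_gt0.
  by rewrite mulrAC ltr_pdivrMr// ltr_pM2l ?ltr_nat// mulr_gt0.
have [->|ab] := eqVneq a b.
  rewrite -exprMn w1 expr1n; under eq_bigr do rewrite expr1n.
  by rewrite sumr_const card_ord.
set x := _ * _.
have x1 : x != 1.
  have [lab|lab] := ltnP a b.
    have -> : x = conjc w ^+ (b - a).
      by rewrite /x -{1}(subnKC (ltnW lab)) exprD mulrA -exprMn w1 expr1n mul1r.
    rewrite -rmorphXn fmorph_eq1; apply: key; lia.
  have -> : x = w ^+ (a - b).
    by rewrite /x -{1}(subnK lab) exprD -mulrA -exprMn w1 expr1n mulr1.
  by apply: key; lia.
apply: (@mulfI _ (x - 1)); first by rewrite subr_eq0.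
by rewrite -subrX1 mulr0 /x exprMn -!exprM ![(_ * L)%N]mulnC !exprM wL cwL !expr1n mulr1 subrr.
Qed.

(** Discrete Fourier coefficient over the roots of unity of order [n.+1]; its multiplier keeps the
    coefficient of index [k] and kills all others. *)
Lemma fourier_averaging (k : nat) :
  averaging (fun n => n.+1)
    (fun n j => conjc (expi (2 * pi / n.+1%:R)) ^+ k ^+ j / n.+1%:R)
    (fun n j => expi (2 * pi / n.+1%:R) ^+ j) (fun m => (m == k)%:R).
Proof.
have n0 n : (n.+1%:R : C) != 0 by rewrite pnatr_eq0.
split.
- by move=> n j; rewrite cabsX cabs_expi expr1n.
- move=> n; under eq_bigr do
    rewrite cabsM cabsV cabs_nat !cabsX cabs_conj cabs_expi !expr1n mul1r.
  by rewrite sumr_const card_ord -[X in X <= 1]mulr_natr mulVf// pnatr_eq0.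
(* From this index on both exponents are below the order [n.+1], and the identity is exact. *)
- move=> m; apply/ccvgP => e e0; exists (m + k)%N => n mkn.
  suff -> : \sum_(j < n.+1) conjc (expi (2 * pi / n.+1%:R)) ^+ k ^+ j / n.+1%:R *
     expi (2 * pi / n.+1%:R) ^+ j ^+ m = (m == k)%:R :> C by rewrite subrr cabs0.
  rewrite (eq_bigr (fun j : 'I_n.+1 => (expi (2 * pi / n.+1%:R : R) ^+ m *
     conjc (expi (2 * pi / n.+1%:R : R)) ^+ k) ^+ j / n.+1%:R)); last first.
    by move=> j _; rewrite exprMn (exprAC _ j m) mulrAC; congr (_ / _); rewrite mulrC.
  rewrite -mulr_suml root_orth; [|lia|lia].
  by case: eqP => _; rewrite ?mul0r// mulfV.
Qed.

Lemma fourier_cvg a f k z : has_series a f -> cabs z < 1 ->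
  ccvg (fun n => \sum_(j < n.+1) conjc (expi (2 * pi / n.+1%:R)) ^+ k ^+ j / n.+1%:R *
    f (expi (2 * pi / n.+1%:R) ^+ j * z)) (a k * z ^+ k).
Proof.
move=> af; move: z; apply: (averaging_cvg (fourier_averaging k) af).
move=> z _; apply/ccvgP => e e0; exists k.+1 => n kn.
rewrite /psum (bigD1 (Ordinal kn)) //= eqxx mulr1 big1; last first.
  move=> i /eqP ik; rewrite (_ : (val i == k) = false) ?mulr0 ?mul0r//.
  by apply/eqP => ?; apply: ik; apply: val_inj.
by rewrite addr0 subrr cabs0.
Qed.

(** The [k]-th term at the point [r] is a limit of sums of values of [f] on the circle of radius
    [r], with [n.+1] weights of modulus [1 / n.+1]. *)
Lemma cauchy_estimate a f (r M : R) k : has_series a f -> 0 <= r -> r < 1 ->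
  (forall z, cabs z = r -> cabs (f z) <= M) -> cabs (a k) * r ^+ k <= M.
Proof.
move=> af r0 r1 fM.
have rc : cabs (r%:C)%C = r by rewrite cabs_real ger0_norm.
have M0 : 0 <= M by apply: le_trans (fM _ rc); exact: cabs_ge0.
rewrite -{1}rc -cabsX -cabsM.
have := @fourier_cvg a f k (r%:C)%C af; rewrite rc => /(_ r1) h.
apply: (ccvg_lim_le h); exists 0%N => n _.
apply: le_trans (cabs_sum _ _ _) _.
apply: (@le_trans _ _ (\sum_(j < n.+1) n.+1%:R^-1 * M)).
  apply: ler_sum => j _; rewrite !cabsM cabsV cabs_nat !cabsX cabs_conj cabs_expi.
  rewrite !expr1n mul1r ler_wpM2l// fM// cabsM cabsX cabs_expi expr1n mul1r//.
by rewrite sumr_const card_ord -[X in X <= M]mulr_natl mulrA mulfV ?mul1r// pnatr_eq0.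
Qed.

(** The Poisson kernel is [(1 - q ^ 2) / |1 - q w| ^ 2]. Here [1 / (1 - q w)] is truncated to [D],
    and the weights are proportional to [|D| ^ 2], which keeps them nonnegative. The [m]-th moment
    is [q ^ m] up to the factor [1 - q ^ (2 (n + 1 - m))]. *)
Lemma poisson_averaging (q : R) : 0 <= q -> q < 1 ->
  exists L c w, averaging L c w (fun m => (q%:C)%C ^+ m).
Proof.
move=> q0 q1.
have q21 : 0 < 1 - q ^+ 2 by rewrite subr_gt0 exprn_ilt1.
(* The exponents [k + m] reach [2 n], so orthogonality is needed for roots of unity of twice the
   order. *)
pose L n := (n.+1 + n.+1)%N.
pose om n : C := expi (2 * pi / (L n)%:R).
pose D n j : C := \sum_(k < n.+1) ((q ^+ k)%:C)%C * om n ^+ k ^+ j.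
pose c n j : C := (((1 - q ^+ 2) / (L n)%:R)%:C)%C * (D n j * conjc (D n j)).
have L0 n : 0 < (L n)%:R :> R by rewrite ltr0n.
have mult n m : (m <= n)%N -> \sum_(j < L n) c n j * om n ^+ j ^+ m =
    ((q ^+ m * (1 - (q ^+ 2) ^+ (n.+1 - m)))%:C)%C.
  move=> mn.
  have E1 (j : nat) : D n j * conjc (D n j) * om n ^+ j ^+ m =
     \sum_(k < n.+1) \sum_(l < n.+1) ((q ^+ (k + l))%:C)%C *
        (om n ^+ (k + m) * conjc (om n) ^+ l) ^+ j.
    have -> : conjc (D n j) = \sum_(l < n.+1) ((q ^+ l)%:C)%C * conjc (om n) ^+ l ^+ j.
      rewrite /D; move: (om n) => v; rewrite raddf_sum; apply: eq_bigr => l _.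
      rewrite [LHS]/= (rmorphM (@conjc R)) (rmorphXn (@conjc R)) (rmorphXn (@conjc R)).
      by congr (_ * _); exact: conjc_real.
    move: (conjc (om n)) => v.
    rewrite /D mulr_suml mulr_suml; apply: eq_bigr => k _.
    rewrite mulr_sumr mulr_suml; apply: eq_bigr => l _.
    rewrite [om n ^+ j ^+ m]exprAC !exprMn !exprD rmorphM !exprMn.
    move: (om n ^+ k ^+ j) (v ^+ l ^+ j) (om n ^+ m ^+ j) => x y z /=; ring.
  under eq_bigr => j _ do rewrite /c -mulrA E1.
  rewrite -mulr_sumr exchange_big /=.
  under eq_bigr => k _ do rewrite exchange_big /=.
  have E2 (k l : 'I_n.+1) : \sum_(j < L n) ((q ^+ (k + l))%:C)%C *
        (om n ^+ (k + m) * conjc (om n) ^+ l) ^+ j =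
        if (k + m)%N == l then ((q ^+ (k + l) * (L n)%:R)%:C)%C else 0.
    rewrite -mulr_sumr root_orth; last 2 first.
    - by rewrite /L; have := ltn_ord k; lia.
    - by rewrite /L; have := ltn_ord l; lia.
    by case: ifP => _; rewrite ?mulr0// rmorphM /= rmorph_nat.
  under eq_bigr => k _ do under eq_bigr => l _ do rewrite E2.
  have E3 (k : 'I_n.+1) : \sum_(l < n.+1) (if (k + m)%N == l then
      ((q ^+ (k + l) * (L n)%:R)%:C)%C else 0) =
      if (k < n.+1 - m)%N then ((q ^+ m * (q ^+ 2) ^+ k * (L n)%:R)%:C)%C else 0.
    case: ifP => h.
      have kmn : (k + m < n.+1)%N by lia.
      rewrite (bigD1 (Ordinal kmn)) //= eqxx big1 ?addr0; last first.
        by move=> i /eqP ik; case: eqP => // e; case: ik; apply: val_inj.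
      by congr (_%:C)%C; rewrite -exprM !exprD; ring.
    rewrite big1// => i _; case: eqP => // e.
    by move: h; have := ltn_ord i; lia.
  under eq_bigr => k _ do rewrite E3.
  rewrite -big_mkcond /= -(big_ord_widen _ (fun k =>
     ((q ^+ m * (q ^+ 2) ^+ k * (L n)%:R)%:C)%C)) ?leq_subr//.
  rewrite -rmorph_sum -rmorphM /=; congr (_%:C)%C.
  rewrite -mulr_suml -mulr_sumr -[1 - (q ^+ 2) ^+ _]opprB subrX1.
  rewrite -[1 - q ^+ 2]opprB !mulNr mulrN; congr (- _).
  by field; rewrite gt_eqF.
exists L, c, (fun n j => om n ^+ j); split.
- by move=> n j; rewrite cabsX cabs_expi expr1n.
(* As the weights are nonnegative, their mass is the moment of order 0, that is
   [1 - q ^ (2 (n + 1))]. *)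
- move=> n; have E j : c n j = ((cabs (c n j))%:C)%C.
    rewrite /c mul_conjc cabsM !cabs_real !ger0_norm ?sqr_ge0 ?rmorphM//.
    by rewrite divr_ge0// ltW.
  have := mult n 0%N (leq0n _).
  under eq_bigr => j _ do rewrite expr0 mulr1 E.
  rewrite -rmorph_sum => /(congr1 (@complex.Re _)) /= ->.
  by rewrite mul1r gerBl !exprn_ge0.
- move=> m; apply/ccvgP => e e0.
  have q2lt1 : q ^+ 2 < 1 by rewrite -subr_gt0.
  have [N hN] := expr_small (sqr_ge0 q) q2lt1 ler01 e0.
  exists (N + m)%N => n Nn; rewrite mult; last lia.
  rewrite -rmorphXn -rmorphB /= mulrBr mulr1 addrAC subrr add0r cabs_real normrN.
  rewrite ger0_norm ?mulr_ge0 ?exprn_ge0//.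
  apply: le_lt_trans (hN (n.+1 - m)%N _); last lia.
  by rewrite mul1r ler_piMl ?exprn_ge0// exprn_ile1// ltW.
Qed.

Lemma poisson_cvg (q : R) : 0 <= q -> q < 1 ->
  exists (L : nat -> nat) (c w : nat -> nat -> C),
  [/\ forall n j, cabs (w n j) = 1 :> R,
      forall n, \sum_(j < L n) cabs (c n j) <= 1 :> R &
      forall f, analytic_D f -> forall z, cabs z < 1 ->
        ccvg (fun n => \sum_(j < L n) c n j * f (w n j * z)) (f ((q%:C)%C * z))].
Proof.
move=> q0 q1; have [L [c [w h]]] := poisson_averaging q0 q1.
exists L, c, w; split; [exact: avg_unimodular h|exact: avg_mass h|].
move=> f /analyticP[a af].
apply: (averaging_cvg h af); apply: series_dilate => //.
by rewrite cabs_real ger0_norm// ltW.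
Qed.

(** An interior point is [q x] with [x] on the circle of radius [r], so [f z] is a limit of Poisson
    averages of values of [f] on that circle. *)
Lemma max_modulus f (r M : R) z : analytic_D f -> r < 1 -> cabs z <= r ->
  (forall w, cabs w = r -> cabs (f w) <= M) -> cabs (f z) <= M.
Proof.
move=> af r1; rewrite le_eqVlt => /orP[/eqP zr|zr] fM; first exact: fM.
have r0 : 0 < r by exact: le_lt_trans (cabs_ge0 z) zr.
(* At the centre there is no direction along which to scale; the value is the coefficient of index 0
   and the Cauchy estimate applies. *)
have [z0|z0] := eqVneq z 0.
  have /analyticP[a sa] := af.
  have : cabs (a 0%N) * r ^+ 0 <= M by apply: (cauchy_estimate 0 sa) => //; exact: ltW.
  rewrite expr0 mulr1 z0; congr (cabs _ <= _).
  apply: (@ccvg_unique _ (fun n => psum a n 0)); last first.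
    by apply: sa; rewrite cabs0 ltr01.
  apply/ccvgP => e e0; exists 1%N => -[//|n] _.
  rewrite /psum big_ord_recl expr0 mulr1 big1 ?addr0 ?subrr ?cabs0// => i _.
  by rewrite expr0n mulr0.
have cz0 : cabs z != 0 by rewrite cabs_eq0.
have czp : 0 < cabs z by rewrite lt_def cz0 cabs_ge0.
have M0 : 0 <= M.
  by apply: le_trans (fM (r%:C)%C _); rewrite ?cabs_ge0// cabs_real gtr0_norm.
pose q := cabs z / r.
have q0 : 0 <= q by rewrite divr_ge0 ?cabs_ge0// ltW.
have q1 : q < 1 by rewrite ltr_pdivrMr ?mul1r.
have [L [c [w [w1 c1 h]]]] := poisson_cvg q0 q1.
pose x := ((r / cabs z)%:C)%C * z.
have xr : cabs x = r.
  by rewrite /x cabsM cabs_real ger0_norm ?divr_ge0 ?cabs_ge0 ?ltW// divfK.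
have -> : z = (q%:C)%C * x.
  rewrite /x mulrA -rmorphM /= (_ : q * _ = 1) ?mul1r// /q; field.
  by rewrite cz0 gt_eqF.
apply: (ccvg_lim_le (h f af x _)); first by rewrite xr.
exists 0%N => n _; apply: le_trans (cabs_sum _ _ _) _.
apply: (@le_trans _ _ (\sum_(j < L n) cabs (c n j) * M)).
  apply: ler_sum => j _; rewrite cabsM ler_wpM2l ?cabs_ge0// fM//.
  by rewrite cabsM w1 mul1r xr.
by rewrite -mulr_suml ler_piMl.
Qed.

Lemma analytic_lin f h (c d : C) : analytic_D f -> analytic_D h ->
  analytic_D (fun z => c * f z + d * h z).
Proof.
move=> /analyticP[a af] /analyticP[b bh]; apply/analyticP.
by eexists; exact: series_lin af bh.
Qed.

Lemma analyticB f h : analytic_D f -> analytic_D h -> analytic_D (fun z => f z - h z).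
Proof.
move=> af ah; apply: analytic_eq (analytic_lin 1 (-1) af ah) _ => z _.
by rewrite mul1r mulN1r.
Qed.

Lemma analyticD f h : analytic_D f -> analytic_D h -> analytic_D (fun z => f z + h z).
Proof.
move=> af ah; apply: analytic_eq (analytic_lin 1 1 af ah) _ => z _.
by rewrite !mul1r.
Qed.

Lemma analyticZ f (c : C) : analytic_D f -> analytic_D (fun z => c * f z).
Proof.
move=> af; apply: analytic_eq (analytic_lin c 0 af af) _ => z _.
by rewrite mul0r addr0.
Qed.

Lemma analytic_poly (P : {poly C}) : analytic_D (horner P).
Proof. by apply/analyticP; eexists; exact: series_poly. Qed.

Lemma analytic_cst (c : C) : analytic_D (fun=> c).
Proof. by apply: analytic_eq (analytic_poly c%:P) _ => z _; rewrite hornerC. Qed.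

Lemma analytic_sum n (F : 'I_n -> C -> C) : (forall i, analytic_D (F i)) ->
  analytic_D (fun z => \sum_(i < n) F i z).
Proof.
elim: n F => [|n IH] F aF.
  by apply: analytic_eq (analytic_cst 0) _ => z _; rewrite big_ord0.
apply: analytic_eq (analyticD (IH _ (fun i => aF (widen_ord (leqnSn n) i))) (aF ord_max)) _.
by move=> z _; rewrite big_ord_recr.
Qed.

Lemma analytic_rot f (w : C) : cabs w <= 1 -> analytic_D f -> analytic_D (fun z => f (w * z)).
Proof.
by move=> w1 /analyticP[a af]; apply/analyticP; eexists; exact: series_dilate af.
Qed.

(** Weierstrass's theorem. Cauchy estimates make each coefficient sequence Cauchy; the limit
    coefficients stay close to those of one fixed [u n0], uniformly after weighting by [r ^+ k], so
    their series sums to [f]. *)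
Lemma analytic_unif_lim (u : nat -> C -> C) f : (forall n, analytic_D (u n)) ->
  (forall s : R, 0 <= s -> s < 1 -> forall e : R, 0 < e -> exists N, forall n, (N <= n)%N ->
     forall z, cabs z <= s -> cabs (u n z - f z) < e) ->
  analytic_D f.
Proof.
move=> au uf.
have /choice[a ha] : forall n, exists a, has_series a (u n).
  by move=> n; apply/analyticP.
have diff n m (r e : R) k : 0 <= r -> r < 1 ->
    (forall z, cabs z <= r -> cabs (u n z - f z) < e) ->
    (forall z, cabs z <= r -> cabs (u m z - f z) < e) ->
    cabs (a n k - a m k) * r ^+ k <= e + e.
  move=> r0 r1 hn hm.
  have := series_lin 1 (-1) (ha n) (ha m) => hs.
  have /= := @cauchy_estimate _ _ r (e + e) k hs r0 r1.
  rewrite mul1r mulN1r; apply => z zr.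
  rewrite mul1r mulN1r; apply: le_trans (cabs_tri (f z) _ _) _.
  by apply: lerD; [|rewrite cabsC]; apply: ltW; [apply: hn|apply: hm]; rewrite zr.
have /choice[b hb] : forall k, exists b, ccvg (fun n => a n k) b.
  move=> k; apply: ccauchy => e e0.
  (* A uniform error [d] on the disk of radius 1/2 costs [2 d / (1 / 2) ^ k = 2 e / 3] in the [k]-th
     coefficient. *)
  pose d := e * (1 / 2) ^+ k / 3.
  have hk : 0 < (1 / 2 : R) ^+ k by rewrite exprn_gt0//; lra.
  have d0 : 0 < d by rewrite /d; apply: divr_gt0 => //; rewrite mulr_gt0.
  have [N hN] := uf (1 / 2) ltac:(lra) ltac:(lra) d d0.
  exists N => n m /hN hn /hN hm.
  have := diff n m (1 / 2) d k ltac:(lra) ltac:(lra) hn hm.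
  rewrite -(ltr_pM2r hk); move/le_lt_trans; apply.
  by have h0 : 0 < e * (1 / 2) ^+ k; [rewrite mulr_gt0|rewrite /d; lra].
apply/analyticP; exists b => z z1; apply/ccvgP => e e0.
pose s := cabs z; have s0 : 0 <= s := cabs_ge0 z.
pose r := (1 + s) / 2.
have r0 : 0 < r by rewrite /r; lra.
have r1 : r < 1 by rewrite /r /s; lra.
have sr : s < r by rewrite /r /s; lra.
pose q := s / r.
have q0 : 0 <= q by rewrite divr_ge0// ltW.
have q1 : q < 1 by rewrite ltr_pdivrMr ?mul1r.
have q1' : 0 < 1 - q by rewrite subr_gt0.
(* The coefficient error sums to [2 d / (1 - q) = e / 4]; the other two errors are below
   [d <= e / 8] each. *)
pose d := e * (1 - q) / 8.
have d0 : 0 < d by rewrite /d divr_gt0// mulr_gt0.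
have de : d <= e / 8.
  by rewrite /d ler_wpM2r ?invr_ge0// ler_piMr ?gerBl// ltW.
have [n0 hn0] := uf r (ltW r0) r1 d d0.
have bn k : cabs (b k - a n0 k) * r ^+ k <= d + d.
  have h : ccvg (fun n => (a n k - a n0 k) * ((r ^+ k)%:C)%C) ((b k - a n0 k) * ((r ^+ k)%:C)%C).
    under eq_fun do rewrite mulrC; rewrite mulrC; apply: ccvgZ.
    by apply: ccvgB => //; exact: ccvg_cst.
  have rk : cabs ((r ^+ k)%:C)%C = r ^+ k.
    by rewrite cabs_real ger0_norm// exprn_ge0// ltW.
  rewrite -rk -cabsM; apply: (ccvg_lim_le h); exists n0 => n nn.
  by rewrite cabsM rk; apply: diff => //; [exact: ltW|exact: hn0|exact: hn0].
have [N hN] := series_unif (ha n0) s0 z1 d0.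
exists N => n /hN /(_ z (lexx _)) h1.
have h2 := hn0 n0 (leqnn _) z (ltW sr).
have h3 : cabs (psum b n z - psum (a n0) n z) <= (d + d) / (1 - q).
  rewrite /psum -sumrB; apply: le_trans (cabs_sum _ _ _) _.
  apply: (@le_trans _ _ (\sum_(k < n) (d + d) * q ^+ k)).
    apply: ler_sum => k _; rewrite -mulrBl cabsM cabsX.
    have -> : cabs z = r * q by rewrite /q mulrC divfK// gt_eqF.
    by rewrite exprMn mulrA ler_wpM2r ?exprn_ge0.
  by rewrite -mulr_sumr ler_wpM2l ?geom_sum_le// addr_ge0 ?ltW.
have h4 : (d + d) / (1 - q) = e / 4 by rewrite /d; field; rewrite gt_eqF.
rewrite h4 in h3; rewrite cabsC in h1.
have := cabs_tri (psum (a n0) n z) (psum b n z) (f z).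
have := cabs_tri (u n0 z) (psum (a n0) n z) (f z).
lra.
Qed.

Lemma series_bounded a f (s : R) : has_series a f -> 0 <= s -> s < 1 ->
  exists2 K : R, 0 <= K & forall z, cabs z <= s -> cabs (f z) <= K.
Proof.
move=> af s0 s1; have [N hN] := series_unif af s0 s1 ltr01.
exists (1 + \sum_(k < N) cabs (a k)).
  by rewrite addr_ge0// sumr_ge0// => i _; rewrite cabs_ge0.
move=> z zs; have h := hN N (leqnn _) z zs.
have h2 : cabs (psum a N z) <= \sum_(k < N) cabs (a k).
  apply: le_trans (cabs_sum _ _ _) _; apply: ler_sum => k _.
  rewrite cabsM cabsX ler_piMr ?cabs_ge0// exprn_ile1 ?cabs_ge0//; lra.
have := ler_cabsB (f z) (psum a N z); lra.
Qed.

(** The products of partial sums are polynomials and converge uniformly on smaller disks, so no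
    rearrangement of a double series is involved. *)
Lemma analyticM f h : analytic_D f -> analytic_D h -> analytic_D (fun z => f z * h z).
Proof.
move=> /analyticP[a af] /analyticP[b bh].
apply: (@analytic_unif_lim (fun n z => psum a n z * psum b n z)).
  move=> n; apply: analytic_eq (analytic_poly (\poly_(i < n) a i * \poly_(i < n) b i)) _.
  by move=> z _; rewrite hornerM -!psum_poly.
move=> s s0 s1 e e0.
have [K K0 fK] := series_bounded af s0 s1.
have [K' K'0 hK] := series_bounded bh s0 s1.
pose d := Num.min 1 (e / (2 * (K + K' + 2))).
have KK : 0 < 2 * (K + K' + 2) by lra.
have d0 : 0 < d by rewrite lt_min ltr01 divr_gt0.
have d1 : d <= 1 by rewrite ge_min lexx.
have de : d * (2 * (K + K' + 2)) <= e.
  by rewrite -ler_pdivlMr// ge_min lexx orbT.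
have [N hN] := series_unif af s0 s1 d0.
have [N' hN'] := series_unif bh s0 s1 d0.
exists (maxn N N') => n; rewrite geq_max => /andP[/hN hn /hN' hn'] z zs.
have {}hn := hn z zs; have {}hn' := hn' z zs.
have fk := fK z zs; have hk := hK z zs.
have -> : psum a n z * psum b n z - f z * h z =
  (psum a n z - f z) * psum b n z + f z * (psum b n z - h z) by ring.
rewrite cabsC in hn; rewrite cabsC in hn'.
have pb : cabs (psum b n z) <= K' + 1.
  have := ler_cabsB (psum b n z) (h z); lra.
apply: le_lt_trans (cabsD _ _) _; rewrite !cabsM.
have e1 : cabs (psum a n z - f z) * cabs (psum b n z) <= d * (K' + 1).
  by apply: ler_pM; rewrite ?cabs_ge0// ltW.
have e2 : cabs (f z) * cabs (psum b n z - h z) <= K * d.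
  by apply: ler_pM; rewrite ?cabs_ge0// ltW.
have : 0 < d * (K + K' + 2) by rewrite mulr_gt0//; lra.
lra.
Qed.

Lemma analyticX f n : analytic_D f -> analytic_D (fun z => f z ^+ n).
Proof.
move=> af; elim: n => [|n IH].
  by apply: analytic_eq (analytic_cst 1) _ => z _; rewrite expr0.
by apply: analytic_eq (analyticM af IH) _ => z _; rewrite exprS.
Qed.

End PowerSeries.

(** * Abstract function spaces and essential norms of multipliers *)

Section PowerInequalities.
Variable R : realType.
Implicit Types (p x y : R).

Lemma powR_leE p x y : 0 < p -> 0 <= x -> 0 <= y -> (x `^ p <= y `^ p) = (x <= y).
Proof.
move=> p0 x0 y0; apply/idP/idP => h; last by rewrite ge0_ler_powR ?nnegrE// ltW.
rewrite leNgt; apply/negP => yx.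
by have := gt0_ltr_powR p0 y0 x0 yx; rewrite ltNge h.
Qed.

Lemma powR_root p x : 0 < p -> 0 <= x -> (x `^ p^-1) `^ p = x.
Proof. by move=> p0 x0; rewrite -powRrM mulVf ?gt_eqF// powRr1. Qed.

Lemma powRV p x : 0 <= x -> x^-1 `^ p = (x `^ p)^-1.
Proof. by move=> x0; rewrite -powR_inv1// -powRrM mulN1r powRN. Qed.

(** Young's inequality for [y] and [x ^ (p - 1)] with the conjugate exponents [p] and [p / (p - 1)],
    rewritten as a supporting line at [x]. *)
Lemma powR_tangent p x y : 1 < p -> 0 <= x -> 0 <= y ->
  x `^ p + p * x `^ (p - 1) * (y - x) <= y `^ p.
Proof.
move=> p1 x0 y0; have p0 : 0 < p by lra.
pose q := p / (p - 1).
have q0 : 0 < q by rewrite divr_gt0//; lra.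
have pq : p^-1 + q^-1 = 1 by rewrite /q; field; apply/andP; split; rewrite gt_eqF//; lra.
have := @conjugate_powR R y (x `^ (p - 1)) p q y0 (powR_ge0 _ _) p0 q0 pq.
rewrite -powRrM (_ : (p - 1) * q = p); last by rewrite /q; field; rewrite gt_eqF//; lra.
have xx : x `^ p = x * x `^ (p - 1).
  rewrite -{2}(powRr1 x0) -powRD; last by apply/implyP => /eqP; lra.
  by congr (_ `^ _); lra.
move=> h; have {}h : p * (y * x `^ (p - 1)) <= y `^ p + (p - 1) * x `^ p.
  apply: le_trans (ler_wpM2l (ltW p0) h) _; rewrite le_eqVlt; apply/orP; left; apply/eqP.
  by rewrite /q; field; apply/andP; split; rewrite gt_eqF//; lra.
move: h; rewrite xx; lra.
Qed.

(** Sum the tangent inequalities at the mean [s]. Total weight [A <= 1] is enough: the defect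
    contributes [(p - 1) (1 - A) s ^ p], which is nonnegative. *)
Lemma jensen_powR p n (a x : 'I_n -> R) : 1 < p ->
  (forall i, 0 <= a i) -> (forall i, 0 <= x i) -> \sum_(i < n) a i <= 1 ->
  (\sum_(i < n) a i * x i) `^ p <= \sum_(i < n) a i * x i `^ p.
Proof.
move=> p1 a0 x0 a1; set s := \sum_(i < n) a i * x i; set A := \sum_(i < n) a i in a1.
have s0 : 0 <= s by apply: sumr_ge0 => i _; rewrite mulr_ge0.
apply: (@le_trans _ _ (\sum_(i < n) a i * (s `^ p + p * s `^ (p - 1) * (x i - s)))); last first.
  by apply: ler_sum => i _; rewrite ler_wpM2l// powR_tangent.
have ss : s `^ p = s * s `^ (p - 1).
  rewrite -{2}(powRr1 s0) -powRD; last by apply/implyP => /eqP; lra.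
  by congr (_ `^ _); lra.
rewrite (_ : \sum_(i < n) _ = A * s `^ p + p * s `^ (p - 1) * (s - A * s)).
  have -> : A * s `^ p + p * s `^ (p - 1) * (s - A * s) = s `^ p + (p - 1) * (1 - A) * s `^ p.
    by rewrite ss; ring.
  by rewrite lerDl mulr_ge0 ?powR_ge0// mulr_ge0//; lra.
rewrite /A /s mulr_suml mulrBr mulr_suml !mulr_sumr -sumrB -big_split /=.
by apply: eq_bigr => i _; ring.
Qed.

Lemma jensen2_powR p (a b x y : R) : 1 < p -> 0 <= a -> 0 <= b -> a + b <= 1 ->
  0 <= x -> 0 <= y -> (a * x + b * y) `^ p <= a * x `^ p + b * y `^ p.
Proof.
move=> p1 a0 b0 ab x0 y0.
have := @jensen_powR p 2 (fun i => if i == 0 :> nat then a else b)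
  (fun i => if i == 0 :> nat then x else y) p1.
rewrite !big_ord_recl !big_ord0 /= !addr0; apply => //.
- by case=> -[|[|//]].
- by case=> -[|[|//]].
Qed.

Lemma powR_sum3 p (x y z : R) : 0 < p -> 0 <= x -> 0 <= y -> 0 <= z ->
  (x + y + z) `^ p <= 3 `^ p * (x `^ p + y `^ p + z `^ p).
Proof.
move=> p0 x0 y0 z0; pose m := Num.max x (Num.max y z).
have xm : x <= m by rewrite le_max lexx.
have ym : y <= m by rewrite !le_max lexx orbT.
have zm : z <= m by rewrite !le_max lexx !orbT.
have m0 : 0 <= m by lra.
apply: (@le_trans _ _ ((3 * m) `^ p)).
  by rewrite powR_leE//; lra.
rewrite powRM// ler_wpM2l ?powR_ge0//.
have := powR_ge0 x p; have := powR_ge0 y p; have := powR_ge0 z p.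
have [->|[->|->]] : m = x \/ m = y \/ m = z; [|lra..].
by rewrite /m; case: (leP y z) => _; case: leP => _; auto.
Qed.

End PowerInequalities.

(** * Norms given by a gauge: triangle inequality, point evaluations, gliding hump, peak
    functions *)

Section Gauge.
Variables (R : realType) (p : R) (N : (R[i] -> R[i]) -> \bar R).
Local Notation C := R[i].
Implicit Types (f g h F : C -> C) (z : C).

(* [N f] plays the role of the [p]-th power of the norm; it is [+oo] off the space. *)
Record gauge : Prop := {
  gauge_ge0 : forall f, (0 <= N f)%E;
  gauge_dom : forall n F (f : 'I_n -> C -> C) (a : 'I_n -> R), analytic_D F ->
    (forall k, analytic_D (f k)) -> (forall k, 0 <= a k) ->
    (forall z, cabs z < 1 -> cabs (F z) `^ p <= \sum_(k < n) a k * cabs (f k z) `^ p) ->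
    (N F <= \sum_(k < n) ((a k)%:E * N (f k))%E)%E;
  gauge_fatou : forall (u : nat -> C -> C) F (M : \bar R), (forall n, analytic_D (u n)) ->
    analytic_D F -> (forall z, cabs z < 1 -> ccvg (u ^~ z) (F z)) ->
    (forall n, (N (u n) <= M)%E) -> (N F <= M)%E;
  gauge_rot : forall f (w : C), analytic_D f -> cabs w = 1 ->
    (N (fun z => f (w * z)%R) <= N f)%E;
  gauge_one : (N (fun=> 1%R) < +oo)%E }.

Hypotheses (p1 : 1 < p) (gN : gauge).

Let p0 : 0 < p. Proof. exact: lt_trans ltr01 p1. Qed.

(** Jensen bounds the sum pointwise by a convex combination of rotated copies of [f], and rotations
    do not increase the gauge. *)
Lemma gauge_avg n (c w : nat -> C) f : analytic_D f ->
  (forall j, cabs (w j) = 1) -> \sum_(j < n) cabs (c j) <= 1 ->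
  (N (fun z => (\sum_(j < n) c j * f (w j * z))%R) <= N f)%E.
Proof.
move=> af w1 c1.
have aw j : analytic_D (fun z => f (w j * z)) by apply: analytic_rot => //; rewrite w1.
have := @gauge_dom gN n (fun z => \sum_(j < n) c j * f (w j * z))
  (fun j z => f (w j * z)) (fun j => cabs (c j)).
move=> /(_ _ _ _ _) /le_trans; apply.
- by apply: analytic_sum => j; exact: analyticZ.
- by move=> j; exact: aw.
- by move=> j; exact: cabs_ge0.
- move=> z z1.
  apply: (@le_trans _ _ ((\sum_(j < n) cabs (c j) * cabs (f (w j * z))) `^ p)).
    rewrite powR_leE ?cabs_ge0//.
      by apply: le_trans (cabs_sum _ _ _) _; under eq_bigr do rewrite cabsM.
    by apply: sumr_ge0 => j _; rewrite mulr_ge0 ?cabs_ge0.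
  by apply: jensen_powR => // j; rewrite cabs_ge0.
- apply: (@le_trans _ _ (\sum_(j < n) ((cabs (c j))%:E * N f)%E)%E).
    apply: lee_sum => j _; apply: lee_wpmul2l; first by rewrite lee_fin cabs_ge0.
    exact: gauge_rot.
  rewrite -ge0_sume_distrl; last by move=> j _; rewrite lee_fin cabs_ge0.
  rewrite sumEFin -[leRHS]mul1e; apply: lee_wpmul2r; first exact: gauge_ge0.
  by rewrite lee_fin.
Qed.

(** A dilation is a pointwise limit of Poisson averages, to which the Fatou property applies. For
    circle means this yields their monotonicity in the radius. *)
Lemma gauge_dilate f (q : R) : analytic_D f -> 0 <= q -> q < 1 ->
  (N (fun z => f ((q%:C)%C * z)%R) <= N f)%E.
Proof.
move=> af q0 q1; have [L [c [w [w1 c1 h]]]] := poisson_cvg q0 q1.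
apply: (@gauge_fatou gN (fun n z => \sum_(j < L n) c n j * f (w n j * z))).
- move=> n; apply: analytic_sum => j; apply: analyticZ; apply: analytic_rot => //.
  by rewrite w1.
- by apply: analytic_rot => //; rewrite cabs_real ger0_norm// ltW.
- by move=> z z1; exact: h.
- by move=> n; exact: gauge_avg.
Qed.

Definition gmem f : Prop := analytic_D f /\ (N f < +oo)%E.
Definition gnorm f : R := (fine (N f)) `^ p^-1.

Lemma gnorm_ge0 f : 0 <= gnorm f. Proof. exact: powR_ge0. Qed.

Lemma gaugeE f : gmem f -> N f = (gnorm f `^ p)%:E.
Proof.
move=> [_ f1]; have f0 := gauge_ge0 gN f.
rewrite /gnorm powR_root ?fine_ge0// fineK// ge0_fin_numE//.
Qed.

Lemma gnorm_le f (A : R) : analytic_D f -> 0 <= A -> (N f <= (A `^ p)%:E)%E ->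
  gmem f /\ gnorm f <= A.
Proof.
move=> af A0 h; have mf : gmem f by split => //; exact: le_lt_trans h (ltry _).
by split=> //; move: h; rewrite gaugeE// lee_fin powR_leE ?gnorm_ge0.
Qed.

Lemma gnorm_dom n F (f : 'I_n -> C -> C) (a : 'I_n -> R) : analytic_D F ->
  (forall k, gmem (f k)) -> (forall k, 0 <= a k) ->
  (forall z, cabs z < 1 -> cabs (F z) `^ p <= \sum_(k < n) a k * cabs (f k z) `^ p) ->
  gmem F /\ gnorm F `^ p <= \sum_(k < n) a k * gnorm (f k) `^ p.
Proof.
move=> aF mf a0 h.
have := gauge_dom gN aF (fun k => (mf k).1) a0 h.
under eq_bigr => k _ do rewrite (gaugeE (mf k)) -EFinM.
rewrite sumEFin => H; have mF : gmem F by split => //; exact: le_lt_trans H (ltry _).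
by split=> //; move: H; rewrite gaugeE// lee_fin.
Qed.

Lemma gnorm_dom1 F f (K : R) : analytic_D F -> gmem f -> 0 <= K ->
  (forall z, cabs z < 1 -> cabs (F z) <= K * cabs (f z)) ->
  gmem F /\ gnorm F <= K * gnorm f.
Proof.
move=> aF mf K0 h.
have [||//|mF] := @gnorm_dom 1 F (fun=> f) (fun=> K `^ p) aF _ _ _.
- by move=> _; exact: mf.
- by move=> _; exact: powR_ge0.
- move=> z z1; rewrite big_ord_recl big_ord0 addr0 -powRM ?cabs_ge0//.
  by rewrite powR_leE ?cabs_ge0 ?mulr_ge0 ?cabs_ge0// h.
rewrite big_ord_recl big_ord0 addr0 -powRM ?gnorm_ge0//.
by rewrite powR_leE ?gnorm_ge0 ?mulr_ge0 ?gnorm_ge0//.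
Qed.

Lemma gnorm_dom2 F f h (a b : R) : analytic_D F -> gmem f -> gmem h ->
  0 <= a -> 0 <= b ->
  (forall z, cabs z < 1 -> cabs (F z) `^ p <= a * cabs (f z) `^ p + b * cabs (h z) `^ p) ->
  gmem F /\ gnorm F `^ p <= a * gnorm f `^ p + b * gnorm h `^ p.
Proof.
move=> aF mf mh a0 b0 H.
have [||||mF] := @gnorm_dom 2 F
   (fun i => if i == 0 :> nat then f else h) (fun i => if i == 0 :> nat then a else b).
- exact: aF.
- by case=> -[|[|//]].
- by case=> -[|[|//]].
- by move=> z z1; rewrite big_ord_recl big_ord_recl big_ord0 addr0; exact: H.
- move=> h2; split; first exact: mF.
  by apply: (le_trans h2); rewrite big_ord_recl big_ord_recl big_ord0 addrA addr0.
Qed.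

(** Functions are total on [C] while only the disk matters; algebraic rearrangements inside a norm
    go through this transfer. *)
Lemma gnorm_eq f h : gmem f -> (forall z, cabs z < 1 -> f z = h z) ->
  gmem h /\ gnorm h = gnorm f.
Proof.
move=> mf fh; have ah : analytic_D h := analytic_eq mf.1 fh.
have [|mh le1] := gnorm_dom1 ah mf ler01.
  by move=> z z1; rewrite mul1r fh.
have [|_ le2] := gnorm_dom1 mf.1 mh ler01.
  by move=> z z1; rewrite mul1r fh.
by split=> //; apply/eqP; rewrite eq_le; rewrite !mul1r in le1 le2; rewrite le1 le2.
Qed.

Lemma gmemZ f (c : C) : gmem f -> gmem (fun z => c * f z) /\
  gnorm (fun z => c * f z) <= cabs c * gnorm f.
Proof.
move=> mf; apply: gnorm_dom1 => //; [exact: analyticZ mf.1|exact: cabs_ge0|].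
by move=> z _; rewrite cabsM.
Qed.

(** The upper bound for [c], combined with the upper bound for [c^-1] applied to [c f]. *)
Lemma gnormZ f (c : C) : gmem f -> gnorm (fun z => c * f z) = cabs c * gnorm f.
Proof.
move=> mf; have [mcf le1] := gmemZ c mf.
have [->|c0] := eqVneq c 0.
  rewrite cabs0 mul0r; apply/eqP; rewrite eq_le gnorm_ge0 andbT.
  by have [_] := gmemZ 0 mf; rewrite cabs0 mul0r.
have cc0 : 0 < cabs c by rewrite lt_def cabs_eq0 c0 cabs_ge0.
apply/eqP; rewrite eq_le le1 /= mulrC -ler_pdivlMr// mulrC -cabsV.
have [mccf le2] := gmemZ c^-1 mcf.
suff -> : gnorm f = gnorm (fun z => c^-1 * (c * f z)) by [].
by have [_ <-] := gnorm_eq mccf (h := f) (fun z _ => mulKf c0 (f z)).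
Qed.

(** Minkowski's inequality from domination alone: [|f| + |h|] is [A + B] times the convex
    combination of [|f| / A] and [|h| / B] with weights [A / (A + B)] and [B / (A + B)]. Convexity
    of the power gives the coefficients [a] and [b]. *)
Lemma gnorm_subadd_aux F f h (A B : R) : analytic_D F -> gmem f -> gmem h ->
  (forall z, cabs z < 1 -> cabs (F z) <= cabs (f z) + cabs (h z)) ->
  0 < A -> 0 < B -> gnorm f <= A -> gnorm h <= B -> gmem F /\ gnorm F <= A + B.
Proof.
move=> aF mf mh Ffh A0 B0 fA hB.
have AB : 0 < A + B by lra.
pose a := (A + B) `^ p * (A / (A + B)) / A `^ p.
pose b := (A + B) `^ p * (B / (A + B)) / B `^ p.
have Ap : 0 < A `^ p by rewrite powR_gt0.
have Bp : 0 < B `^ p by rewrite powR_gt0.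
have ABp : 0 < (A + B) `^ p by rewrite powR_gt0.
have a0 : 0 <= a by rewrite /a ltW// divr_gt0// mulr_gt0// divr_gt0.
have b0 : 0 <= b by rewrite /b ltW// divr_gt0// mulr_gt0// divr_gt0.
have [|mF h2] := gnorm_dom2 aF mf mh a0 b0.
- move=> z z1; apply: (@le_trans _ _ ((cabs (f z) + cabs (h z)) `^ p)).
    by rewrite powR_leE ?addr_ge0 ?cabs_ge0// Ffh.
  have -> : cabs (f z) + cabs (h z) = (A + B) *
     (A / (A + B) * (cabs (f z) / A) + B / (A + B) * (cabs (h z) / B)).
    by field; rewrite !gt_eqF.
  rewrite powRM; [|lra|]; last first.
    by rewrite addr_ge0// mulr_ge0// divr_ge0 ?cabs_ge0// ltW.
  apply: le_trans (ler_wpM2l (ltW ABp) (@jensen2_powR R p _ _ _ _ p1 _ _ _ _ _)) _.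
  - by rewrite divr_ge0// ltW.
  - by rewrite divr_ge0// ltW.
  - by rewrite -mulrDl divff// gt_eqF.
  - by rewrite divr_ge0 ?cabs_ge0// ltW.
  - by rewrite divr_ge0 ?cabs_ge0// ltW.
  rewrite !powRM ?cabs_ge0 ?invr_ge0 ?(ltW A0) ?(ltW B0)//.
  rewrite !powRV ?(ltW A0) ?(ltW B0)//.
  by rewrite /a /b le_eqVlt; apply/orP; left; apply/eqP; ring.
split; first exact: mF.
rewrite -(@powR_leE _ p)// ?gnorm_ge0 ?(ltW AB)//.
apply: le_trans h2 _.
apply: (@le_trans _ _ (a * A `^ p + b * B `^ p)).
  by apply: lerD; apply: ler_wpM2l => //; rewrite powR_leE ?gnorm_ge0// ltW.
by rewrite /a /b !divfK ?gt_eqF// -mulrDr -mulrDl divff ?gt_eqF// mulr1.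
Qed.

Lemma gnorm_subadd F f h : analytic_D F -> gmem f -> gmem h ->
  (forall z, cabs z < 1 -> cabs (F z) <= cabs (f z) + cabs (h z)) ->
  gmem F /\ gnorm F <= gnorm f + gnorm h.
Proof.
move=> aF mf mh Ffh; have f0 := gnorm_ge0 f; have h0 := gnorm_ge0 h.
(* The slack keeps both bounds positive even when a norm vanishes. *)
have aux e : 0 < e -> gmem F /\ gnorm F <= (gnorm f + e / 2) + (gnorm h + e / 2).
  by move=> e0; apply: (gnorm_subadd_aux aF mf mh Ffh); lra.
split; first exact: (aux 1 ltr01).1.
by apply/ler_addgt0Pr => e e0; have [_] := aux e e0; lra.
Qed.

Lemma gnormD f h : gmem f -> gmem h -> gmem (fun z => f z + h z) /\
  gnorm (fun z => f z + h z) <= gnorm f + gnorm h.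
Proof.
move=> mf mh; apply: gnorm_subadd => //; first exact: analyticD mf.1 mh.1.
by move=> z _; exact: cabsD.
Qed.

Lemma gnormB f h : gmem f -> gmem h -> gmem (fun z => f z - h z) /\
  gnorm (fun z => f z - h z) <= gnorm f + gnorm h.
Proof.
move=> mf mh; have [mN nN] := gmemZ (-1) mh.
rewrite cabsN cabs1 mul1r in nN; have [mD nD] := gnormD mf mN.
have E z : cabs z < 1 -> f z + -1 * h z = f z - h z by rewrite mulN1r.
have [m ->] := gnorm_eq mD E; split=> //; lra.
Qed.

Lemma gnorm_triB g f h : gmem f -> gmem g -> gmem h ->
  gnorm (fun z => f z - h z) <= gnorm (fun z => f z - g z) + gnorm (fun z => g z - h z).
Proof.
move=> mf mg mh; have [mD nD] := gnormD (gnormB mf mg).1 (gnormB mg mh).1.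
have E z : cabs z < 1 -> f z - g z + (g z - h z) = f z - h z by rewrite addrA subrK.
by have [m ->] := gnorm_eq mD E.
Qed.

Lemma gnorm_dist f h : gmem f -> gmem h ->
  `|gnorm f - gnorm h| <= gnorm (fun z => f z - h z).
Proof.
have aux f' h' : gmem f' -> gmem h' -> gnorm f' <= gnorm (fun z => f' z - h' z) + gnorm h'.
  move=> mf mh; have [mD nD] := gnormD (gnormB mf mh).1 mh.
  have E z : cabs z < 1 -> f' z - h' z + h' z = f' z by rewrite subrK.
  by have [_ ->] := gnorm_eq mD E.
move=> mf mh; rewrite ler_norml; apply/andP; split; last first.
  by rewrite lerBlDr; exact: aux.
have E z : cabs z < 1 -> -1 * (f z - h z) = h z - f z by rewrite mulN1r opprB.
have [mB _] := gnormB mf mh; have [mN _] := gmemZ (-1) mB.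
have [_ e] := gnorm_eq mN E.
have := gnormZ (-1) mB; rewrite cabsN cabs1 mul1r -e => <-.
by have := aux h f mh mf; lra.
Qed.

Lemma gmem0 : gmem (fun=> 0) /\ gnorm (fun=> 0) = 0.
Proof.
have m1 : gmem (fun=> 1) by split; [exact: analytic_cst|exact: gauge_one].
have [m nm] := gnorm_eq (h := fun=> 0) (gmemZ 0 m1).1 (fun z _ => mul0r 1).
by split=> //; rewrite nm gnormZ// cabs0 mul0r.
Qed.

Lemma gmem_sum n (F : 'I_n -> C -> C) : (forall i, gmem (F i)) ->
  gmem (fun z => \sum_(i < n) F i z).
Proof.
elim: n F => [|n IH] F mF.
  by apply: (gnorm_eq gmem0.1 _).1 => z _; rewrite big_ord0.
have m := (gnormD (IH _ (fun i => mF (widen_ord (leqnSn n) i))) (mF ord_max)).1.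
by apply: (gnorm_eq m _).1 => z _; rewrite big_ord_recr.
Qed.

Lemma gnorm_fatou (u : nat -> C -> C) F (M : R) : (forall n, gmem (u n)) ->
  analytic_D F -> (forall z, cabs z < 1 -> ccvg (u ^~ z) (F z)) -> 0 <= M ->
  (forall n, gnorm (u n) <= M) -> gmem F /\ gnorm F <= M.
Proof.
move=> mu aF uF M0 uM; apply: gnorm_le => //.
apply: (gauge_fatou gN _ aF uF) => n; first exact: (mu n).1.
by rewrite gaugeE// lee_fin powR_leE// gnorm_ge0.
Qed.

Lemma gnorm_mult g f (K : R) : analytic_D g -> 0 <= K ->
  (forall z, cabs z < 1 -> cabs (g z) <= K) -> gmem f ->
  gmem (fun z => g z * f z) /\ gnorm (fun z => g z * f z) <= K * gnorm f.
Proof.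
move=> ag K0 gK mf; apply: gnorm_dom1 => //; first exact: analyticM mf.1.
by move=> z z1; rewrite cabsM ler_wpM2r ?cabs_ge0 ?gK.
Qed.

(** A homogeneous component is a limit of Fourier averages of [f], so extracting it is a
    contraction. *)
Lemma gnorm_coef a f k : has_series a f -> gmem f ->
  gmem (fun z => a k * z ^+ k) /\ gnorm (fun z => a k * z ^+ k) <= gnorm f.
Proof.
move=> af mf; apply: gnorm_le; [|exact: gnorm_ge0|].
  by apply: analytic_eq (analytic_poly (a k *: 'X^k)) _ => z _; rewrite hornerZ hornerXn.
rewrite -gaugeE//.
apply: (gauge_fatou gN (u := fun n z => \sum_(j < n.+1)
   (fun j => conjc (expi (2 * pi / n.+1%:R)) ^+ k ^+ j / n.+1%:R) j *
    f ((fun j => expi (2 * pi / n.+1%:R) ^+ j) j * z))).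
- move=> n; apply: analytic_sum => j; apply: analyticZ; apply: analytic_rot; last exact: mf.1.
  by rewrite cabsX cabs_expi expr1n.
- by apply: analytic_eq (analytic_poly (a k *: 'X^k)) _ => z _; rewrite hornerZ hornerXn.
- by move=> z z1; exact: fourier_cvg.
- move=> n; apply: (@gauge_avg n.+1
     (fun j => conjc (expi (2 * pi / n.+1%:R)) ^+ k ^+ j / n.+1%:R)
     (fun j => expi (2 * pi / n.+1%:R) ^+ j)); first exact: mf.1.
    by move=> j; rewrite cabsX cabs_expi expr1n.
  exact: (avg_mass (fourier_averaging R k) n).
Qed.

(** Monomials decay in norm slower than every geometric sequence; this is what makes point
    evaluations bounded on the whole open disk. *)
Hypothesis mono_lb : forall r : R, 0 < r -> r < 1 ->
  exists2 c : R, 0 < c & forall k, (((c * r ^+ k) `^ p)%:E <= N (fun z => (z ^+ k)%R))%E.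

(** The homogeneous component has norm [|a k|] times the norm of the monomial and at most that of
    [f]; divide by the lower bound on monomials. *)
Lemma coef_bound (r : R) : 0 < r -> r < 1 -> exists2 K : R, 0 < K &
  forall a f k, has_series a f -> gmem f -> cabs (a k) * r ^+ k <= K * gnorm f.
Proof.
move=> r0 r1; have [c c0 hc] := mono_lb r0 r1.
exists c^-1; first by rewrite invr_gt0.
move=> a f k af mf; rewrite [leRHS]mulrC ler_pdivlMr// mulrC.
have [mk nk] := gnorm_coef k af mf.
have [->|ak] := eqVneq (a k) 0; first by rewrite cabs0 mul0r mulr0 gnorm_ge0.
have E z : cabs z < 1 -> (a k)^-1 * (a k * z ^+ k) = z ^+ k by rewrite mulKf.
have [mz nz] := gnorm_eq (gmemZ (a k)^-1 mk).1 E.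
have := hc k; rewrite gaugeE// lee_fin powR_leE ?gnorm_ge0//; last first.
  by rewrite mulr_ge0 ?exprn_ge0// ltW.
have ck0 : 0 < cabs (a k) by rewrite lt_def cabs_eq0 ak cabs_ge0.
rewrite nz gnormZ// cabsV mulrC => h; apply: le_trans nk.
by rewrite -mulrA -ler_pdivlMl// [r ^+ k * c]mulrC.
Qed.

Lemma point_eval (s : R) : 0 <= s -> s < 1 -> exists2 K : R, 0 < K &
  forall f z, gmem f -> cabs z <= s -> cabs (f z) <= K * gnorm f.
Proof.
move=> s0 s1; pose r := (1 + s) / 2.
have r0 : 0 < r by rewrite /r; lra.
have r1 : r < 1 by rewrite /r; lra.
have sr : s < r by rewrite /r; lra.
have [K K0 hK] := coef_bound r0 r1.
have q1' : 0 < 1 - s / r by rewrite subr_gt0 ltr_pdivrMr ?mul1r.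
exists (K / (1 - s / r)); first by rewrite divr_gt0.
move=> f z mf zs; have /analyticP[a af] := mf.1.
have zr : cabs z < r by lra.
(* With zero terms subtracted, the tail estimate bounds [f] itself. *)
have h := series_tail 0 af r0 (ltW r1) (fun k => hK a f k af mf) zr.
move: h; rewrite /psum big_ord0 subr0 expr0 mulr1 => h; apply: le_trans h _.
rewrite [leRHS]mulrAC; apply: ler_wpM2l.
  by rewrite mulr_ge0 ?gnorm_ge0// ltW.
by rewrite lef_pV2 ?posrE ?subr_gt0 ?ltr_pdivrMr ?mul1r// lerD2l lerN2 ler_pM2r ?invr_gt0.
Qed.

Let one : C -> C := fun=> 1.

Lemma gmem_one : gmem one.
Proof. by split; [exact: analytic_cst|exact: gauge_one]. Qed.

Lemma gnorm_one_gt0 : 0 < gnorm one.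
Proof.
have [K K0 hK] := point_eval (lexx 0) ltr01.
have := hK one 0 gmem_one; rewrite cabs0 lexx cabs1 => /(_ isT) h.
by rewrite -(pmulr_rgt0 _ K0); exact: lt_le_trans ltr01 h.
Qed.

Lemma gmem_bounded f (K : R) : analytic_D f -> 0 <= K ->
  (forall z, cabs z < 1 -> cabs (f z) <= K) -> gmem f /\ gnorm f <= K * gnorm one.
Proof.
move=> af K0 fK; apply: gnorm_dom1 => //; first exact: gmem_one.
by move=> z z1; rewrite cabs1 mulr1 fK.
Qed.

(* The norm [D] of evaluation at [z]; it is never estimated explicitly. *)
Lemma eval_norm z : cabs z < 1 -> exists2 D : R, 0 < D &
  (forall h, gmem h -> cabs (h z) <= D * gnorm h) /\
  (exists2 e : C -> C, gmem e & gnorm e <= 1 /\ 3 / 4 * D <= cabs (e z)).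
Proof.
move=> z1; pose S := [set cabs (h z) | h in [set h | gmem h /\ gnorm h <= 1]].
have [K K0 hK] := point_eval (cabs_ge0 z) z1.
have S0 : S !=set0.
  by exists (cabs 0), (fun=> 0) => //=; have [m ->] := gmem0; split.
have Sub : has_ubound S.
  exists K => _ [h [mh h1] <-]; apply: le_trans (hK h z mh (lexx _)) _.
  by rewrite ler_piMr// ltW.
have sS : has_sup S by split.
have n1 := gnorm_one_gt0.
have inS h : gmem h -> 0 < gnorm h -> cabs (h z) / gnorm h <= sup S.
  move=> mh h0; apply: ub_le_sup => //; exists (fun x => ((gnorm h)^-1%:C)%C * h x).
    split; first exact: (gmemZ _ mh).1.
    by rewrite gnormZ// cabs_real ger0_norm ?invr_ge0 ?gnorm_ge0// mulVf ?gt_eqF.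
  by rewrite cabsM cabs_real ger0_norm ?invr_ge0 ?gnorm_ge0// mulrC.
have D0 : 0 < sup S.
  by apply: lt_le_trans (inS one gmem_one n1); rewrite cabs1 divr_gt0.
exists (sup S) => //; split.
  move=> h mh; have := gnorm_ge0 h; rewrite le_eqVlt => /orP[/eqP h0|h0].
    by have := hK h z mh (lexx _); rewrite -h0 !mulr0.
  by rewrite -ler_pdivrMr// inS.
have [|_ [e [me e1] <-] he] := @sup_adherent _ S (sup S / 4) _ sS; first lra.
by exists e => //; split=> //; lra.
Qed.

(* A gliding hump (Sokal's proof of the uniform boundedness theorem). *)
Lemma gliding_hump (x : nat -> C) : (forall n, cabs (x n) < 1) ->
  exists2 f, gmem f & forall n g, gmem (fun z => g z * f z) ->
    cabs (g (x n)) <= 4 * 3 ^+ n * gnorm (fun z => g z * f z).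
Proof.
move=> x1.
have /choice[D /all_and2[D0 /all_and2[DB /choice[e he]]]] : forall n, exists D : R, 0 < D /\
  ((forall h, gmem h -> cabs (h (x n)) <= D * gnorm h) /\
  (exists e : C -> C, gmem e /\ gnorm e <= 1 /\ 3 / 4 * D <= cabs (e (x n)))).
  by move=> n; have [D D0 [h1 [e]]] := eval_norm (x1 n); exists D; split=> //; split=> //; exists e.
(* With ratio 1/3 all steps after the [n]-th add up to [t n / 2], less than the gain [3 / 4 * t n]
   made at that step. *)
pose t n : R := (1 / 3) ^+ n.
have t0 n : 0 < t n by rewrite exprn_gt0//; lra.
have tS n : t n.+1 = t n / 3 by rewrite /t exprS; ring.
(* Of [A + B] and [A - B] one has modulus at least [|B|]. The sign is chosen so that the value at
   [x k] is not cancelled by the earlier steps. *)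
pose y := fix y n : C -> C := if n is k.+1 then
  let s : C := if t k * cabs (e k (x k)) <= cabs (y k (x k) + ((t k)%:C)%C * e k (x k))
    then ((t k)%:C)%C else - ((t k)%:C)%C in
  fun z => y k z + s * e k z else fun=> 0.
have yS n : exists2 s : C, cabs s = t n & (forall z, y n.+1 z = y n z + s * e n z) /\
    t n * cabs (e n (x n)) <= cabs (y n.+1 (x n)).
  have ct : cabs ((t n)%:C)%C = t n by rewrite cabs_real ger0_norm// ltW.
  rewrite /=; case: ifPn => h.
    by exists ((t n)%:C)%C => //; split.
  exists (- ((t n)%:C)%C); first by rewrite cabsN.
  split=> //; rewrite -ltNge in h.
  set A := y n (x n) in h *; set B := ((t n)%:C)%C * e n (x n) in h *.
  have := cabsB (A + B) (A - B); rewrite mulNr -/B.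
  have -> : A + B - (A - B) = 2%:R * B by ring.
  have -> : cabs (2%:R * B) = 2 * (t n * cabs (e n (x n))).
    by rewrite [LHS]cabsM cabs_nat /B cabsM ct.
  lra.
have y0 : y 0%N = fun=> 0 by [].
move: y yS y0 => y yS y0.
have my n : gmem (y n).
  elim: n => [|n IH]; first by rewrite y0; exact: gmem0.1.
  have [s _ [h _]] := yS n; have [m _] := gnormD IH (gmemZ s (he n).1).1.
  by apply: (gnorm_eq m _).1 => z _; rewrite h.
have stepy n : gnorm (fun z => y n.+1 z - y n z) <= t n.
  have [s st [h _]] := yS n; have [ms ns] := gmemZ s (he n).1.
  have E z : cabs z < 1 -> s * e n z = y n.+1 z - y n z by rewrite h addrAC subrr add0r.
  have [_ ->] := gnorm_eq ms E.
  by apply: le_trans ns _; rewrite st ler_piMr ?(ltW (t0 n))//; exact: (he n).2.1.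
(* The exact partial geometric sum: keeping the subtracted term lets the induction close. *)
have diffy m n : gnorm (fun z => y (n + m)%N z - y n z) <= 3 / 2 * t n - 3 / 2 * t (n + m)%N.
  elim: m => [|m IH].
    rewrite addn0 subrr.
    by have [_ ->] := gnorm_eq (h := fun z => y n z - y n z) gmem0.1 (fun z _ => esym (subrr _)); rewrite gmem0.2.
  rewrite addnS; apply: le_trans (gnorm_triB (my _) (my (n + m)%N) (my n)) _.
  by have := stepy (n + m)%N; rewrite tS; lra.
have diffy' m n : gnorm (fun z => y (n + m)%N z - y n z) <= 3 / 2 * t n.
  by apply: le_trans (diffy m n) _; have := t0 (n + m)%N; lra.
have tsmall (K a : R) : 0 <= K -> 0 < a -> exists n0, forall n, (n0 <= n)%N -> K * t n < a.
  by move=> K0 a0; apply: expr_small => //; lra.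
have cauchyy (s : R) : 0 <= s -> s < 1 -> exists2 K : R, 0 < K &
    forall m n z, cabs z <= s -> cabs (y (n + m)%N z - y n z) <= K * t n.
  move=> s0 s1; have [K K0 hK] := point_eval s0 s1.
  exists (K * (3 / 2)); first by rewrite mulr_gt0//; lra.
  move=> m n z zs; rewrite -mulrA; apply: le_trans (ler_wpM2l (ltW K0) (diffy' m n)).
  exact: (hK _ z (gnormB (my _) (my _)).1 zs).
have /choice[f hf] : forall z, exists l, cabs z < 1 -> ccvg (fun n => y n z) l.
  move=> z; have [z1|z1] := ltP (cabs z) 1; last by exists 0.
  suff [l hl] : exists l, ccvg (fun n => y n z) l by exists l.
  have [K K0 hK] := cauchyy _ (cabs_ge0 z) z1.
  apply: ccauchy => a a0; have [n0 hn0] := tsmall (2 * K) a ltac:(lra) a0.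
  exists n0 => n m n0n n0m; apply: le_lt_trans (hn0 n0 (leqnn _)).
  have := cabs_tri (y n0 z) (y n z) (y m z); rewrite [in X in _ <= _ + X]cabsC.
  have := hK (n - n0)%N n0 z (lexx _); have := hK (m - n0)%N n0 z (lexx _).
  by rewrite !subnKC//; lra.
have fy (s : R) : 0 <= s -> s < 1 -> exists2 K : R, 0 < K &
    forall n z, cabs z <= s -> cabs (f z - y n z) <= K * t n.
  move=> s0 s1; have [K K0 hK] := cauchyy s s0 s1; exists K => // n z zs.
  have z1 : cabs z < 1 by lra.
  apply: (ccvg_lim_le (ccvgB (hf z z1) (ccvg_cst (y n z)))).
  by exists n => m nm; rewrite -(subnKC nm); exact: hK.
have af : analytic_D f.
  apply: (@analytic_unif_lim _ y) => [n|s s0 s1 a a0]; first exact: (my n).1.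
  have [K K0 hK] := fy s s0 s1; have [n0 hn0] := tsmall K a (ltW K0) a0.
  by exists n0 => n nn z zs; rewrite cabsC; apply: le_lt_trans (hK n z zs) (hn0 n nn).
have nf n : gmem (fun z => f z - y n z) /\ gnorm (fun z => f z - y n z) <= 3 / 2 * t n.
  apply: (@gnorm_fatou (fun m z => y (n + m)%N z - y n z)).
  - by move=> m; exact: (gnormB (my _) (my _)).1.
  - exact: analyticB af (my n).1.
  - move=> z z1; apply: ccvgB; last exact: ccvg_cst.
    have /ccvgP hz := hf z z1; apply/ccvgP => a /hz[n0 hn0].
    by exists n0 => m nm; apply: hn0; rewrite (leq_trans nm)// leq_addl.
  - by have := t0 n; lra.
  - by move=> m; exact: diffy'.
have mf : gmem f.
  have [m _] := gnormD (nf 0%N).1 (my 0%N).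
  by apply: (gnorm_eq m _).1 => z _; rewrite subrK.
exists f => // n g mg.
have [_ _ [_ h1]] := yS n.
have h2 := DB n _ (nf n.+1).1.
have h3 := (nf n.+1).2; rewrite tS in h3.
have [_ [_ h4]] := he n.
have Dn := D0 n; have tn := t0 n.
have h5 : D n * gnorm (fun z => f z - y n.+1 z) <= D n * (t n / 2).
  by rewrite ler_wpM2l ?(ltW Dn)//; lra.
have h6 : t n * (3 / 4 * D n) <= t n * cabs (e n (x n)) by rewrite ler_wpM2l ?(ltW tn).
(* Gain [3 / 4 * t n * D n] at step [n], minus at most [t n / 2 * D n] lost to all later steps. *)
have h7 : t n / 4 * D n <= cabs (f (x n)).
  have := ler_cabsB (y n.+1 (x n)) (f (x n)).
  rewrite cabsC; lra.
have h8 := DB n _ mg; rewrite cabsM in h8.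
(* Evaluation of [g f] at [x n] also costs the factor [D n], so it cancels and the final constant
   depends on [n] only. *)
have h9 : cabs (g (x n)) * (t n / 4 * D n) <= D n * gnorm (fun z => g z * f z).
  by apply: le_trans h8; rewrite ler_wpM2l ?cabs_ge0.
have h10 : cabs (g (x n)) * (t n / 4) <= gnorm (fun z => g z * f z).
  by rewrite -(ler_pM2l Dn); apply: le_trans h9; rewrite le_eqVlt; apply/orP; left; apply/eqP; ring.
have t4 : 0 < t n / 4 by lra.
rewrite -ler_pdivlMr// in h10; apply: le_trans h10 _.
rewrite mulrC ler_wpM2r ?gnorm_ge0// /t expr_div_n expr1n.
by rewrite mul1r -invfM invrK mulrC.
Qed.

Hypothesis peak_small : forall e : R, 0 < e -> exists m0, forall m, (m0 <= m)%N ->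
  (N (fun z => (((1 + z) / 2) ^+ m)%R) <= e%:E)%E.

(** * Powers of a peak function and an almost disjoint normalized subsequence *)

Section Peak.
Variable xi : C.
Hypothesis xi1 : cabs xi = 1.

Let phi z : C := (1 + conjc xi * z) / 2.
Let nu m : R := gnorm (fun z => phi z ^+ m).

(** Parallelogram identity for 1 and [w = conj xi z], where [|z - xi| = |1 - w|] and [|w| <= 1]. *)
Lemma phi_sqr z : cabs z <= 1 -> cabs (phi z) ^+ 2 <= 1 - cabs (z - xi) ^+ 2 / 4.
Proof.
move=> z1; pose w := conjc xi * z.
have wz : cabs w = cabs z by rewrite /w cabsM cabs_conj xi1 mul1r.
have -> : cabs (z - xi) = cabs (1 - w).
  rewrite -[RHS]mul1r -xi1 -cabsM mulrBr mulr1 /w mulrA unimodular_conj// mul1r.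
  by rewrite cabsC.
have -> : cabs (phi z) ^+ 2 = cabs (1 + w) ^+ 2 / 4.
  rewrite /phi -/w cabsM exprMn cabsV (cabs_nat R 2) exprVn; congr (_ / _).
  by rewrite -natrX.
have w1 : cabs w ^+ 2 <= 1 by rewrite exprn_ile1 ?cabs_ge0 ?wz.
suff : cabs (1 + w) ^+ 2 + cabs (1 - w) ^+ 2 = 2 + 2 * cabs w ^+ 2 by lra.
by rewrite !cabs_sqr; case: (w) => a b /=; ring.
Qed.

Lemma phi_le1 z : cabs z <= 1 -> cabs (phi z) <= 1.
Proof.
move=> z1; rewrite -(@ler_pXn2r _ 2)// ?nnegrE ?cabs_ge0// expr1n.
by apply: le_trans (phi_sqr z1) _; rewrite gerBl divr_ge0 ?sqr_ge0.
Qed.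

Let phi_an m : analytic_D (fun z => phi z ^+ m).
Proof.
apply: analytic_eq (analytic_poly (((2^-1)%:P * (1 + (conjc xi)%:P * 'X)) ^+ m)) _.
by move=> z _; rewrite !(hornerE, horner_exp) /phi mulrC.
Qed.

Let phi_mem m : gmem (fun z => phi z ^+ m).
Proof.
apply: (gmem_bounded (phi_an m) ler01 _).1 => z z1.
by rewrite cabsX exprn_ile1 ?cabs_ge0 ?phi_le1// ltW.
Qed.

(** Evaluate at [q xi], where [phi] equals [(1 + q) / 2 >= q], and use that this evaluation is
    bounded. *)
Lemma nu_lb (q : R) : 0 <= q -> q < 1 -> exists2 c : R, 0 < c & forall m, c * q ^+ m <= nu m.
Proof.
move=> q0 q1; have [K K0 hK] := point_eval q0 q1; exists K^-1; first by rewrite invr_gt0.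
move=> m; have := hK _ ((q%:C)%C * xi) (phi_mem m).
rewrite cabsM cabs_real xi1 mulr1 ger0_norm// => /(_ (lexx _)) h.
rewrite -ler_pdivlMl ?invr_gt0// invrK; apply: le_trans h.
rewrite cabsX lerXn2r ?nnegrE ?cabs_ge0// /phi mulrCA [conjc xi * xi]mulrC.
rewrite unimodular_conj// mulr1.
have -> : ((1 + (q%:C)%C) / 2 : C) = (((1 + q) / 2)%:C)%C.
  by rewrite rmorphM rmorphD fmorphV rmorph_nat.
rewrite cabs_real ger0_norm; lra.
Qed.

Lemma nu_gt0 m : 0 < nu m.
Proof.
have [c c0 hc] := @nu_lb (1 / 2) ltac:(lra) ltac:(lra).
by apply: lt_le_trans (hc m); rewrite mulr_gt0// exprn_gt0//; lra.
Qed.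

Lemma nu_small (e : R) : 0 < e -> exists m0, forall m, (m0 <= m)%N -> nu m <= e.
Proof.
move=> e0; have [m0 h] := peak_small (powR_gt0 p e0); exists m0 => m /h hm.
apply: (gnorm_le (phi_an m) (ltW e0) _).2; apply: le_trans hm.
have aP : analytic_D (fun z : C => ((1 + z) / 2) ^+ m).
  apply: analytic_eq (analytic_poly (((2^-1)%:P * (1 + 'X)) ^+ m)) _.
  by move=> z _; rewrite !(hornerE, horner_exp) mulrC.
by apply: (@gauge_rot gN _ (conjc xi) aP); rewrite cabs_conj.
Qed.

(* Since [nu] decays subexponentially, [phi ^+ n / nu n] is small wherever [phi ^+ m] is. *)
Lemma peak_step (k : nat) (B : R) : exists nm : nat * nat,
  [/\ 2 * B * nu nm.2 <= 1, (k <= nm.2)%N &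
    forall x : R, 0 <= x -> x <= 1 ->
      (1 / 2) ^+ k * nu nm.1 < x ^+ nm.1 -> 1 / 2 <= x ^+ nm.2].
Proof.
pose e := (2 * (`|B| + 1))^-1.
have B0 : 0 < 2 * (`|B| + 1) by have := normr_ge0 B; lra.
have e0 : 0 < e by rewrite invr_gt0.
have [m0 hm0] := nu_small e0; pose m := (maxn m0 k).+1.
have m0' : 0 < m%:R :> R by rewrite ltr0n.
have m1 : 1 <= m%:R :> R by rewrite ler1n.
(* Bernoulli's inequality then gives [q ^ m >= 3 / 4], hence [nu (m l) >= c (3 / 4) ^ l]. *)
pose q : R := 1 - (4 * m%:R)^-1.
have m4 : 0 < 4 * m%:R :> R by rewrite mulr_gt0.
have iq : (4 * m%:R)^-1 <= 1 / 4 :> R.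
  by rewrite invf_ple ?posrE//; lra.
have iq0 : 0 < (4 * m%:R)^-1 :> R by rewrite invr_gt0.
have q0 : 0 <= q by rewrite /q; lra.
have q1 : q < 1 by rewrite /q; lra.
have bern (j : nat) : 1 - j%:R * (4 * m%:R)^-1 <= q ^+ j.
  elim: j => [|j IH]; first by rewrite mul0r subr0 expr0.
  rewrite exprS; apply: le_trans (ler_wpM2l q0 IH).
  rewrite /q -natr1; set x := (4 * m%:R)^-1.
  have : 0 <= j%:R * x * x by rewrite !mulr_ge0// ltW.
  lra.
have qm : 3 / 4 <= q ^+ m.
  apply: le_trans (bern m); rewrite invfM mulrCA mulfV ?gt_eqF//; lra.
have [c c0 hc] := nu_lb q0 q1.
have ck : 0 < (1 / 2) ^+ k * c by rewrite mulr_gt0// exprn_gt0//; lra.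
have [l hl] := @expr_small R (2 / 3) 1 _ ltac:(lra) ltac:(lra) ler01 ck.
(* If [x ^ m < 1 / 2], then [x ^ (m l) <= (2 / 3) ^ l (3 / 4) ^ l]. The first factor is below
   [(1 / 2) ^ k c] by the choice of [l]; the rest is absorbed by [nu (m l)]. *)
exists ((m * l)%N, m); split=> /=.
- have h1 := hm0 m (leqW (leq_maxl _ _)).
  have h2 := nu_gt0 m; have h3 := ler_norm B.
  apply: (@le_trans _ _ (2 * (`|B| + 1) * nu m)).
    by rewrite ler_wpM2r// ?(ltW h2)//; lra.
  apply: (le_trans (ler_wpM2l (ltW B0) h1)).
  by rewrite /e mulfV ?gt_eqF.
- exact: leqW (leq_maxr _ _).
- move=> x x0 x1; apply: contraTT; rewrite -ltNge -leNgt => xm.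
  rewrite exprM.
  have h1 : (x ^+ m) ^+ l <= (1 / 2) ^+ l.
    by rewrite lerXn2r ?nnegrE ?exprn_ge0 ?(ltW xm)//; lra.
  apply: le_trans h1 _.
  have h2 : (1 / 2) ^+ k * (c * (3 / 4) ^+ l) <= (1 / 2) ^+ k * nu (m * l)%N.
    have k2 : 0 <= (1 / 2 : R) ^+ k by rewrite exprn_ge0//; lra.
    rewrite ler_wpM2l//.
    apply: le_trans (hc _); rewrite ler_wpM2l ?(ltW c0)// exprM.
    by rewrite lerXn2r ?nnegrE ?exprn_ge0//; lra.
  apply: le_trans h2; rewrite mulrA.
  have -> : (1 / 2 : R) = 2 / 3 * (3 / 4) by lra.
  have l34 : 0 <= (3 / 4 : R) ^+ l by rewrite exprn_ge0//; lra.
  rewrite exprMn ler_wpM2r//.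
  have := hl l (leqnn l); rewrite mul1r => /ltW /le_trans; apply.
  by have -> : (2 / 3 * (3 / 4) : R) = 1 / 2 by lra.
Qed.

(** Recursion on [B k], the sum of the earlier [1 / nu (n j)], which bounds the sum of all earlier
    normalized powers at every point of the disk. *)
Lemma peak_seq_exists : exists (n m : nat -> nat), forall k,
  [/\ 2 * (\sum_(j < k) (nu (n j))^-1) * nu (m k) <= 1, (k <= m k)%N &
    forall z, cabs z < 1 -> (1 / 2) ^+ k < cabs (phi z ^+ n k) / nu (n k) ->
      1 / 2 <= cabs (phi z ^+ m k)].
Proof.
have /choice[F hF] : forall kB : nat * R, exists nm : nat * nat,
  [/\ 2 * kB.2 * nu nm.2 <= 1, (kB.1 <= nm.2)%N &
    forall x : R, 0 <= x -> x <= 1 ->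
      (1 / 2) ^+ kB.1 * nu nm.1 < x ^+ nm.1 -> 1 / 2 <= x ^+ nm.2].
  by move=> [k B]; exact: peak_step.
pose B := fix B k : R := if k is j.+1 then B j + (nu (F (j, B j)).1)^-1 else 0.
have BE k : B k = \sum_(j < k) (nu (F (j : nat, B j)).1)^-1.
  by elim: k => [|k IH]; rewrite ?big_ord0// big_ord_recr /= -IH.
exists (fun k => (F (k, B k)).1), (fun k => (F (k, B k)).2) => k.
have [h1 h2 h3] := hF (k, B k); split=> //; first by rewrite -BE.
move=> z z1; rewrite !cabsX ltr_pdivlMr ?nu_gt0// => h; apply: h3 h; first exact: cabs_ge0.
by apply: phi_le1; exact: ltW.
Qed.

(** Fix [z] and take the last marked [k] with [|fs k z| > (1 / 2) ^ k]. Later marked terms add at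
    most 2, and all earlier ones together are at most [|hs k z|] for an auxiliary [hs k] of norm at
    most 1. Thus the sum is pointwise below [2 + |fs k| + |hs k|], whose [p]-th power is dominated
    by sums over the marked indices. The predicate [J] makes the bound depend on their number
    only. *)
Lemma peak_sequence : exists fs : nat -> C -> C,
  [/\ forall k, gmem (fs k) /\ gnorm (fs k) = 1,
      exists2 K : R, 0 <= K & forall (u : nat -> C) (J : pred nat) n,
        (forall j, cabs (u j) <= (J j)%:R) ->
        gmem (fun z => \sum_(j < n) u j * fs j z) /\
        gnorm (fun z => \sum_(j < n) u j * fs j z) `^ p <=
          K * (1 + \sum_(j < n) (J j)%:R) &
      forall d : R, 0 < d -> exists k0, forall k z, (k0 <= k)%N -> cabs z < 1 ->
        d <= cabs (z - xi) -> cabs (fs k z) <= (1 / 2) ^+ k].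
Proof.
have aux (x y s : R) : 0 <= x -> 0 <= s -> y <= s -> x + s + y <= (x + 2) * (1 + s).
  by move=> x0 s0 ys; have xs : 0 <= x * s; [rewrite mulr_ge0|lra].
have [n [m hnm]] := peak_seq_exists.
pose fs k z : C := ((nu (n k))^-1%:C)%C * phi z ^+ n k.
have nu0 k : 0 < nu k := nu_gt0 k.
have fsE k z : cabs (fs k z) = cabs (phi z ^+ n k) / nu (n k).
  by rewrite /fs cabsM cabs_real ger0_norm ?invr_ge0 ?(ltW (nu0 _))// mulrC.
have mfs k : gmem (fs k) by exact: (gmemZ _ (phi_mem (n k))).1.
have nfs k : gnorm (fs k) = 1.
  rewrite /fs gnormZ ?phi_mem// cabs_real ger0_norm ?invr_ge0 ?(ltW (nu0 _))//.
  by rewrite -/(nu _) mulVf ?gt_eqF.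
pose B k := \sum_(j < k) (nu (n j))^-1.
have B0 k : 0 <= B k by apply: sumr_ge0 => j _; rewrite invr_ge0 ltW.
pose hs k z : C := ((2 * B k)%:C)%C * phi z ^+ m k.
have B20 k : 0 <= 2 * B k by rewrite mulr_ge0.
have mhs k : gmem (hs k) by exact: (gmemZ _ (phi_mem (m k))).1.
have nhs k : gnorm (hs k) <= 1.
  rewrite /hs gnormZ ?phi_mem// cabs_real ger0_norm//.
  by have [h _ _] := hnm k.
have fsB k z : cabs z < 1 -> \sum_(j < k) cabs (fs j z) <= B k.
  move=> z1; apply: ler_sum => j _; rewrite fsE -[leRHS]mul1r ler_wpM2r//.
    by rewrite invr_ge0 ltW.
  by rewrite cabsX exprn_ile1 ?cabs_ge0 ?phi_le1// ltW.
(* Where [fs k] is not small, [phi ^ m k] is at least 1/2 in modulus, and the factor [2 * B k] in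
   [hs k] was chosen for this. *)
have dich k z : cabs z < 1 -> cabs (fs k z) <= (1 / 2) ^+ k \/ B k <= cabs (hs k z).
  move=> z1; have [h|h] := leP (cabs (fs k z)) ((1 / 2) ^+ k); [by left|right].
  have [_ _ /(_ z z1)] := hnm k; rewrite -fsE => /(_ h) h'.
  rewrite /hs cabsM cabs_real ger0_norm//.
  by have := ler_wpM2l (B20 k) h'; lra.
exists fs; split.
- by move=> k; split.
- pose E := gnorm one `^ p.
  have E0 : 0 <= E by exact: powR_ge0.
  have p3 : 0 <= 3 `^ p :> R by exact: powR_ge0.
  have p2 : 0 <= 2 `^ p :> R by exact: powR_ge0.
  have K0 : 0 <= 3 `^ p * (2 `^ p * E + 2) by rewrite mulr_ge0// addr_ge0// mulr_ge0.
  exists (3 `^ p * (2 `^ p * E + 2)) => // u J l uJ.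
  (* [c] collects the small terms met since the last large one; its bound is the partial geometric
     sum. *)
  have claim z l' : cabs z < 1 -> exists2 c : R, c <= 2 - 2 * (1 / 2) ^+ l' &
      (\sum_(j < l') (J j)%:R * cabs (fs j z) <= c \/
       exists2 k : 'I_l', J k & \sum_(j < l') (J j)%:R * cabs (fs j z) <=
          c + cabs (fs k z) + cabs (hs k z)).
    move=> z1; elim: l' => [|l' [c hc IH]].
      by exists 0; [rewrite expr0; lra|left; rewrite big_ord0].
    have t0 : 0 < (1 / 2 : R) ^+ l' by rewrite exprn_gt0//; lra.
    have [Jl|Jl] := boolP (J l'); last first.
      exists c; first by rewrite exprS; lra.
      rewrite big_ord_recr /= (negbTE Jl) mul0r addr0.
      by case: IH => [h|[k Jk h]]; [left|right; exists (widen_ord (leqnSn l') k)].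
    have [h|h] := dich l' z z1.
      exists (c + (1 / 2) ^+ l'); first by rewrite exprS; lra.
      rewrite big_ord_recr /= (_ : (J l')%:R = 1) ?Jl// mul1r.
      case: IH => [h'|[k Jk h']]; first by left; lra.
      by right; exists (widen_ord (leqnSn l') k) => //=; lra.
    (* A new large term resets the account: everything before it is below [B l'], hence below
       [|hs l' z|]. *)
    exists 0; first by rewrite subr_ge0 ger_pMr// exprn_ile1//; lra.
    right; exists ord_max => //=; rewrite big_ord_recr /= (_ : (J l')%:R = 1) ?Jl// mul1r add0r addrC lerD2l.
    apply: le_trans h; apply: le_trans (fsB l' z z1); apply: ler_sum => j _.
    by rewrite ler_piMl ?cabs_ge0//; case: (J j); rewrite ?ler01.
  (* The dominating family in a single index: the constant 1 for the remainder 2, then every [fs k]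
     and every [hs k], with weight 0 at unmarked indices. *)
  pose G (i : 'I_(1 + (l + l))) : C -> C := match fintype.split i with
    | inl _ => one | inr j => match fintype.split j with inl k => fs k | inr k => hs k end end.
  pose a (i : 'I_(1 + (l + l))) : R := match fintype.split i with
    | inl _ => 3 `^ p * 2 `^ p | inr j => match fintype.split j with
      inl k => 3 `^ p * (J k)%:R | inr k => 3 `^ p * (J k)%:R end end.
  have sumG (T : (C -> C) -> R) : \sum_(i < 1 + (l + l)) a i * T (G i) =
      3 `^ p * (2 `^ p * T one + \sum_(k < l) (J k)%:R * T (fs k)
       + \sum_(k < l) (J k)%:R * T (hs k)).
    rewrite big_split_ord /= big_ord_recl big_ord0 addr0 big_split_ord /=.
    rewrite !mulrDr !mulr_sumr addrA; congr (_ + _ + _).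
    - by rewrite /a /G (unsplitK (inl ord0)) mulrA.
    - apply: eq_bigr => k _; rewrite /a /G (unsplitK (inr (lshift l k))).
      by rewrite (unsplitK (inl k)) mulrA.
    - apply: eq_bigr => k _; rewrite /a /G (unsplitK (inr (rshift l k))).
      by rewrite (unsplitK (inr k)) mulrA.
  have aF : analytic_D (fun z => \sum_(j < l) u j * fs j z).
    by apply: analytic_sum => j; exact: analyticZ (mfs j).1.
  have mG i : gmem (G i).
    by rewrite /G; case: (fintype.split i) => [_|j]; [exact: gmem_one|case: (fintype.split j)].
  have a0 i : 0 <= a i.
    by rewrite /a; case: (fintype.split i) => [_|j]; [|case: (fintype.split j) => k]; rewrite mulr_ge0.
  have [|mF nF] := gnorm_dom aF mG a0.
    move=> z z1; rewrite (sumG (fun f => cabs (f z) `^ p)) cabs1 powR1 mulr1.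
    have S1 : cabs (\sum_(j < l) u j * fs j z) <= \sum_(j < l) (J j)%:R * cabs (fs j z).
      apply: le_trans (cabs_sum _ _ _) _; apply: ler_sum => j _.
      by rewrite cabsM ler_wpM2r ?cabs_ge0.
    have t0 : 0 < (1 / 2 : R) ^+ l by rewrite exprn_gt0//; lra.
    have sJ (f : nat -> C -> C) : 0 <= \sum_(k < l) (J k)%:R * cabs (f k z) `^ p.
      by apply: sumr_ge0 => k _; rewrite mulr_ge0 ?powR_ge0.
    have sk (f : nat -> C -> C) (k : 'I_l) : J k ->
        cabs (f k z) `^ p <= \sum_(k < l) (J k)%:R * cabs (f k z) `^ p.
      move=> Jk; rewrite (bigD1 k) //= Jk mul1r lerDl.
      by apply: sumr_ge0 => i _; rewrite mulr_ge0 ?powR_ge0.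
    have [c hc [h|[k Jk h]]] := claim z l z1.
      apply: (@le_trans _ _ ((2 + 0 + 0) `^ p)).
        by rewrite powR_leE ?cabs_ge0//; lra.
      apply: le_trans (powR_sum3 p0 _ _ _) _ => //.
      by rewrite powR0 ?gt_eqF// ler_wpM2l// !addr0 -addrA lerDl addr_ge0.
    apply: (@le_trans _ _ ((2 + cabs (fs k z) + cabs (hs k z)) `^ p)).
      have := cabs_ge0 (fs k z); have := cabs_ge0 (hs k z).
      by move=> hz fz; rewrite powR_leE ?cabs_ge0//; lra.
    apply: le_trans (powR_sum3 p0 _ _ _) _; rewrite ?cabs_ge0//.
    by rewrite ler_wpM2l// lerD ?lerD// sk.
  split=> //; apply: le_trans nF _.
  rewrite (sumG (fun f => gnorm f `^ p)) -mulrA ler_wpM2l//.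
  have sf : \sum_(k < l) (J k)%:R * gnorm (fs k) `^ p <= \sum_(k < l) (J k)%:R :> R.
    by apply: ler_sum => k _; rewrite nfs powR1 mulr1.
  have sh : \sum_(k < l) (J k)%:R * gnorm (hs k) `^ p <= \sum_(k < l) (J k)%:R :> R.
    apply: ler_sum => k _; rewrite ler_piMr//.
    have h1 : gnorm (hs k) `^ p <= 1 `^ p by rewrite powR_leE ?gnorm_ge0.
    by rewrite powR1 in h1.
  have sJ0 : 0 <= \sum_(k < l) (J k)%:R :> R by apply: sumr_ge0.
  apply: le_trans (lerD (lerD (lexx (2 `^ p * E)) sf) (lexx _)) _.
  exact: aux (mulr_ge0 p2 E0) sJ0 sh.
- move=> d d0.
  have d4 : 0 < d ^+ 2 / 4 by rewrite divr_gt0// exprn_gt0.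
  (* For such [d] no point of the disk is that far from [xi]. Otherwise [|phi| ^ 2 <= Q < 1] away
     from [xi], and [Q ^ m k < 1 / 4] contradicts [|phi ^ m k| >= 1 / 2]. *)
  have [dd|dd] := ltP 1 (d ^+ 2 / 4).
    exists 0%N => k z _ z1 dz; exfalso.
    have := phi_sqr (ltW z1); have := sqr_ge0 (cabs (phi z)).
    have : d ^+ 2 <= cabs (z - xi) ^+ 2 by rewrite lerXn2r ?nnegrE ?cabs_ge0// ltW.
    lra.
  pose Q := 1 - d ^+ 2 / 4.
  have [k0 hk0] := @expr_small R Q 1 (1 / 4) ltac:(rewrite /Q; lra) ltac:(rewrite /Q; lra) ler01 ltac:(lra).
  exists k0 => k z kk z1 dz; rewrite leNgt; apply/negP => h.
  have [_ mk /(_ z z1)] := hnm k; rewrite -fsE => /(_ h) h'.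
  have h2 := hk0 (m k) (leq_trans kk mk).
  have : cabs (phi z ^+ m k) ^+ 2 <= Q ^+ m k.
    rewrite cabsX exprAC lerXn2r ?nnegrE ?sqr_ge0//; first by rewrite /Q; lra.
    apply: le_trans (phi_sqr (ltW z1)) _; rewrite /Q lerD2l lerN2 ler_wpM2r//.
    by rewrite lerXn2r ?nnegrE ?cabs_ge0// ltW.
  have : (1 / 2) ^+ 2 <= cabs (phi z ^+ m k) ^+ 2.
    by rewrite lerXn2r ?nnegrE ?cabs_ge0//; lra.
  by rewrite expr_div_n expr1n; lra.
Qed.

End Peak.

End Gauge.

(** The excess factor [n ^ (p - 1)] is unbounded because [p > 1]. This gap between power and linear
    growth rules out functionals that do not tend to 0. *)
Lemma powR_not_linear (R : realType) (p A : R) : 1 < p ->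
  exists n0, forall n, (n0 <= n)%N -> A * (1 + n%:R) < n%:R `^ p.
Proof.
move=> p1; pose B := `|A| * 2 + 1.
have B0 : 0 < B by have := normr_ge0 A; rewrite /B; lra.
have q0 : 0 < (p - 1)^-1 by rewrite invr_gt0; lra.
have := archi_boundP (powR_ge0 B (p - 1)^-1).
move: (Num.bound _) => n0 hn0.
exists n0.+1 => n nn.
have n1 : 1 <= n%:R :> R by rewrite ler1n; lia.
have n0' : 0 <= n%:R :> R by lra.
have hB : B < n%:R `^ (p - 1).
  have h : B `^ (p - 1)^-1 < n%:R.
    by apply: lt_le_trans hn0 _; rewrite ler_nat ltnW.
  have q1 : 0 < p - 1 by lra.
  have := gt0_ltr_powR q1 (powR_ge0 _ _) n0' h.
  by rewrite /= -powRrM mulVf ?gt_eqF// powRr1// ltW.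
have -> : n%:R `^ p = n%:R * n%:R `^ (p - 1).
  rewrite -{2}(powRr1 n0') -powRD; last by apply/implyP => /eqP; lra.
  by congr (_ `^ _); lra.
apply: (@le_lt_trans _ _ (n%:R * (`|A| * 2))).
  have := ler_norm A; have := normr_ge0 A => a0 aA.
  apply: (@le_trans _ _ (`|A| * (1 + n%:R))); first by rewrite ler_wpM2r//; lra.
  by rewrite mulrCA ler_wpM2l//; lra.
rewrite ltr_pM2l; last by lra.
by apply: lt_trans hB; rewrite /B; lra.
Qed.

(** * Weakly null sequences and bounds for essential norms of multipliers *)

Section EssentialNorm.
Variables (R : realType) (p : R) (N : (R[i] -> R[i]) -> \bar R) (X : fspace R).
Local Notation C := R[i].
Hypotheses (p1 : 1 < p) (gN : gauge p N).
Hypothesis mono_lb : forall r : R, 0 < r -> r < 1 ->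
  exists2 c : R, 0 < c & forall k, (((c * r ^+ k) `^ p)%:E <= N (fun z => (z ^+ k)%R))%E.
Hypothesis peak_small : forall e : R, 0 < e -> exists m0, forall m, (m0 <= m)%N ->
  (N (fun z => (((1 + z) / 2) ^+ m)%R) <= e%:E)%E.
Hypothesis memX : forall f, fmem X f <-> gmem N f.
Hypothesis normX : forall f, gmem N f -> fnorm X f = gnorm p N f.

Let p0 : 0 < p. Proof. exact: lt_trans ltr01 p1. Qed.

Lemma functional_sum (psi : (C -> C) -> C) (u : nat -> C) (fs : nat -> C -> C) n :
  bounded_functional X psi -> (forall j, gmem N (fs j)) ->
  psi (fun z => \sum_(j < n) u j * fs j z) = \sum_(j < n) u j * psi (fs j).
Proof.
move=> [lin _] mfs; elim: n => [|n IH].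
  (* Linearity is given for two-term combinations of members, so the zero function is written as
     one. *)
  rewrite big_ord0 (_ : (fun z => _) = fun z => 0 * fs 0%N z + 0 * fs 0%N z).
    by rewrite lin ?memX// !mul0r addr0.
  by apply/funext => z; rewrite big_ord0 !mul0r addr0.
rewrite big_ord_recr /= -IH.
rewrite (_ : (fun z => _) = fun z => 1 * (\sum_(j < n) u j * fs j z) + u n * fs n z).
  rewrite lin ?mul1r// ?memX//.
  by apply: (gmem_sum p1 gN) => j; exact: (gmemZ p1 gN _ (mfs j)).1.
by apply/funext => z; rewrite big_ord_recr /= mul1r.
Qed.

(* Finite unimodular combinations of an almost disjoint sequence grow like [n `^ p^-1 = o(n)],
   so no bounded functional stays away from [0] on infinitely many of its terms. *)
Lemma weakly_null_of_sums (fs : nat -> C -> C) (K : R) : 0 <= K ->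
  (forall k, gmem N (fs k)) ->
  (forall (u : nat -> C) (J : pred nat) n, (forall j, cabs (u j) <= (J j)%:R) ->
     gmem N (fun z => \sum_(j < n) u j * fs j z) /\
     gnorm p N (fun z => \sum_(j < n) u j * fs j z) `^ p <=
       K * (1 + \sum_(j < n) (J j)%:R)) ->
  forall psi, bounded_functional X psi ->
    (fun n => cabs (psi (fs n))) @ \oo --> (0 : R).
Proof.
move=> K0 mfs hK psi bpsi; have [_ [L hL]] := bpsi.
apply/(real_cvg0P (fun n => cabs_ge0 _)) => d d0; apply: contrapT => H.
have {}H n0 : exists2 n, (n0 <= n)%N & d <= cabs (psi (fs n)).
  apply: contrapT => h; apply: H; exists n0 => n nn; rewrite ltNge; apply/negP => dn.
  by apply: h; exists n.
(* Only the terms on which [psi] stays large are kept; the phases [v j] then prevent any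
   cancellation in the value of [psi] on the sum. *)
pose J : pred nat := fun j => d <= cabs (psi (fs j)).
pose cnt n := (\sum_(j < n) J j)%N.
have cntR n : \sum_(j < n) (J j)%:R = (cnt n)%:R :> R by rewrite natr_sum.
have cnt_mono n m : (n <= m)%N -> (cnt n <= cnt m)%N.
  by move=> nm; rewrite /cnt -!(big_mkord xpredT (fun j => J j : nat)) (big_cat_nat (leq0n n) nm) /= leq_addr.
have cnt_unb c : exists n, (c <= cnt n)%N.
  elim: c => [|c [n hn]]; first by exists 0%N.
  have [m nm Jm] := H n; exists m.+1; rewrite /cnt big_ord_recr /=.
  have -> : J m = true by [].
  by rewrite addn1 ltnS (leq_trans hn)// cnt_mono.
have /choice[v hv] : forall j, exists v : C, cabs v = 1 /\
    v * psi (fs j) = ((cabs (psi (fs j)))%:C)%C.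
  by move=> j; have [v v1 v2] := phase_exists (psi (fs j)); exists v.
pose u j : C := if J j then v j else 0.
have uJ j : cabs (u j) <= (J j)%:R.
  by rewrite /u; case: (J j); rewrite ?cabs0// (hv j).1.
(* [psi] is at least [d] times the number of kept terms, while the [p]-th power of the norm is
   linear in that number. *)
have est n : (d * (cnt n)%:R) `^ p <= `|L| `^ p * K * (1 + (cnt n)%:R).
  have [mF nF] := hK u J n uJ; rewrite cntR in nF.
  have mF' : fmem X (fun z => \sum_(j < n) u j * fs j z) by apply/memX.
  have := hL _ mF'; rewrite normX// functional_sum// => h.
  have E : \sum_(j < n) u j * psi (fs j) = ((\sum_(j < n) (J j)%:R * cabs (psi (fs j)))%:C)%C.
    rewrite rmorph_sum; apply: eq_bigr => j _; rewrite /u; case: (J j).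
      by rewrite (hv j).2 mul1r.
    by rewrite !mul0r.
  have dle : d * (cnt n)%:R <= \sum_(j < n) (J j)%:R * cabs (psi (fs j)).
    rewrite -cntR mulr_sumr; apply: ler_sum => j _; rewrite mulrC.
    by case Jj: (J j); rewrite ?mul0r// !mul1r.
  have s0 : 0 <= d * (cnt n)%:R by rewrite mulr_ge0// ltW.
  rewrite E cabs_real ger0_norm ?(le_trans s0 dle)// in h.
  apply: (@le_trans _ _ ((`|L| * gnorm p N (fun z => \sum_(j < n) u j * fs j z)) `^ p)).
    rewrite powR_leE ?mulr_ge0 ?gnorm_ge0 ?normr_ge0 ?(ltW d0)//.
    apply: le_trans dle _; apply: le_trans h _; rewrite ler_wpM2r ?gnorm_ge0//.
    exact: ler_norm.
  by rewrite powRM ?gnorm_ge0// -mulrA ler_wpM2l ?powR_ge0.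
have dp : 0 < d `^ p by exact: powR_gt0.
have [n0 hn0] := @powR_not_linear R p (`|L| `^ p * K / d `^ p) p1.
have [n hn] := cnt_unb n0.
have := est n; have := hn0 _ hn; rewrite powRM ?(ltW d0)// => h1 h2.
move: h1; rewrite ltNge => /negP; apply.
by rewrite mulrAC ler_pdivlMr// mulrC.
Qed.

Lemma limn_esup_ge (u : nat -> \bar R) (a : \bar R) :
  (exists n0, forall n, (n0 <= n)%N -> (a <= u n)%E) -> (a <= limn_esup u)%E.
Proof.
move=> [n0 h]; apply: le_ereal_inf_tmp => _ [V [n1 _ hV] <-].
apply: le_ereal_sup_tmp; exists (u (maxn n0 n1)); last by apply: h; exact: leq_maxl.
by exists (maxn n0 n1) => //; apply: hV; exact: leq_maxr.
Qed.

Lemma limn_esup_le (u : nat -> \bar R) (a : \bar R) :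
  (forall n, (u n <= a)%E) -> (limn_esup u <= a)%E.
Proof.
move=> h; apply: (@le_trans _ _ (ereal_sup [set u n | n in setT])).
  by apply: ereal_inf_lbound; exists setT => //; exact: filterT.
by apply: ge_ereal_sup => _ [n _ <-].
Qed.

(** Test on the peak sequence at [xi]. Near [xi], [(h - c) fs k] is below [e / 2 * |fs k|]; away
    from it, below [(K + |c|) (1 / 2) ^ k]. So [h fs k] has norm at least [|c| - e] eventually. [S]
    is compared with multiplication inside the disk only, where the integral operator is
    controlled. *)
Lemma EN_ge (S : (C -> C) -> C -> C) h (K : R) (xi c : C) : cabs xi = 1 ->
  analytic_D h -> (forall z, cabs z < 1 -> cabs (h z) <= K) ->
  (forall e : R, 0 < e -> exists2 d : R, 0 < d & forall z, cabs z < 1 ->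
     cabs (z - xi) < d -> cabs (h z - c) < e) ->
  (forall f, gmem N f -> forall z, cabs z < 1 -> S f z = h z * f z) ->
  ((cabs c)%:E <= EN X S)%E.
Proof.
move=> xi1 ah hK hc Sh.
have K0 : 0 <= K by apply: le_trans (hK 0 _); rewrite ?cabs_ge0// cabs0 ltr01.
have [fs [mfs [L L0 hL] far]] := peak_sequence p1 gN mono_lb peak_small xi1.
have mf k := (mfs k).1; have nf k := (mfs k).2.
have wn : unit_weakly_null X fs.
  split; first by move=> n; split; [apply/memX|rewrite normX].
  exact: (weakly_null_of_sums L0 mf hL).
apply/lee_addgt0Pr => e e0; rewrite -leeBlDr//.
apply: le_ereal_sup_tmp; eexists; first by exists fs; [exact: wn|reflexivity].
apply: limn_esup_ge.
have e2 : 0 < e / 2 by lra.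
have [d d0 hd] := hc _ e2; have [k0 hk0] := far d d0.
pose M := (K + cabs c) * gnorm p N (fun=> 1).
have M0 : 0 <= M by rewrite mulr_ge0 ?gnorm_ge0// addr_ge0// cabs_ge0.
have [k1 hk1] := @expr_small R (1 / 2) M (e / 2) ltac:(lra) ltac:(lra) M0 e2.
exists (maxn k0 k1) => k; rewrite geq_max => /andP[kk0 /hk1 kk1].
have [mhf _] := gnorm_mult p1 gN ah K0 hK (mf k).
have [mSf ->] : gmem N (S (fs k)) /\ fnorm X (S (fs k)) = gnorm p N (fun z => h z * fs k z).
  have [m1 n1] := gnorm_eq p1 gN (h := S (fs k)) mhf (fun z z1 => esym (Sh _ (mf k) z z1)).
  by split=> //; rewrite normX// n1.
rewrite -EFinB lee_fin.
have m1 := gmem_one gN.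
have aF : analytic_D (fun z => (h z - c) * fs k z).
  by apply: analyticM (mf k).1; apply: analyticB => //; exact: analytic_cst.
have e2' : cabs ((e / 2)%:C)%C = e / 2 by rewrite cabs_real ger0_norm// ltW.
have k2 : 0 <= (K + cabs c) * (1 / 2) ^+ k.
  by rewrite mulr_ge0 ?exprn_ge0//; have := cabs_ge0 c; lra.
pose b : C := (((K + cabs c) * (1 / 2) ^+ k)%:C)%C.
have bE : cabs b = (K + cabs c) * (1 / 2) ^+ k by rewrite cabs_real ger0_norm.
have [|mF nF] := gnorm_subadd p1 gN aF (gmemZ p1 gN ((e / 2)%:C)%C (mf k)).1
   (gmemZ p1 gN b m1).1.
  move=> z z1; rewrite !cabsM e2' bE cabs1 mulr1.
  have f0 := cabs_ge0 (fs k z).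
  have [dz|dz] := ltP (cabs (z - xi)) d.
    have := ler_wpM2r f0 (ltW (hd z z1 dz)); lra.
  have h1 := hk0 k z kk0 z1 dz.
  have h2 : cabs (h z - c) <= K + cabs c.
    by apply: le_trans (cabsB _ _) _; rewrite lerD2r hK.
  have : cabs (h z - c) * cabs (fs k z) <= (K + cabs c) * (1 / 2) ^+ k.
    by apply: ler_pM; rewrite ?cabs_ge0.
  have : 0 <= e / 2 * cabs (fs k z) by rewrite mulr_ge0// ltW.
  lra.
rewrite !gnormZ// e2' bE nf mulr1 mulrAC -/M in nF.
have [mD nD] := gnormB p1 gN mhf mF.
have E z : cabs z < 1 -> h z * fs k z - (h z - c) * fs k z = c * fs k z by move=> _; ring.
have [_ nE] := gnorm_eq p1 gN mD E.
rewrite -nE gnormZ// nf mulr1 in nD.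
lra.
Qed.

Lemma EN_le (S : (C -> C) -> C -> C) h (K : R) :
  analytic_D h -> (forall z, cabs z < 1 -> cabs (h z) <= K) ->
  (forall f, gmem N f -> forall z, cabs z < 1 -> S f z = h z * f z) ->
  (EN X S <= K%:E)%E.
Proof.
move=> ah hK Sh.
have K0 : 0 <= K by apply: le_trans (hK 0 _); rewrite ?cabs_ge0// cabs0 ltr01.
apply: ge_ereal_sup => _ [fs [mfs _] <-]; apply: limn_esup_le => n.
have [/memX mf nf] := mfs n; rewrite normX// in nf.
have [mhf nhf] := gnorm_mult p1 gN ah K0 hK mf.
have [mS nS] := gnorm_eq p1 gN (h := S (fs n)) mhf (fun z z1 => esym (Sh _ mf z z1)).
by rewrite normX// nS lee_fin; rewrite nf mulr1 in nhf.
Qed.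

End EssentialNorm.

(** * Gauges given by integrals *)

Section PowerContinuity.
Variable R : realType.

(** The tangent inequality at the larger of the two points; it also covers continuity of the power
    at 0. *)
Lemma powR_lipschitz (p x y M : R) : 1 < p -> 0 <= x -> 0 <= y -> x <= M -> y <= M ->
  `|y `^ p - x `^ p| <= p * M `^ (p - 1) * `|y - x|.
Proof.
move=> p1; wlog xy : x y / x <= y => [hw|] x0 y0 xM yM.
  have [xy|/ltW yx] := leP x y; first exact: hw.
  by rewrite distrC [`|y - x|]distrC; exact: hw.
have p0 : 0 < p by lra.
have xyp : x `^ p <= y `^ p by rewrite powR_leE.
rewrite ger0_norm ?subr_ge0// ger0_norm ?subr_ge0//.
have := powR_tangent p1 y0 x0.
have : y `^ (p - 1) <= M `^ (p - 1) by rewrite ge0_ler_powR ?nnegrE//; lra.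
move=> h1 h2; have h3 : p * y `^ (p - 1) * (y - x) <= p * M `^ (p - 1) * (y - x).
  by rewrite ler_wpM2r ?subr_ge0// ler_wpM2l// ltW.
apply: le_trans h3; lra.
Qed.

Lemma cvg_powR (p : R) (u : nat -> R) (l : R) : 1 < p -> (forall n, 0 <= u n) -> 0 <= l ->
  u @ \oo --> l -> (fun n => u n `^ p) @ \oo --> l `^ p.
Proof.
move=> p1 u0 l0 ul; have p0 : 0 < p by lra.
pose K := p * (l + 1) `^ (p - 1).
have K0 : 0 <= K by rewrite mulr_ge0 ?powR_ge0// ltW.
have hK : 0 < K + 1 by lra.
apply/cvgrPdist_lt => e e0.
have d0 : 0 < Num.min 1 (e / (K + 1)) by rewrite lt_min ltr01 divr_gt0.
have /cvgrPdist_lt/(_ _ d0)[n0 _ hn0] := ul.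
exists n0 => // n nn /=; have := hn0 n nn; rewrite /= lt_min => /andP[h1 h2].
have unl : u n <= l + 1 by have := ler_norm (u n - l); rewrite distrC; lra.
have l1 : l <= l + 1 by lra.
apply: le_lt_trans (powR_lipschitz p1 (u0 n) l0 unl l1) _.
rewrite -/K; rewrite ltr_pdivlMr// in h2; apply: le_lt_trans h2.
by rewrite mulrC ler_wpM2l//; lra.
Qed.

End PowerContinuity.

(** * Measurability of complex-valued functions *)

Section ComplexMeasurable.
Context {d : measure_display} {T : measurableType d} {R : realType}.
Local Notation C := R[i].
Variable A : set T.
Implicit Types (f g : T -> C).

Definition cmeasurable f : Prop :=
  measurable_fun A (fun x => complex.Re (f x)) /\
  measurable_fun A (fun x => complex.Im (f x)).

Lemma cmeasurable_cst (c : C) : cmeasurable (fun=> c).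
Proof. by split; exact: measurable_cst. Qed.

Lemma cmeasurableD f g : cmeasurable f -> cmeasurable g -> cmeasurable (fun x => f x + g x).
Proof.
move=> [fr fi] [gr gi]; split.
  by under eq_fun do rewrite raddfD; exact: measurable_funD.
by under eq_fun do rewrite raddfD; exact: measurable_funD.
Qed.

Lemma cmeasurableM f g : cmeasurable f -> cmeasurable g -> cmeasurable (fun x => f x * g x).
Proof.
move=> [fr fi] [gr gi].
have reM (z w : C) : complex.Re (z * w) =
    complex.Re z * complex.Re w - complex.Im z * complex.Im w by case: z; case: w.
have imM (z w : C) : complex.Im (z * w) =
    complex.Re z * complex.Im w + complex.Im z * complex.Re w by case: z; case: w.
split.
  by under eq_fun do rewrite reM; apply: measurable_funB; exact: measurable_funM.
by under eq_fun do rewrite imM; apply: measurable_funD; exact: measurable_funM.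
Qed.

Lemma cmeasurableX f n : cmeasurable f -> cmeasurable (fun x => f x ^+ n).
Proof.
move=> mf; elim: n => [|n IH]; first exact: cmeasurable_cst.
by under eq_fun do rewrite exprS; exact: cmeasurableM.
Qed.

Lemma cmeasurable_psum (a : nat -> C) f n : cmeasurable f ->
  cmeasurable (fun x => psum a n (f x)).
Proof.
move=> mf; elim: n => [|n IH].
  by under eq_fun do rewrite /psum big_ord0; exact: cmeasurable_cst.
under eq_fun do rewrite /psum big_ord_recr /=; apply: cmeasurableD => //.
by apply: cmeasurableM; [exact: cmeasurable_cst|exact: cmeasurableX].
Qed.

Lemma cmeasurable_lim (u : nat -> T -> C) f : (forall n, cmeasurable (u n)) ->
  (forall x, A x -> ccvg (u ^~ x) (f x)) -> cmeasurable f.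
Proof.
move=> mu uf; split.
  apply: (measurable_fun_cvg (h := fun n x => complex.Re (u n x))) => [n|x Ax].
    exact: (mu n).1.
  exact: ccvg_Re (uf x Ax).
apply: (measurable_fun_cvg (h := fun n x => complex.Im (u n x))) => [n|x Ax].
  exact: (mu n).2.
exact: ccvg_Im (uf x Ax).
Qed.

(** Pointwise limit of the partial sums, which converge since [f] takes values in the disk. *)
Lemma cmeasurable_analytic (h : C -> C) f : analytic_D h -> cmeasurable f ->
  (forall x, A x -> cabs (f x) < 1) -> cmeasurable (fun x => h (f x)).
Proof.
move=> /analyticP[a ah] mf f1.
apply: (@cmeasurable_lim (fun n x => psum a n (f x))) => [n|x Ax].
  exact: cmeasurable_psum.
by apply: ah; exact: f1.
Qed.

Lemma measurable_cabs f : measurable A -> cmeasurable f -> measurable_fun A (fun x => cabs (f x)).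
Proof.
move=> mA [fr fi].
have E z : cabs z = (complex.Re z ^+ 2 + complex.Im z ^+ 2) `^ 2^-1 :> R.
  by rewrite powR12_sqrt ?addr_ge0 ?sqr_ge0// -cabs_sqr sqrtr_sqr ger0_norm ?cabs_ge0.
under eq_fun do rewrite E.
apply: (@measurableT_comp _ _ _ _ _ _ (fun x => x `^ 2^-1)); first exact: measurable_powR.
by apply: measurable_funD; exact: measurable_funX.
Qed.

End ComplexMeasurable.

(** * Gauge properties of weighted integrals of the [p]-th power of the modulus *)

Section IntegralGauge.
Context {d : measure_display} {T : measurableType d} {R : realType}.
Variable mu : {measure set T -> \bar R}.
Local Notation C := R[i].
Variables (p : R) (A : set T) (gam : T -> C) (w : T -> R).
Hypotheses (p1 : 1 < p) (mA : measurable A) (mgam : cmeasurable A gam)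
  (gam1 : forall x, A x -> cabs (gam x) < 1)
  (mw : measurable_fun A w) (w0 : forall x, A x -> 0 <= w x).

(** Common form of circle means and the Bergman integral: [gam] parametrizes points of the disk and
    [w] is the density. Rotation invariance depends on the parametrization and is proved in each
    case. *)
Definition igauge (f : C -> C) : \bar R :=
  (\int[mu]_(x in A) (cabs (f (gam x)) `^ p * w x)%:E)%E.

Lemma igauge_measurable f : analytic_D f ->
  measurable_fun A (fun x => (cabs (f (gam x)) `^ p * w x)%:E).
Proof.
move=> af; apply/measurable_EFinP; apply: measurable_funM => //.
apply: (@measurableT_comp _ _ _ _ _ _ (fun x => x `^ p)); first exact: measurable_powR.
by apply: measurable_cabs => //; exact: cmeasurable_analytic.
Qed.

Lemma igauge_integrand_ge0 f x : A x -> (0 <= (cabs (f (gam x)) `^ p * w x)%:E)%E.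
Proof. by move=> Ax; rewrite lee_fin mulr_ge0 ?powR_ge0// w0. Qed.

Lemma igauge_ge0 f : (0 <= igauge f)%E.
Proof. by apply: integral_ge0 => x; exact: igauge_integrand_ge0. Qed.

Lemma igauge_dom n F (f : 'I_n -> C -> C) (a : 'I_n -> R) : analytic_D F ->
  (forall k, analytic_D (f k)) -> (forall k, 0 <= a k) ->
  (forall z, cabs z < 1 -> cabs (F z) `^ p <= \sum_(k < n) a k * cabs (f k z) `^ p) ->
  (igauge F <= \sum_(k < n) ((a k)%:E * igauge (f k))%E)%E.
Proof.
move=> aF af a0 h.
have mZ k : measurable_fun A (fun x => ((a k)%:E * (cabs (f k (gam x)) `^ p * w x)%:E)%E).
  by apply: emeasurable_funM; [exact: measurable_cst|exact: igauge_measurable].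
have Z0 k x : A x -> (0 <= (a k)%:E * (cabs (f k (gam x)) `^ p * w x)%:E)%E.
  by move=> Ax; rewrite mule_ge0 ?lee_fin ?mulr_ge0 ?powR_ge0 ?w0.
rewrite (eq_bigr (fun k => \int[mu]_(x in A) ((a k)%:E * (cabs (f k (gam x)) `^ p * w x)%:E))%E).
  rewrite -ge0_integral_sum//.
  apply: ge0_le_integral => //.
  - by move=> x; exact: igauge_integrand_ge0.
  - exact: igauge_measurable.
  - by apply: emeasurable_sum => k _; exact: mZ.
  - move=> x Ax; under eq_bigr do rewrite -EFinM.
    rewrite sumEFin lee_fin; under eq_bigr do rewrite mulrA.
    by rewrite -mulr_suml ler_wpM2r ?w0// h// gam1.
move=> k _; rewrite ge0_integralZl//.
- exact: igauge_measurable.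
- by move=> x; exact: igauge_integrand_ge0.
- by rewrite lee_fin.
Qed.

Lemma igauge_fatou (u : nat -> C -> C) F (M : \bar R) : (forall n, analytic_D (u n)) ->
  analytic_D F -> (forall z, cabs z < 1 -> ccvg (u ^~ z) (F z)) ->
  (forall n, (igauge (u n) <= M)%E) -> (igauge F <= M)%E.
Proof.
move=> au aF uF uM.
have := @fatou _ _ _ mu A mA (fun n x => (cabs (u n (gam x)) `^ p * w x)%:E)
  (fun n => igauge_measurable (au n)) (fun n x Ax => igauge_integrand_ge0 (u n) Ax).
set L := (X in (X <= _)%E); set L' := (X in (_ <= X)%E) => h.
have -> : igauge F = L.
  apply: eq_integral => x; rewrite inE => Ax; apply/esym.
  apply: (cvg_limn_einf_sup _).1; apply: cvg_EFin; first by near=> n.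
  apply: cvgM; last exact: cvg_cst.
  apply: cvg_powR => //; [by move=> n; exact: cabs_ge0|exact: cabs_ge0|].
  by apply: ccvg_cabs; apply: uF; exact: gam1.
apply: le_trans h _; apply: le_trans (limn_einf_sup _) _.
exact: limn_esup_le.
Unshelve. all: by end_near. Qed.

End IntegralGauge.

(** * Hardy spaces *)

Section Translation.
Variable R : realType.
Local Notation lam := (@lebesgue_measure R).

Lemma lebesgue_measure_shift (c : R) (A : set R) : measurable A ->
  pushforward lam (fun x => x + c : measurableTypeR R) A = lam A.
Proof.
move=> mA; apply/esym; apply: lebesgue_measure_unique => //= {A mA}.
  exact: measurable_funD.
move=> mphi _ [[a b] /= _ <-]; rewrite /pushforward.
have -> : (fun x => x + c) @^-1` `]a, b] = `]a - c, b - c]%classic.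
  by apply/seteqP; split => x /=; rewrite !in_itv /= ltrBlDr lerBrDr.
by rewrite !lebesgue_measure_itv /= !lte_fin ltrD2r -!EFinB; case: ifP => // _; congr (_%:E); ring.
Qed.

Lemma integral_shift (c : R) (D : set R) (F : R -> \bar R) : measurable D ->
  measurable_fun D F -> (forall x, D x -> (0 <= F x)%E) ->
  (\int[lam]_(y in D) F y = \int[lam]_(x in (fun x => x + c)%R @^-1` D) F (x + c)%R)%E.
Proof.
move=> mD mF F0.
pose phi : measurableTypeR R -> measurableTypeR R := fun x : R => x + c.
have mphi : measurable_fun setT phi by exact: measurable_funD.
have F0' : {in D, forall y, (0 <= F y)%E} by move=> x; rewrite inE; exact: F0.
have := @ge0_integral_pushforward _ _ _ _ R phi mphi lebesgue_measure D F mD mF F0'.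
move=> <-; apply: eq_measure_integral => A mA _.
exact/esym/lebesgue_measure_shift.
Qed.

(** The shifted window is cut at [T] and the overhanging piece moved back by one period; half-open
    intervals tile exactly. *)
Lemma integral_periodic (F : R -> \bar R) (b T : R) : 0 <= b -> b <= T ->
  measurable_fun setT F -> (forall x, (0 <= F x)%E) -> (forall x, F (x + T)%R = F x) ->
  (\int[lam]_(x in `]0%R, T]) F (x + b)%R = \int[lam]_(x in `]0%R, T]) F x)%E.
Proof.
move=> b0 bT mF F0 FT.
have mFs (D : set R) : measurable_fun D F by exact: measurable_funS mF.
have pre (c x y : R) : (fun z => z + c) @^-1` `]x, y] = `]x - c, y - c]%classic.
  by apply/seteqP; split => z /=; rewrite !in_itv /= ltrBlDr lerBrDr.
have splitI (x y z : R) : x <= y -> y <= z ->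
    (\int[lam]_(t in `]x, z]) F t = \int[lam]_(t in `]x, y]) F t + \int[lam]_(t in `]y, z]) F t)%E.
  move=> xy yz; rewrite -ge0_integral_setU//.
  - by congr (integral _ _ _); apply/seteqP; split => t /=; rewrite !in_itv /=;
      [move=> /andP[h1 h2]; have [?|?] := leP t y; [left|right]; lra|
       case; lra].
  - exact: mFs.
  - by apply/disj_setPS => t /=; rewrite !in_itv /=; lra.
have -> : (\int[lam]_(x in `]0%R, T]) F (x + b)%R = \int[lam]_(x in `]b, (T + b)%R]) F x)%E.
  by rewrite [RHS](integral_shift b)// pre subrr addrK.
rewrite (splitI b T)//; last by lra.
rewrite [X in (_ + X)%E](integral_shift T)// pre subrr (_ : T + b - T = b); last by ring.
under [X in (_ + X)%E]eq_integral do rewrite FT.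
by rewrite [RHS](splitI 0 b T)// addeC.
Qed.

End Translation.

(** * Circle means and their supremum *)

Section HardyGauge.
Variables (R : realType) (p : R).
Hypothesis p1 : 1 < p.
Local Notation C := R[i].
Local Notation lam := (@lebesgue_measure R).
Let p0 : 0 < p. Proof. exact: lt_trans ltr01 p1. Qed.
Let tau : R := 2 * pi.
Let tau0 : 0 < tau. Proof. by rewrite mulr_gt0 ?pi_gt0. Qed.

Definition circ_pt (r th : R) : C := (r%:C)%C * expi th.

Definition circ_gauge (r : R) : (C -> C) -> \bar R :=
  igauge lam p `]0%R, tau]%classic (circ_pt r) (fun=> tau^-1).

Lemma cabs_circ_pt (r th : R) : 0 <= r -> cabs (circ_pt r th) = r.
Proof. by move=> r0; rewrite cabsM cabs_expi mulr1 cabs_real ger0_norm. Qed.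

Lemma cmeasurable_circ_pt (A : set R) (r : R) : cmeasurable A (circ_pt r).
Proof.
rewrite /circ_pt; apply: cmeasurableM; first exact: cmeasurable_cst.
split => /=.
  by apply: measurable_funTS; apply: continuous_measurable_fun; exact: continuous_cos.
by apply: measurable_funTS; apply: continuous_measurable_fun; exact: continuous_sin.
Qed.

Let w0 : forall x, `]0%R, tau]%classic x -> 0 <= (fun=> tau^-1) x :> R.
Proof. by move=> x _; rewrite invr_ge0 ltW. Qed.

Let mw (A : set R) : measurable_fun A (fun=> tau^-1 : R).
Proof. exact: measurable_cst. Qed.

Let circ1 (r : R) : 0 <= r -> r < 1 -> forall x, `]0%R, tau]%classic x -> cabs (circ_pt r x) < 1.
Proof. by move=> r0 r1 x _; rewrite cabs_circ_pt. Qed.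

(** The closed interval of [Mp] differs by a null point from the half-open one, which suits
    translations. *)
Lemma MpE f (r : R) : analytic_D f -> 0 <= r -> r < 1 -> Mp p f r = circ_gauge r f.
Proof.
move=> af r0 r1; rewrite /Mp /circ_gauge /igauge -/tau.
have mf : measurable_fun `]0%R, tau] (fun th => (cabs (f (circ_pt r th)) `^ p)%:E).
  have := igauge_measurable p (measurable_itv _) (cmeasurable_circ_pt _ r)
    (circ1 r0 r1) (measurable_cst (1 : R)) af.
  by congr (measurable_fun _ _); apply/funext => x; rewrite /cst mulr1.
rewrite -integral_itv_obnd_cbnd//.
under [in RHS]eq_integral do rewrite EFinM.
rewrite [LHS]muleC ge0_integralZr//; first by move=> x _; rewrite lee_fin powR_ge0.
by rewrite lee_fin invr_ge0 ltW.
Qed.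

Lemma circ_gauge_cst (r : R) (f : C -> C) (c : R) : 0 <= r ->
  (forall z, cabs z = r -> cabs (f z) = c) -> circ_gauge r f = (c `^ p)%:E.
Proof.
move=> r0 fc; rewrite /circ_gauge /igauge.
rewrite (eq_integral (cst (c `^ p * tau^-1)%:E)); last first.
  by move=> x _; rewrite fc// cabs_circ_pt.
rewrite integral_cst//= lebesgue_measure_itv /= lte_fin tau0 sube0 -EFinM.
by rewrite divfK ?gt_eqF.
Qed.

Lemma circ_gaugeP (r : R) : 0 <= r -> r < 1 -> gauge p (circ_gauge r).
Proof.
move=> r0 r1; have mA : measurable `]0%R, tau]%classic by [].
have mc := cmeasurable_circ_pt `]0%R, tau]%classic r.
split.
- by move=> f; exact: igauge_ge0.
- by move=> n F f a; apply: igauge_dom => //; exact: circ1.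
- by move=> u F M; apply: igauge_fatou => //; exact: circ1.
- move=> f w af /[dup] w1; have [b /andP[b0 b2]] := polar_exists w.
  move=> -> ; rewrite cabsM cabs_real cabs_expi mulr1 => _; rewrite w1 mul1r.
  pose F th : \bar R := (cabs (f (circ_pt r th)) `^ p * tau^-1)%:E.
  have -> : circ_gauge r f = (\int[lam]_(x in `]0%R, tau]) F x)%E by [].
  have mF : measurable_fun setT F.
    apply: igauge_measurable; [exact: measurableT|exact: cmeasurable_circ_pt| |exact: mw|exact: af].
    by move=> x _; rewrite cabs_circ_pt.
  have F0 x : (0 <= F x)%E by rewrite lee_fin mulr_ge0 ?powR_ge0// invr_ge0 ltW.
  have FT x : F (x + tau) = F x by rewrite /F /circ_pt expiD expi2pi mulr1.
  rewrite -(integral_periodic b0 b2 mF F0 FT) le_eqVlt; apply/orP; left; apply/eqP.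
  by apply: eq_integral => th _; rewrite /F /circ_pt addrC expiD mulrCA.
- by rewrite (@circ_gauge_cst r _ 1)// ?ltry// => z _; rewrite cabs1.
Qed.

(** The mean at radius [r] is the mean at radius [s] of the dilation by [r / s], so [gauge_dilate]
    takes the place of subharmonicity. *)
Lemma circ_gauge_mono f (r s : R) : analytic_D f -> 0 <= r -> r <= s -> s < 1 ->
  (circ_gauge r f <= circ_gauge s f)%E.
Proof.
move=> af r0; rewrite le_eqVlt => /orP[/eqP->//|rs] s1.
have s0 : 0 < s by exact: le_lt_trans rs.
have q0 : 0 <= r / s by rewrite divr_ge0// ltW.
have q1 : r / s < 1 by rewrite ltr_pdivrMr// mul1r.
have := gauge_dilate p1 (circ_gaugeP (ltW s0) s1) af q0 q1.
suff -> : circ_gauge s (fun z => f (((r / s)%:C)%C * z)) = circ_gauge r f by [].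
apply: eq_integral => x _.
have -> // : ((r / s)%:C)%C * circ_pt s x = circ_pt r x.
by rewrite /circ_pt mulrA -rmorphM divfK// gt_eqF.
Qed.

(** A supremum, unlike a limit, exists for every function and inherits each gauge property from the
    single circles. *)
Definition hardy_gauge (f : C -> C) : \bar R :=
  ereal_sup [set circ_gauge r f | r in [set r : R | 0 <= r /\ r < 1]].

Lemma circ_le_hardy f (r : R) : 0 <= r -> r < 1 -> (circ_gauge r f <= hardy_gauge f)%E.
Proof. by move=> r0 r1; apply: ereal_sup_ubound; exists r. Qed.

Lemma hardy_gauge_le f (M : \bar R) :
  (forall r, 0 <= r -> r < 1 -> (circ_gauge r f <= M)%E) -> (hardy_gauge f <= M)%E.
Proof. by move=> h; apply: ge_ereal_sup => _ [r [r0 r1] <-]; exact: h. Qed.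

Lemma hardy_gaugeP : gauge p hardy_gauge.
Proof.
split.
- move=> f; apply: le_trans (circ_le_hardy f (lexx 0) ltr01).
  exact: gauge_ge0 (circ_gaugeP (lexx 0) ltr01) f.
- move=> n F f a aF af a0 h; apply: hardy_gauge_le => r r0 r1.
  apply: le_trans (gauge_dom (circ_gaugeP r0 r1) aF af a0 h) _.
  apply: lee_sum => k _; apply: lee_wpmul2l; first by rewrite lee_fin.
  exact: circ_le_hardy.
- move=> u F M au aF uF uM; apply: hardy_gauge_le => r r0 r1.
  apply: (gauge_fatou (circ_gaugeP r0 r1) au aF uF) => n.
  by apply: le_trans (uM n); exact: circ_le_hardy.
- move=> f w af w1; apply: hardy_gauge_le => r r0 r1.
  apply: le_trans (gauge_rot (circ_gaugeP r0 r1) af w1) _; exact: circ_le_hardy.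
- apply: (@le_lt_trans _ _ 1%:E); last exact: ltry.
  apply: hardy_gauge_le => r r0 r1; rewrite (@circ_gauge_cst r _ 1)// ?powR1//.
  by move=> z _; rewrite cabs1.
Qed.

Lemma hardy_mono_lb (r : R) : 0 < r -> r < 1 -> exists2 c : R, 0 < c & forall k,
  (((c * r ^+ k) `^ p)%:E <= hardy_gauge (fun z => (z ^+ k)%R))%E.
Proof.
move=> r0 r1; exists 1 => // k; rewrite mul1r.
apply: le_trans (circ_le_hardy _ (ltW r0) r1).
by rewrite (@circ_gauge_cst r _ (r ^+ k)) ?(ltW r0)// => z zr; rewrite cabsX zr.
Qed.

(** Monotonicity in the radius identifies the supremum with the left limit at 1 used in the
    definition of the Hardy norm. *)
Lemma hardy_gauge_cvg f : analytic_D f -> (hardy_gauge f < +oo)%E ->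
  Mp p f @ 1^'- --> hardy_gauge f.
Proof.
move=> af f1.
have hg := circ_le_hardy f.
have [L LE] : exists L : R, hardy_gauge f = L%:E.
  exists (fine (hardy_gauge f)); rewrite fineK// ge0_fin_numE//.
  exact: gauge_ge0 hardy_gaugeP f.
have fin r : 0 <= r -> r < 1 -> exists2 x : R, circ_gauge r f = x%:E & x <= L.
  move=> r0 r1; exists (fine (circ_gauge r f)); last first.
    rewrite -lee_fin -LE fineK ?hg// ge0_fin_numE ?(gauge_ge0 (circ_gaugeP r0 r1))//.
    exact: le_lt_trans (hg r r0 r1) f1.
  rewrite fineK// ge0_fin_numE ?(gauge_ge0 (circ_gaugeP r0 r1))//.
  exact: le_lt_trans (hg r r0 r1) f1.
have rpos : \forall r \near (1 : R)^'-, 0 < r by exact: nbhs_left_gt.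
have rlt : \forall r \near (1 : R)^'-, r < 1 by exact: nbhs_left_lt.
rewrite LE; apply/fine_cvgP; split.
  near=> r; have r0 : 0 <= r by apply: ltW; near: r.
  have r1 : r < 1 by near: r.
  by rewrite MpE//; have [x -> _] := fin r r0 r1.
apply/cvgrPdist_lt => e e0.
have [r0 [r00 r01] hr0] : exists2 r, 0 <= r /\ r < 1 & (L%:E - e%:E < circ_gauge r f)%E.
  have : (L%:E - e%:E < hardy_gauge f)%E by rewrite LE -EFinB lte_fin; lra.
  by rewrite /hardy_gauge => /ereal_sup_gt[_ [r [r0 r1] <-] h]; exists r.
near=> r; have rr : r0 < r by near: r; exact: nbhs_left_gt.
have r1 : r < 1 by near: r.
have r0' : 0 <= r by lra.
have [x xE xL] := fin r r0' r1.
rewrite /= MpE// xE /=.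
have : (L%:E - e%:E < x%:E)%E.
  by apply: lt_le_trans hr0 _; rewrite -xE; apply: circ_gauge_mono => //; exact: ltW.
by rewrite -EFinB lte_fin => h; rewrite ger0_norm; lra.
Unshelve. all: by end_near. Qed.

Lemma hardy_memP f : fmem (Hardy p) f <-> gmem hardy_gauge f.
Proof.
split=> -[af]; last first.
  move=> f1; split=> //; exists (fine (hardy_gauge f)); rewrite fineK.
    exact: hardy_gauge_cvg.
  by rewrite ge0_fin_numE// (gauge_ge0 hardy_gaugeP).
move=> [L hL]; split=> //; apply: (@le_lt_trans _ _ L%:E); last exact: ltry.
apply: hardy_gauge_le => r r0 r1; apply: cvge_ge hL.
near=> s; have rs : r < s by near: s; exact: nbhs_left_gt.
have s1 : s < 1 by near: s; exact: nbhs_left_lt.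
have s0 : 0 <= s by exact: ltW (le_lt_trans r0 rs).
by rewrite (MpE af s0 s1); exact: circ_gauge_mono af r0 (ltW rs) s1.
Unshelve. all: by end_near. Qed.

Lemma hardy_normP f : gmem hardy_gauge f -> fnorm (Hardy p) f = gnorm p hardy_gauge f.
Proof.
move=> [af f1]; rewrite /= /hardy_norm /gnorm; congr (fine _ `^ _).
by apply/cvg_lim => //; exact: hardy_gauge_cvg.
Qed.

Lemma cos_lt1 (x : R) : 0 < x -> x < tau -> cos x < 1.
Proof.
move=> x0 x1; rewrite lt_neqAle cos_le1 andbT; apply/negP => /eqP c1.
have s0 : sin x = 0.
  by apply/eqP; rewrite -sqrf_eq0 sin2cos2 c1 expr1n subrr.
have := @expi_eq1 R x (introT andP (conj x0 x1)).
by rewrite /expi c1 s0 eqxx.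
Qed.

(** The integrands are bounded by [b ^ m] independently of [r], so one application of dominated
    convergence controls the supremum over all circles. *)
Lemma hardy_peak_small (e : R) : 0 < e -> exists m0, forall m, (m0 <= m)%N ->
  (hardy_gauge (fun z => (((1 + z) / 2) ^+ m)%R) <= e%:E)%E.
Proof.
move=> e0.
have powRX (c : R) m : 0 <= c -> (c ^+ m) `^ p = ((c ^+ 2) `^ (p / 2)) ^+ m.
  move=> c0; rewrite -(powR_mulrn m c0) -(powR_mulrn 2 c0) -(powR_mulrn m (powR_ge0 _ _)).
  by rewrite -!powRrM; congr (_ `^ _); field.
(* [|1 + r e^(i th)| ^ 2 = 1 + r ^ 2 + 2 r cos th] is convex in [r], hence at most the larger of its
   values at [r = 0] and [r = 1]. *)
pose b2 (th : R) : R := Num.max 1 (2 + 2 * cos th) / 4.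
pose b (th : R) : R := b2 th `^ (p / 2).
have b20 th : 0 <= b2 th by rewrite divr_ge0// le_max ler01.
have b21 th : b2 th <= 1.
  by rewrite ler_pdivrMr// ge_max; have := cos_le1 th; lra.
have p2 : 0 < p / 2 by rewrite divr_gt0.
have b0 th : 0 <= b th by exact: powR_ge0.
have one1 : (1 : R) `^ (p / 2) = 1 by rewrite powR1.
have b1 th : b th <= 1 by rewrite -[leRHS]one1 powR_leE.
have bl th : 0 < th -> th < tau -> b th < 1.
  move=> t0 t1; rewrite -[ltRHS]one1; apply: gt0_ltr_powR; rewrite ?nnegrE//.
  by rewrite /b2 ltr_pdivrMr// gt_max; have := cos_lt1 t0 t1; lra.
have mb : measurable_fun setT b.
  apply: (@measurableT_comp _ _ _ _ _ _ (fun x => x `^ (p / 2))); first exact: measurable_powR.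
  apply: measurable_funM; last exact: measurable_cst.
  apply: measurable_maxr; first exact: measurable_cst.
  apply: measurable_funD; first exact: measurable_cst.
  apply: measurable_funM; first exact: measurable_cst.
  by apply: continuous_measurable_fun; exact: continuous_cos.
have mbm m (A : set R) : measurable_fun A (fun th => (b th ^+ m / tau)%:E).
  apply/measurable_EFinP; apply: measurable_funM; last exact: measurable_cst.
  by apply: measurable_funX; exact: measurable_funTS.
have aphi m : analytic_D (fun z : C => ((1 + z) / 2) ^+ m).
  apply: analyticX; apply: analytic_eq (analytic_poly ((2^-1)%:P * (1 + 'X))) _.
  by move=> z _; rewrite !hornerE mulrC.
have key m r : 0 <= r -> r < 1 -> (circ_gauge r (fun z => (((1 + z) / 2) ^+ m)%R) <=
    \int[lam]_(th in `]0%R, tau[) (b th ^+ m / tau)%:E)%E.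
  (* At the endpoint [b] equals 1 and its powers do not vanish; removing this null point makes the
     pointwise limit 0 everywhere. *)
  move=> r0 r1; rewrite -(@integral_itv_bndoo _ _ _ _ false false)//.
  apply: ge0_le_integral => //.
  - by move=> x _; rewrite lee_fin mulr_ge0 ?powR_ge0 ?invr_ge0// ltW.
  - have mc : measurable_fun (`]0%R, tau]%classic : set (measurableTypeR R)) (fun=> tau^-1 : R).
      exact: measurable_cst.
    exact: (@igauge_measurable _ (measurableTypeR R) R p `]0%R, tau]%classic (circ_pt r) (fun=> tau^-1)
      (measurable_itv _) (cmeasurable_circ_pt _ r) (circ1 r0 r1) mc _ (aphi m)).
  - exact: (mbm m `]0%R, tau]%classic).
  - move=> x _; rewrite lee_fin ler_wpM2r ?invr_ge0 ?(ltW tau0)//.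
    set z := circ_pt r x.
    have sq : cabs ((1 + z) / 2) ^+ 2 <= b2 x.
      rewrite cabsM cabsV (cabs_nat R 2) exprMn exprVn /b2 -natrX.
      rewrite ler_pM2r// cabs_sqr /z /circ_pt /expi /= !mul0r subr0 addr0 add0r.
      have cs := cos2Dsin2 x.
      have rr : 0 <= r * (1 - r) by rewrite mulr_ge0//; lra.
      have E : (1 + r * cos x) ^+ 2 + (r * sin x) ^+ 2 = 1 + r ^+ 2 + 2 * r * cos x.
        have ss : sin x ^+ 2 = 1 - cos x ^+ 2 by rewrite sin2cos2.
        by rewrite exprMn ss; ring.
      rewrite E; set M := Num.max _ _.
      have M1 : 1 <= M by rewrite le_max lexx.
      have M2 : 2 + 2 * cos x <= M by rewrite le_max lexx orbT.
      have h1 : (1 - r) * 1 <= (1 - r) * M by rewrite ler_wpM2l//; lra.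
      have h2 : r * (2 + 2 * cos x) <= r * M by rewrite ler_wpM2l.
      move: rr h1 h2; rewrite expr2; lra.
    have c0 := cabs_ge0 ((1 + z) / 2).
    have -> : cabs (((1 + z) / 2) ^+ m) `^ p = ((cabs ((1 + z) / 2) ^+ 2) `^ (p / 2)) ^+ m.
      by rewrite cabsX powRX.
    rewrite lerXn2r ?nnegrE ?powR_ge0//.
    by rewrite powR_leE ?exprn_ge0.
have cv : (fun m => \int[lam]_(th in `]0%R, tau[) (b th ^+ m / tau)%:E)%E @ \oo --> 0%:E.
  rewrite -[X in _ --> X](@integral0 _ _ _ lam `]0%R, tau[%classic).
  apply: (@dominated_cvg _ _ _ lam _ _ _ _ (fun=> (tau^-1)%:E)) => //.
  - by move=> m; exact: (mbm m `]0%R, tau[%classic).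
  - move=> x /=; rewrite in_itv /= => /andP[x0 x1].
    apply: cvg_EFin; first by near=> m.
    rewrite -[X in _ --> X](mul0r tau^-1); apply: cvgM; last exact: cvg_cst.
    by apply: cvg_expr; rewrite ger0_norm// bl.
  - apply/integrableP; split; first exact: measurable_cst.
    rewrite (eq_integral (cst (tau^-1)%:E)); last first.
      by move=> x _; rewrite gee0_abs// lee_fin invr_ge0 ltW.
    by rewrite integral_cst//= lebesgue_measure_itv /= lte_fin tau0 sube0 -EFinM ltry.
  - move=> n x _; rewrite gee0_abs lee_fin.
      by rewrite ler_piMl ?invr_ge0 ?(ltW tau0)// exprn_ile1.
    by rewrite mulr_ge0 ?exprn_ge0 ?invr_ge0// ltW.
have /fine_cvgP[fn /cvgrPdist_lt/(_ _ e0)] := cv.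
move: fn => [n0 _ hn0] [n1 _ hn1].
exists (maxn n0 n1) => m; rewrite geq_max => /andP[/hn0 /= fm /hn1 /=].
rewrite sub0r normrN => h; apply: hardy_gauge_le => r r0 r1.
apply: le_trans (key m r r0 r1) _; rewrite -(fineK fm) lee_fin.
by apply: le_trans (ler_norm _) (ltW h).
Unshelve. all: by end_near. Qed.

End HardyGauge.

(** * Bergman spaces *)

Section PlaneMeasure.
Variable R : realType.
Local Notation lam := (@lebesgue_measure R).
Local Notation mu2 := (lam \x lam)%E.
Local Notation RR := (measurableTypeR R * measurableTypeR R)%type.

Lemma lebesgue_measure_scale (c : R) (cn : 0 <= c) (A : set R) : 0 < c -> measurable A ->
  pushforward (mscale (NngNum cn) lam) (fun x => c * x : measurableTypeR R) A = lam A.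
Proof.
move=> c0 mA; apply/esym; apply: lebesgue_measure_unique => //= {A mA}.
  exact: measurable_funM.
move=> mphi _ [[a b] /= _ <-]; rewrite /pushforward /mscale /=.
have -> : (fun x => c * x) @^-1` `]a, b] = `]a / c, b / c]%classic.
  by apply/seteqP; split => x /=; rewrite !in_itv /= ltr_pdivrMr// ler_pdivlMr// ![_ * c]mulrC.
rewrite !lebesgue_measure_itv /= !lte_fin ltr_pM2r ?invr_gt0//.
case: ifP => _; last by rewrite mule0.
by rewrite -!EFinB -EFinM; congr (_%:E); field; rewrite gt_eqF.
Qed.

Lemma integral_scale (c : R) (F : R -> \bar R) : 0 < c ->
  measurable_fun setT F -> (forall x, (0 <= F x)%E) ->
  (\int[lam]_y F y = c%:E * \int[lam]_x F (c * x)%R)%E.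
Proof.
move=> c0 mF F0; have cn : 0 <= c := ltW c0.
pose phi : measurableTypeR R -> measurableTypeR R := fun x : R => c * x.
have mphi : measurable_fun setT phi by exact: measurable_funM.
have F0' : {in setT, forall y, (0 <= F y)%E} by move=> x _; exact: F0.
have mFphi : measurable_fun (setT : set (measurableTypeR R)) (F \o phi).
  exact: (measurableT_comp mF mphi).
transitivity (\int[mscale (NngNum cn) lam]_x (F \o phi) x)%E; last first.
  by rewrite ge0_integral_mscale// => x _; exact: F0.
have := @ge0_integral_pushforward _ _ _ _ R phi mphi (mscale (NngNum cn) lam)
  setT F measurableT mF F0'.
rewrite preimage_setT => <-; apply: eq_measure_integral => A mA _.
exact/esym/(lebesgue_measure_scale cn c0).
Qed.

Let mfst : measurable_fun setT (fun xy : RR => xy.1 : R). Proof. exact: measurable_fst. Qed.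
Let msnd : measurable_fun setT (fun xy : RR => xy.2 : R). Proof. exact: measurable_snd. Qed.

Lemma measurable_affine (a b c d : R) :
  measurable_fun setT (fun xy : RR => ((a * xy.1 + b * xy.2)%R, (c * xy.1 + d * xy.2)%R) : RR).
Proof.
apply: measurable_fun_pair.
  by apply: measurable_funD; apply: measurable_funM => //; exact: measurable_cst.
by apply: measurable_funD; apply: measurable_funM => //; exact: measurable_cst.
Qed.

Lemma plane_tonelli1 (G : RR -> \bar R) : measurable_fun setT G -> (forall x, (0 <= G x)%E) ->
  (\int[mu2]_xy G xy = \int[lam]_x \int[lam]_y G (x, y))%E.
Proof. by move=> mG G0; rewrite fubini_tonelli1. Qed.

Lemma plane_tonelli2 (G : RR -> \bar R) : measurable_fun setT G -> (forall x, (0 <= G x)%E) ->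
  (\int[mu2]_xy G xy = \int[lam]_y \int[lam]_x G (x, y))%E.
Proof. by move=> mG G0; rewrite plane_tonelli1// fubini_tonelli. Qed.

(** For fixed [y] a horizontal shear is a translation in [x]; Tonelli's theorem reduces to the
    line. *)
Lemma integral_shear1 (a : R) (G : RR -> \bar R) : measurable_fun setT G ->
  (forall x, (0 <= G x)%E) ->
  (\int[mu2]_xy G xy = \int[mu2]_xy G ((xy.1 + a * xy.2)%R, xy.2))%E.
Proof.
move=> mG G0.
have mS : measurable_fun setT (fun xy : RR => G ((xy.1 + a * xy.2)%R, xy.2)).
  apply: (measurableT_comp mG).
  have := measurable_affine 1 a 0 1; congr (measurable_fun _ _).
  by apply/funext => -[x y] /=; rewrite !mul1r mul0r add0r.
rewrite (plane_tonelli2 mG G0) (plane_tonelli2 mS (fun x => G0 _)).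
apply: eq_integral => y _.
have mGy : measurable_fun setT (fun x : R => G (x, y)).
  exact: measurableT_comp mG (measurable_pair2 y).
by have := integral_shift (a * y) measurableT mGy (fun x _ => G0 _); rewrite preimage_setT.
Qed.

Lemma integral_shear2 (a : R) (G : RR -> \bar R) : measurable_fun setT G ->
  (forall x, (0 <= G x)%E) ->
  (\int[mu2]_xy G xy = \int[mu2]_xy G (xy.1, (xy.2 + a * xy.1)%R))%E.
Proof.
move=> mG G0.
have mS : measurable_fun setT (fun xy : RR => G (xy.1, (xy.2 + a * xy.1)%R)).
  apply: (measurableT_comp mG).
  have := measurable_affine 1 0 a 1; congr (measurable_fun _ _).
  by apply/funext => -[x y] /=; rewrite !mul1r mul0r addr0 addrC.
rewrite (plane_tonelli1 mG G0) (plane_tonelli1 mS (fun x => G0 _)).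
apply: eq_integral => x _.
have mGx : measurable_fun setT (fun y : R => G (x, y)).
  exact: measurableT_comp mG (measurable_pair1 x).
by have := integral_shift (a * x) measurableT mGx (fun y _ => G0 _); rewrite preimage_setT.
Qed.

Lemma integral_scale2 (c : R) (G : RR -> \bar R) : 0 < c -> measurable_fun setT G ->
  (forall x, (0 <= G x)%E) ->
  (\int[mu2]_xy G xy = (c ^+ 2)%:E * \int[mu2]_xy G ((c * xy.1)%R, (c * xy.2)%R))%E.
Proof.
move=> c0 mG G0.
have mS : measurable_fun setT (fun xy : RR => G ((c * xy.1)%R, (c * xy.2)%R)).
  apply: (measurableT_comp mG).
  have := measurable_affine c 0 0 c; congr (measurable_fun _ _).
  by apply/funext => -[x y] /=; rewrite !mul0r addr0 add0r.
rewrite (plane_tonelli1 mG G0) (plane_tonelli1 mS (fun x => G0 _)).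
have mI : measurable_fun setT (fun x : R => (\int[lam]_y G (x, y))%E).
  exact: measurable_fun_fubini_tonelli_F.
rewrite (integral_scale c0 mI); last by move=> x; exact: integral_ge0.
have mI2 : measurable_fun setT (fun x : R => (\int[lam]_y G ((c * x)%R, (c * y)%R))%E).
  exact: (@measurable_fun_fubini_tonelli_F _ _ _ _ _ lam
    (fun xy : RR => G ((c * xy.1)%R, (c * xy.2)%R)) mS (fun x => G0 _)).
rewrite expr2 EFinM -muleA; congr (_ * _)%E.
rewrite -ge0_integralZl ?lee_fin ?(ltW c0)//; last by move=> x _; exact: integral_ge0.
apply: eq_integral => x _; rewrite (integral_scale c0)//.
exact: measurableT_comp mG (measurable_pair1 _).
Qed.

Lemma integral_rotation (c s : R) (G : RR -> \bar R) : c ^+ 2 + s ^+ 2 = 1 ->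
  measurable_fun setT G -> (forall x, (0 <= G x)%E) ->
  (\int[mu2]_xy G xy = \int[mu2]_xy G ((c * xy.1 - s * xy.2)%R, (s * xy.1 + c * xy.2)%R))%E.
Proof.
have mrot (c' s' : R) G' : measurable_fun setT G' -> measurable_fun setT (fun xy : RR =>
    G' ((c' * xy.1 - s' * xy.2)%R, (s' * xy.1 + c' * xy.2)%R) : \bar R).
  move=> mG'; apply: (measurableT_comp mG').
  have := measurable_affine c' (- s') s' c'; congr (measurable_fun _ _).
  by apply/funext => -[x y] /=; rewrite mulNr.
(* a rotation is a product of three shears *)
have rot (c' s' : R) G' : s' != 0 -> c' ^+ 2 + s' ^+ 2 = 1 -> measurable_fun setT G' ->
    (forall x, (0 <= G' x)%E) -> (\int[mu2]_xy G' xy = \int[mu2]_xy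
      G' ((c' * xy.1 - s' * xy.2)%R, (s' * xy.1 + c' * xy.2)%R))%E.
  (* For [c' = cos u] and [s' = sin u] this is [- tan (u / 2)], the coefficient of the two outer
     shears. *)
  move=> s0 cs mG' G'0; pose a := (c' - 1) / s'.
  have as1 : a * s' = c' - 1 by rewrite divfK.
  have ac : a * (1 + c') = - s'.
    apply: (mulIf s0); rewrite mulrAC as1 mulNr -expr2.
    have -> : s' ^+ 2 = 1 - c' ^+ 2 by lra.
    ring.
  rewrite (integral_shear1 a mG' G'0).
  set G1 := fun xy : RR => G' ((xy.1 + a * xy.2)%R, xy.2).
  have mG1 : measurable_fun setT G1.
    apply: (measurableT_comp mG').
    have := measurable_affine 1 a 0 1; congr (measurable_fun _ _).
    by apply/funext => -[x y] /=; rewrite !mul1r mul0r add0r.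
  rewrite (integral_shear2 s' mG1 (fun x => G'0 _)).
  set G2 := fun xy : RR => G1 (xy.1, (xy.2 + s' * xy.1)%R).
  have mG2 : measurable_fun setT G2.
    apply: (measurableT_comp mG1).
    have := measurable_affine 1 0 s' 1; congr (measurable_fun _ _).
    by apply/funext => -[x y] /=; rewrite !mul1r mul0r addr0 addrC.
  rewrite (integral_shear1 a mG2 (fun x => G'0 _)).
  apply: eq_integral => -[x y] _; rewrite /G2 /G1 /=; congr (G' (_, _)).
    have -> : x + a * y + a * (y + s' * (x + a * y)) =
      (1 + a * s') * x + a * (1 + (1 + a * s')) * y by ring.
    rewrite as1 (_ : 1 + (c' - 1) = c'); last by ring.
    by rewrite ac mulNr.
  have -> : y + s' * (x + a * y) = s' * x + (1 + a * s') * y by ring.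
  by rewrite as1; congr (_ + _ * _); ring.
move=> cs mG G0; have [s0|s0] := eqVneq s 0; last exact: rot.
have : (c - 1) * (c + 1) = 0.
  have -> : (c - 1) * (c + 1) = c ^+ 2 - 1 by ring.
  by move: cs; rewrite s0 expr0n addr0 => ->; rewrite subrr.
move/eqP; rewrite mulf_eq0 subr_eq0 addr_eq0 => /orP[/eqP->|/eqP->].
  by apply: eq_integral => -[x y] _; rewrite s0 /= !mul1r !mul0r subr0 add0r.
(* The half turn has zero sine and no shear factorization of this kind; it is the square of a
   quarter turn. *)
have i1 : (0 : R) ^+ 2 + 1 ^+ 2 = 1 by rewrite expr0n add0r expr1n.
rewrite (rot 0 1 G (oner_neq0 _) i1 mG G0).
rewrite (rot 0 1 _ (oner_neq0 _) i1 (mrot 0 1 G mG) (fun x => G0 _)).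
apply: eq_integral => -[x y] _; rewrite s0 /=; congr (G (_, _)); ring.
Qed.

(** The parameter is the square of the radius, so that area is linear in it. *)
Definition odisk (t : R) : set RR := [set xy : RR | xy.1 ^+ 2 + xy.2 ^+ 2 < t].

Lemma measurable_sqr : measurable_fun setT (fun xy : RR => xy.1 ^+ 2 + xy.2 ^+ 2 : R).
Proof. by apply: measurable_funD; exact: measurable_funX. Qed.

Lemma measurable_odisk (t : R) : measurable (odisk t).
Proof.
rewrite -[odisk t]setTI.
have := measurable_sqr measurableT (measurable_itv `]-oo, t[).
by congr measurable; congr (_ `&` _); apply/seteqP; split => xy /=; rewrite in_itv.
Qed.

Lemma odisk_scale (t : R) : 0 < t -> mu2 (odisk t) = (t%:E * mu2 (odisk 1))%E.
Proof.
move=> t0; have c0 : 0 < Num.sqrt t by rewrite sqrtr_gt0.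
have mI (s : R) : measurable_fun setT (fun xy : RR => (\1_(odisk s) xy)%:E : \bar R).
  by apply/measurable_EFinP; exact: measurable_indic (measurable_odisk s).
have I0 (s : R) xy : (0 <= (\1_(odisk s) xy)%:E :> \bar R)%E by rewrite lee_fin.
have E (s : R) : mu2 (odisk s) = (\int[mu2]_xy (\1_(odisk s) xy)%:E)%E.
  by rewrite integral_indic ?setIT//; exact: measurable_odisk.
rewrite !E.
rewrite (integral_scale2 c0 (mI t) (I0 t)) sqr_sqrtr ?(ltW t0)//; congr (_ * _)%E.
apply: eq_integral => -[x y] _; rewrite !indicE; congr ((nat_of_bool _)%:R%:E).
apply/idP/idP; rewrite !inE /odisk /= !exprMn sqr_sqrtr ?(ltW t0)// -mulrDr.
  by rewrite -ltr_pdivlMl// mulVf ?gt_eqF.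
by move=> h; rewrite -[ltRHS]mulr1 ltr_pM2l.
Qed.

(** Comparison with an inscribed square of side 1/2 and a circumscribed one of side 2. *)
Lemma odisk1_bounds : (4^-1%:E <= mu2 (odisk 1) /\ mu2 (odisk 1) <= 4%:E)%E.
Proof.
pose Q1 : set R := `]0, 2^-1]%classic; pose Q2 : set R := `](-1), 1]%classic.
have mQ1 : measurable Q1 by exact: measurable_itv.
have mQ2 : measurable Q2 by exact: measurable_itv.
have sqE (Q : set R) : measurable Q -> mu2 (Q `*` Q) = (lam Q * lam Q)%E.
  by move=> mQ; exact: product_measure1E.
have L1 : lam Q1 = (2^-1)%:E.
  by rewrite /Q1 lebesgue_measure_itv /= lte_fin invr_gt0 ltr0n sube0.
have L2 : lam Q2 = 2%:E.
  rewrite /Q2 lebesgue_measure_itv /= lte_fin -EFinB (_ : -1 < 1 :> R); last by lra.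
  by congr (_%:E); lra.
split.
  apply: (@le_trans _ _ (mu2 (Q1 `*` Q1))).
    by rewrite sqE// L1 -EFinM lee_fin -invfM -natrM.
  apply: le_measure; rewrite ?inE; [exact: measurableX|exact: measurable_odisk|].
  move=> [x y] [/=]; rewrite /Q1 /= !in_itv /= => /andP[x0 x1] /andP[y0 y1].
  have : x ^+ 2 <= 2^-1 ^+ 2 by rewrite lerXn2r ?nnegrE//; lra.
  have : y ^+ 2 <= 2^-1 ^+ 2 by rewrite lerXn2r ?nnegrE//; lra.
  rewrite /odisk /= exprVn -natrX => h1 h2; lra.
apply: (@le_trans _ _ (mu2 (Q2 `*` Q2))).
  apply: le_measure; rewrite ?inE; [exact: measurable_odisk|exact: measurableX|].
  move=> [x y]; rewrite /odisk /= => h.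
  have aux (u v : R) : u ^+ 2 + v ^+ 2 < 1 -> -1 < u <= 1.
    move=> uv; have u1 : `|u| < 1.
      rewrite -(@ltr_pXn2r _ 2)// ?nnegrE// expr1n real_normK ?num_real//.
      by have := sqr_ge0 v; lra.
    by move: u1; rewrite ltr_norml => /andP[-> /ltW ->].
  by split; rewrite /Q2 /= in_itv /=; [exact: (aux x y)|apply: (aux y x); rewrite addrC].
by rewrite sqE// L2 -EFinM lee_fin -natrM.
Qed.

End PlaneMeasure.

Lemma powR_exprn (R : realType) (s c : R) n : 0 <= c -> (c ^+ n) `^ s = (c `^ s) ^+ n.
Proof.
move=> c0; rewrite -(powR_mulrn n c0) -(powR_mulrn n (powR_ge0 _ _)).
by rewrite -!powRrM mulrC.
Qed.

(** The power is increasing or decreasing according to the sign of [al]; using both endpoints gives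
    bounds valid in either case. *)
Lemma powR_between (R : realType) (al a b u : R) : 0 < a -> a <= u -> u <= b ->
  u `^ al <= a `^ al + b `^ al /\ Num.min (a `^ al) (b `^ al) <= u `^ al.
Proof.
move=> a0 au ub.
have u0 : 0 < u by lra.
have b0 : 0 < b by lra.
have ha := powR_ge0 a al; have hb := powR_ge0 b al.
have [al0|al0] := leP 0 al.
  have h1 : u `^ al <= b `^ al by rewrite ge0_ler_powR ?nnegrE// ltW.
  have h2 : a `^ al <= u `^ al by rewrite ge0_ler_powR ?nnegrE// ltW.
  by split; [lra|rewrite ge_min h2].
have inv x : x `^ al = (x `^ (- al))^-1 by rewrite -powRN opprK.
have nal : 0 <= - al by lra.
have h1 : u `^ al <= a `^ al.
  rewrite !inv lef_pV2 ?posrE ?powR_gt0// ge0_ler_powR ?nnegrE// ltW//.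
have h2 : b `^ al <= u `^ al.
  rewrite !inv lef_pV2 ?posrE ?powR_gt0// ge0_ler_powR ?nnegrE// ltW//.
by split; [lra|rewrite ge_min h2 orbT].
Qed.

(** * The weighted area integral as a gauge *)

Section BergmanGauge.
Variables (R : realType) (p al : R).
Hypotheses (p1 : 1 < p) (al1 : -1 < al).
Local Notation C := R[i].
Local Notation lam := (@lebesgue_measure R).
Local Notation mu2 := (lam \x lam)%E.
Local Notation RR := (measurableTypeR R * measurableTypeR R)%type.
Let p0 : 0 < p. Proof. exact: lt_trans ltr01 p1. Qed.

Let ap0 : 0 <= (al + 1) / pi.
Proof. by rewrite divr_ge0 ?pi_ge0//; move: al1; lra. Qed.

Definition plane_pt (xy : RR) : C := (xy.1 +i* xy.2)%C.
Definition bweight (xy : RR) : R :=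
  (al + 1) * (1 - (xy.1 ^+ 2 + xy.2 ^+ 2)) `^ al / pi.
Definition bergman_gauge : (C -> C) -> \bar R := igauge mu2 p (odisk 1) plane_pt bweight.

Lemma BintE f : Bint p al f = bergman_gauge f.
Proof. by apply: eq_integral => xy _; rewrite /bweight !mulrA. Qed.

Lemma cmeasurable_plane_pt (A : set RR) : cmeasurable A plane_pt.
Proof.
split; apply: measurable_funTS; [exact: measurable_fst|exact: measurable_snd].
Qed.

Lemma cabs_plane_pt xy : cabs (plane_pt xy) ^+ 2 = xy.1 ^+ 2 + xy.2 ^+ 2.
Proof. by rewrite cabs_sqr. Qed.

Lemma plane_pt_lt1 xy : odisk 1 xy -> cabs (plane_pt xy) < 1.
Proof.
rewrite /odisk /= -cabs_plane_pt => h.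
by rewrite -(@ltr_pXn2r _ 2) ?nnegrE ?cabs_ge0// expr1n.
Qed.

Lemma bweight_ge0 xy : 0 <= bweight xy.
Proof.
rewrite /bweight divr_ge0 ?pi_ge0// mulr_ge0 ?powR_ge0//; move: al1; lra.
Qed.

Lemma measurable_bweight (A : set RR) : measurable_fun A bweight.
Proof.
apply: measurable_funTS; apply: measurable_funM; last exact: measurable_cst.
apply: measurable_funM; first exact: measurable_cst.
apply: (@measurableT_comp _ _ _ _ _ _ (fun x => x `^ al)); first exact: measurable_powR.
apply: measurable_funB; [exact: measurable_cst|exact: measurable_sqr].
Qed.

Lemma measurable_bergman_integrand f : analytic_D f ->
  measurable_fun (odisk 1) (fun xy => (cabs (f (plane_pt xy)) `^ p * bweight xy)%:E).
Proof.
move=> af; apply: igauge_measurable => //; [exact: measurable_odisk|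
  exact: cmeasurable_plane_pt|exact: plane_pt_lt1|exact: measurable_bweight].
Qed.

Lemma odisk_diff_area (s t : R) : 0 < s -> s <= t -> t <= 1 ->
  exists2 x : R, mu2 (odisk t `\` odisk s) = x%:E & (t - s) / 4 <= x /\ x <= 4 * (t - s).
Proof.
move=> s0 st t1.
have [b1 b2] := odisk1_bounds R.
have [P PE] : exists P : R, mu2 (odisk 1) = P%:E.
  exists (fine (mu2 (odisk 1))); rewrite fineK// ge0_fin_numE; last exact: measure_ge0.
  exact: le_lt_trans b2 (ltry _).
rewrite PE !lee_fin in b1 b2.
have t0 : 0 < t by exact: lt_le_trans st.
have sub : odisk t `&` odisk s = odisk s.
  by apply/setIidr => xy; rewrite /odisk /= => h; exact: lt_le_trans st.
exists ((t - s) * P).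
  rewrite measureD ?sub; [|exact: measurable_odisk|exact: measurable_odisk|].
  - by rewrite [X in (X - _)%E](odisk_scale t0) [X in (_ - X)%E](odisk_scale s0) PE -!EFinM -EFinB mulrBl.
  - by rewrite [X in (X < _)%E](odisk_scale t0) PE -EFinM ltry.
have ts : 0 <= t - s by lra.
split; first by rewrite ler_wpM2l.
by rewrite [leRHS]mulrC ler_wpM2l.
Qed.

(** Dyadic annuli: where [1 - |z| ^ 2] is of size [h n], the weight is of order [h n ^ al] and the
    area of order [h n]. The contributions are geometric with ratio [(1 / 2) ^ (1 + al)], which is
    below 1 because [al > -1]. *)
Lemma bweight_integrable_bound : exists K : R,
  (\int[mu2]_(xy in odisk 1) (bweight xy)%:E <= K%:E)%E.
Proof.
pose h n : R := (1 / 2) ^+ n.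
have h0 n : 0 < h n by rewrite exprn_gt0//; lra.
have hS n : h n.+1 = h n / 2 by rewrite /h exprS; lra.
have h1 n : h n <= 1 by rewrite exprn_ile1//; lra.
pose A n := odisk (1 - h n).
have mA n : measurable (A n) by exact: measurable_odisk.
have mb (D : set RR) : measurable_fun D (fun xy => (bweight xy)%:E).
  by apply/measurable_EFinP; exact: measurable_bweight.
have b0 (D : set RR) xy : D xy -> (0 <= (bweight xy)%:E)%E by rewrite lee_fin bweight_ge0.
have Asub n m : (n <= m)%N -> A n `<=` A m.
  move=> nm xy; rewrite /A /odisk /= => hx; apply: lt_le_trans hx _.
  rewrite lerD2l lerN2 -(subnKC nm) (_ : h _ = h n * h (m - n)%N); last by rewrite /h exprD.
  by rewrite ger_pMr.
pose q : R := (1 / 2) `^ (1 + al).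
have q0 : 0 <= q by exact: powR_ge0.
have q1 : q < 1.
  have one1 : (1 : R) `^ (1 + al) = 1 by rewrite powR1.
  rewrite /q -[ltRHS]one1.
  by apply: gt0_ltr_powR; rewrite ?nnegrE; move: al1; lra.
pose K := (al + 1) / pi * ((1 / 2) `^ al + 1) * 4.
have K0 : 0 <= K.
  by rewrite /K mulr_ge0// mulr_ge0// addr_ge0 ?powR_ge0.
have hq n : h n `^ al * h n = q ^+ n.
  rewrite -{2}(powRr1 (ltW (h0 n))) -powRD; last by apply/implyP => _; rewrite gt_eqF.
  by rewrite addrC powR_exprn//; lra.
have area n : (mu2 (A n.+1 `\` A n) <= (4 * h n)%:E)%E.
  (* [A 0] is empty, as its squared radius is 0; the annulus lemma asks for a positive inner radius,
     so the whole disk serves as bound. *)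
  case: n => [|n].
    apply: (@le_trans _ _ (mu2 (odisk 1))); last first.
      by rewrite /h expr0 mulr1; exact: (odisk1_bounds R).2.
    apply: le_measure; rewrite ?inE; [exact: measurableD|exact: measurable_odisk|].
    by move=> xy [] /= h' _; rewrite /odisk /=; apply: lt_le_trans h' _; have := h0 1%N; lra.
  have hn2 : h n.+1 <= 1 / 2 by rewrite hS; have := h1 n; lra.
  have hp := h0 n.+1.
  have [|||x -> [_ x2]] := @odisk_diff_area (1 - h n.+1) (1 - h n.+2).
  - by lra.
  - by rewrite [h n.+2]hS; lra.
  - by have := h0 n.+2; lra.
  by rewrite lee_fin; apply: le_trans x2 _; rewrite [h n.+2]hS; lra.
have ann n xy : (A n.+1 `\` A n) xy -> bweight xy <= (al + 1) / pi * (((1 / 2) `^ al + 1) * h n `^ al).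
  move=> [] /=; rewrite /A /odisk /= => x1 /negP; rewrite -leNgt => x2.
  rewrite /bweight [leLHS]mulrAC ler_wpM2l//.
  set u := 1 - _.
  have hn := h0 n; rewrite hS in x1.
  have [|||up _] := @powR_between R al (h n / 2) (h n) u; [lra|rewrite /u; lra|rewrite /u; lra|].
  apply: le_trans up _; have -> : h n / 2 = 1 / 2 * h n by lra.
  by rewrite powRM ?(ltW hn)//; lra.
have step n : (\int[mu2]_(xy in A n.+1) (bweight xy)%:E <=
    \int[mu2]_(xy in A n) (bweight xy)%:E + (K * q ^+ n)%:E)%E.
  have -> : A n.+1 = A n `|` (A n.+1 `\` A n) by rewrite setDUK//; exact: Asub.
  have mD : measurable (A n.+1 `\` A n) by exact: measurableD.
  have dj : [disjoint A n & A n.+1 `\` A n]%classic by apply/disj_setPS => xy [h' []].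
  rewrite (ge0_integral_setU _ (mA n) mD (mb _) (b0 _) dj) leeD2l//.
  pose c0 := (al + 1) / pi * (((1 / 2) `^ al + 1) * h n `^ al).
  have H : (\int[mu2]_(xy in A n.+1 `\` A n) (bweight xy)%:E <=
      \int[mu2]_(xy in A n.+1 `\` A n) cst c0%:E xy)%E.
    apply: ge0_le_integral => //; first by move=> xy; exact: b0.
    by move=> xy /ann; rewrite lee_fin.
  apply: le_trans H _.
  rewrite integral_cst//.
  apply: (@le_trans _ _ (((al + 1) / pi * (((1 / 2) `^ al + 1) * h n `^ al))%:E * (4 * h n)%:E)%E).
    apply: lee_wpmul2l; last exact: area.
    by rewrite lee_fin mulr_ge0// mulr_ge0 ?powR_ge0// addr_ge0 ?powR_ge0.
  rewrite -EFinM lee_fin -hq /K le_eqVlt; apply/orP; left; apply/eqP; ring.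
have bound n : (\int[mu2]_(xy in A n) (bweight xy)%:E <= (K * \sum_(k < n) q ^+ k)%:E)%E.
  elim: n => [|n IH].
    have -> : A 0%N = set0.
      apply/seteqP; split => // xy; rewrite /A /odisk /= /h expr0 subrr.
      by rewrite ltNge addr_ge0 ?sqr_ge0.
    by rewrite integral_set0 big_ord0 mulr0.
  apply: le_trans (step n) _; rewrite big_ord_recr /= mulrDr EFinD.
  by rewrite leeD2r.
exists (K / (1 - q)).
have := @ge0_nondecreasing_set_cvg_integral _ _ _ A (fun xy => (bweight xy)%:E) mu2.
move=> /(_ _ mA (fun n => mb (A n)) (fun n => b0 (A n))).
have -> : \bigcup_n A n = odisk 1.
  apply/seteqP; split => [xy [n _]|xy]; rewrite /A /odisk /=.
    by move=> h'; apply: lt_le_trans h' _; have := h0 n; lra.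
  move=> h'; have [n hn] : exists n, h n < 1 - (xy.1 ^+ 2 + xy.2 ^+ 2).
    have [N hN] := @expr_small R (1 / 2) 1 (1 - (xy.1 ^+ 2 + xy.2 ^+ 2)) ltac:(lra) ltac:(lra) ler01 ltac:(lra).
    by exists N; have := hN N (leqnn _); rewrite mul1r.
  by exists n => //=; lra.
have Ah : {homo A : n m / (n <= m)%N >-> (n <= m)%O}.
  by move=> n m nm; apply/subsetPset; exact: Asub.
move=> /(_ Ah) cv; apply: cvge_le cv.
near=> n; apply: le_trans (bound n) _; rewrite lee_fin ler_wpM2l//.
exact: geom_sum_le.
Unshelve. all: by end_near. Qed.

Lemma bergman_gaugeP : gauge p bergman_gauge.
Proof.
have mA := measurable_odisk (1 : R).
split.
- by move=> f; apply: igauge_ge0 => xy _; exact: bweight_ge0.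
- move=> n F f a; apply: igauge_dom => //; [exact: cmeasurable_plane_pt|
    exact: plane_pt_lt1|exact: measurable_bweight|by move=> xy _; exact: bweight_ge0].
- move=> u F M; apply: igauge_fatou => //; [exact: cmeasurable_plane_pt|
    exact: plane_pt_lt1|exact: measurable_bweight|by move=> xy _; exact: bweight_ge0].
- move=> f w af w1.
  pose F xy : \bar R := (cabs (f (plane_pt xy)) `^ p * bweight xy)%:E.
  pose c := complex.Re w; pose s := complex.Im w.
  have cs : c ^+ 2 + s ^+ 2 = 1 by rewrite -cabs_sqr w1 expr1n.
  have mF : measurable_fun (odisk 1) F.
    exact: measurable_bergman_integrand.
  (* Extension by 0 lets the rotation formula of the whole plane apply; disk and weight depend on
     [|z| ^ 2] only. *)
  have mG : measurable_fun setT (F \_ (odisk 1)).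
    by apply/(measurable_restrictT _ mA).
  have G0 xy : (0 <= (F \_ (odisk 1)) xy)%E.
    by rewrite patchE; case: ifP => // _; rewrite lee_fin mulr_ge0 ?powR_ge0 ?bweight_ge0.
  have -> : bergman_gauge f = (\int[mu2]_xy (F \_ (odisk 1)) xy)%E.
    by rewrite -integral_mkcond.
  rewrite (integral_rotation cs mG G0) /bergman_gauge /igauge integral_mkcond.
  rewrite le_eqVlt; apply/orP; left; apply/eqP; apply: eq_integral => -[x y] _.
  have sq : (c * x - s * y) ^+ 2 + (s * x + c * y) ^+ 2 = x ^+ 2 + y ^+ 2.
    transitivity ((c ^+ 2 + s ^+ 2) * (x ^+ 2 + y ^+ 2)); first by ring.
    by rewrite cs mul1r.
  rewrite !patchE /=.
  have -> : ((c * x - s * y, s * x + c * y) \in odisk 1) = ((x, y) \in odisk (1 : R)).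
    by apply/idP/idP; rewrite !inE /odisk /= sq.
  case: ifP => // _; rewrite /F /bweight /= sq; congr ((cabs (f _) `^ _ * _)%:E).
  rewrite /plane_pt /c /s; case: (w) => a b /=.
  by apply/eqP; rewrite eq_complex /=; apply/andP; split; apply/eqP; ring.
- have [K hK] := bweight_integrable_bound.
  apply: (@le_lt_trans _ _ K%:E); last exact: ltry.
  apply: le_trans hK; rewrite le_eqVlt; apply/orP; left; apply/eqP.
  by apply: eq_integral => xy _; rewrite cabs1 powR1 mul1r.
Qed.

(** Integrate over an annulus with inner radius [r], where [|z ^ k| >= r ^ k], and which stays away
    from the unit circle so that the weight is bounded below for either sign of [al]. *)
Lemma bergman_mono_lb (r : R) : 0 < r -> r < 1 -> exists2 c : R, 0 < c & forall k,
  (((c * r ^+ k) `^ p)%:E <= bergman_gauge (fun z => (z ^+ k)%R))%E.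
Proof.
move=> r0 r1.
have r20 : 0 < r ^+ 2 by rewrite exprn_gt0.
have r21 : r ^+ 2 < 1 by rewrite exprn_ilt1// ltW.
pose a := (1 - r ^+ 2) / 2.
have a0 : 0 < a by rewrite /a; lra.
pose kap := (al + 1) / pi * Num.min (a `^ al) ((1 : R) `^ al).
have kap0 : 0 < kap.
  rewrite mulr_gt0 ?divr_gt0 ?pi_gt0 ?lt_min ?powR_gt0//; last by move: al1; lra.
have [|||ar arE [ar0 _]] := @odisk_diff_area (r ^+ 2) (1 - a); [lra|rewrite /a; lra|lra|].
pose D : set RR := odisk (1 - a) `\` odisk (r ^+ 2).
have mD : measurable D by apply: measurableD; exact: measurable_odisk.
have ar1 : 0 < ar by apply: lt_le_trans ar0; rewrite /a; lra.
have ka : 0 < kap * ar by rewrite mulr_gt0.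
exists ((kap * ar) `^ p^-1); first by rewrite powR_gt0.
move=> k; rewrite powRM ?powR_ge0 ?exprn_ge0 ?(ltW r0)// powR_root ?(ltW ka)//.
have az : analytic_D (fun z : C => z ^+ k).
  by apply: analytic_eq (analytic_poly 'X^k) _ => z _; rewrite hornerXn.
have Dsub : D `<=` odisk 1.
  by move=> xy []; rewrite /odisk /= => h _; apply: lt_le_trans h _; lra.
have mz : measurable_fun (odisk 1) (fun xy => (cabs (plane_pt xy ^+ k) `^ p * bweight xy)%:E).
  exact: (measurable_bergman_integrand az).
apply: (@le_trans _ _ (\int[mu2]_(xy in D) (cabs (plane_pt xy ^+ k) `^ p * bweight xy)%:E)%E); last first.
  apply: ge0_subset_integral => //; first exact: measurable_odisk.
  by move=> xy _; rewrite lee_fin mulr_ge0 ?powR_ge0 ?bweight_ge0.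
apply: (@le_trans _ _ (\int[mu2]_(xy in D) cst ((r ^+ k) `^ p * kap)%:E xy)%E).
  rewrite integral_cst// [X in (_ <= _ * X)%E]arE -EFinM lee_fin.
  by rewrite le_eqVlt; apply/orP; left; apply/eqP; ring.
apply: ge0_le_integral => //.
- by move=> xy _; rewrite lee_fin mulr_ge0 ?powR_ge0// ltW.
- exact: (measurable_funS (measurable_odisk 1) Dsub mz).
move=> xy [] /=; rewrite /odisk /= => x1 /negP; rewrite -leNgt => x2.
rewrite lee_fin; apply: ler_pM.
- exact: powR_ge0.
- exact: ltW.
- rewrite powR_leE ?exprn_ge0 ?cabs_ge0 ?(ltW r0)// cabsX lerXn2r ?nnegrE ?cabs_ge0 ?(ltW r0)//.
  by rewrite -(@ler_pXn2r _ 2) ?nnegrE ?cabs_ge0 ?(ltW r0)// cabs_plane_pt.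
- rewrite /bweight /kap [leRHS]mulrAC ler_wpM2l//.
  have s0 : 0 <= xy.1 ^+ 2 + xy.2 ^+ 2 by rewrite addr_ge0 ?sqr_ge0.
  by apply: (powR_between al a0 _ _).2; lra.
Qed.

(** [|(1 + z) / 2| < 1] throughout the open disk, so the powers tend to 0 pointwise and are
    dominated by the integrable weight. *)
Lemma bergman_peak_small (e : R) : 0 < e -> exists m0, forall m, (m0 <= m)%N ->
  (bergman_gauge (fun z => (((1 + z) / 2) ^+ m)%R) <= e%:E)%E.
Proof.
move=> e0.
have aphi m : analytic_D (fun z : C => ((1 + z) / 2) ^+ m).
  apply: analyticX; apply: analytic_eq (analytic_poly ((2^-1)%:P * (1 + 'X))) _.
  by move=> z _; rewrite !hornerE mulrC.
have phi1 (z : C) : cabs z < 1 -> cabs ((1 + z) / 2) < 1.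
  move=> z1; rewrite cabsM cabsV (cabs_nat R 2) ltr_pdivrMr// mul1r.
  by apply: le_lt_trans (cabsD _ _) _; rewrite cabs1; lra.
have mA := measurable_odisk (1 : R).
have cv : (fun m => bergman_gauge (fun z => ((1 + z) / 2) ^+ m)) @ \oo --> 0%:E.
  rewrite -[X in _ --> X](@integral0 _ _ _ mu2 (odisk (1 : R))).
  apply: (@dominated_cvg _ _ _ mu2 _ mA _ _ (fun xy => (bweight xy)%:E)) => //.
  - by move=> m; exact: (measurable_bergman_integrand (aphi m)).
  - move=> xy /plane_pt_lt1/phi1 h1; apply: cvg_EFin; first by near=> m.
    rewrite -[X in _ --> X](mul0r (bweight xy)); apply: cvgM; last exact: cvg_cst.
    under eq_fun do rewrite cabsX powR_exprn ?cabs_ge0//.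
    apply: cvg_expr; rewrite ger0_norm ?powR_ge0//.
    have -> : (1 : R) = 1 `^ p by rewrite powR1.
    by apply: gt0_ltr_powR; rewrite ?nnegrE ?cabs_ge0.
  - apply/integrableP; split; first by apply/measurable_EFinP; exact: measurable_bweight.
    have [K hK] := bweight_integrable_bound; apply: (@le_lt_trans _ _ K%:E); last exact: ltry.
    apply: le_trans hK; rewrite le_eqVlt; apply/orP; left; apply/eqP.
    by apply: eq_integral => xy _; rewrite gee0_abs// lee_fin bweight_ge0.
  - move=> m xy /plane_pt_lt1/phi1 h1; rewrite gee0_abs lee_fin; last first.
      by rewrite mulr_ge0 ?powR_ge0 ?bweight_ge0.
    rewrite ler_piMl ?bweight_ge0//.
    rewrite cabsX powR_exprn ?cabs_ge0// exprn_ile1 ?powR_ge0//.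
    have -> : (1 : R) = 1 `^ p by rewrite powR1.
    by rewrite powR_leE ?cabs_ge0// ltW.
have /fine_cvgP[fn /cvgrPdist_lt/(_ _ e0)] := cv.
move: fn => [n0 _ hn0] [n1 _ hn1].
exists (maxn n0 n1) => m; rewrite geq_max => /andP[/hn0 /= fm /hn1 /=].
rewrite sub0r normrN => h; rewrite -(fineK fm) lee_fin.
by apply: le_trans (ler_norm _) (ltW h).
Unshelve. all: by end_near. Qed.

Lemma bergman_memP f : fmem (Bergman p al) f <-> gmem bergman_gauge f.
Proof. by rewrite /gmem -BintE. Qed.

Lemma bergman_normP f : fnorm (Bergman p al) f = gnorm p bergman_gauge f.
Proof. by rewrite /= /bergman_norm BintE. Qed.

End BergmanGauge.

(** * Boundary maxima and complex integrals *)

Section BoundaryMaximum.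
Variable R : realType.
Local Notation C := R[i].

Lemma inv_nat_small (e : R) : 0 < e -> exists n0, forall n, (n0 <= n)%N -> n.+1%:R^-1 < e.
Proof.
move=> e0; have /real_cvg0P h : forall n : nat, 0 <= n.+1%:R^-1 :> R.
  by move=> n; rewrite invr_ge0.
have [N hN] := (h.1 (@cvg_harmonic R)) e e0.
by exists N.
Qed.

(** Bolzano-Weierstrass for the real parts, then for the imaginary parts along the first
    subsequence. *)
Lemma circle_cluster (w : nat -> C) : (forall n, 1 - n.+1%:R^-1 <= cabs (w n) < 1) ->
  exists2 xi, cabs xi = 1 & exists2 s : nat -> nat, (forall n, (n <= s n)%N) &
    ccvg (fun n => w (s n)) xi.
Proof.
move=> hw.
have bRe : bounded_fun (fun n => complex.Re (w n)).
  exists 1; split => // M M1 n _ /=; apply: le_trans (ltW M1).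
  by apply: le_trans (Re_le_cabs _) _; case/andP: (hw n) => _ /ltW.
have [s1 is1 /cvg_ex[a1 c1]] := bolzano_weierstrass bRe.
have bIm : bounded_fun (fun n => complex.Im (w (s1 n))).
  exists 1; split => // M M1 n _ /=; apply: le_trans (ltW M1).
  by apply: le_trans (Im_le_cabs _) _; case/andP: (hw (s1 n)) => _ /ltW.
have [s2 is2 /cvg_ex[a2 c2]] := bolzano_weierstrass bIm.
have inc (s : nat -> nat) : increasing_seq s -> forall n, (n <= s n)%N.
  move=> /increasing_seqP h; elim=> // n IH; exact: leq_ltn_trans IH (h n).
have sn n : (n <= s1 (s2 n))%N by apply: leq_trans (inc _ is2 n) (inc _ is1 _).
pose xi : C := (a1 +i* a2)%C.
have cxi : ccvg (fun n => w (s1 (s2 n))) xi.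
  apply: ccvg_ReIm => //=.
  have : (fun n => complex.Re (w (s1 n))) (s2 n) @[n --> \oo] --> a1.
    apply: (@cvg_comp _ _ _ s2 (fun n => complex.Re (w (s1 n))) _ _ _ _ c1).
    move=> A [N _ hN]; exists N => // n /= Nn; apply: hN => /=.
    exact: leq_trans Nn (inc _ is2 n).
  by [].
exists xi; last by exists (s1 \o s2).
have lim1 : (fun n => cabs (w (s1 (s2 n)))) @ \oo --> (1 : R).
  apply/cvgrPdist_lt => e e0; have [N hN] := inv_nat_small e0.
  exists N => // n /= Nn; have /andP[h1 h2] := hw (s1 (s2 n)).
  have h3 := hN _ (leq_trans Nn (sn n)).
  by rewrite gtr0_norm; move: h1 h2 h3; set u := _^-1; set v := cabs _ => *; lra.
exact: cvg_unique (ccvg_cabs cxi) lim1.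
Qed.

(** Near-maximizers may sit deep inside the disk; the maximum principle moves each one out to a
    circle of radius at least [1 - 1 / n.+1] without loss, and a cluster point then lies on the unit
    circle. *)
Lemma boundary_maximizer (f : C -> C) (S : R) : analytic_D f ->
  (forall e : R, 0 < e -> exists2 z, cabs z < 1 & S - e < cabs (f z)) ->
  exists (xi : C) (w : nat -> C), [/\ cabs xi = 1, forall n, cabs (w n) < 1,
    ccvg w xi & forall n, S - n.+1%:R^-1 < cabs (f (w n))].
Proof.
move=> af hS.
have ex n : exists w : C, 1 - n.+1%:R^-1 <= cabs w < 1 /\ S - n.+1%:R^-1 < cabs (f w).
  have i0 : 0 < n.+1%:R^-1 :> R by rewrite invr_gt0.
  have [z z1 hz] := hS _ i0.
  pose r := Num.max (cabs z) (1 - n.+1%:R^-1).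
  have r1 : r < 1 by rewrite /r gt_max z1 ltrBlDr ltrDl.
  have zr : cabs z <= r by rewrite /r le_max lexx.
  have hr : 1 - n.+1%:R^-1 <= r by rewrite /r le_max lexx orbT.
  apply: contrapT => no.
  have : cabs (f z) <= S - n.+1%:R^-1.
    apply: (max_modulus af r1 zr) => w wr; rewrite leNgt; apply/negP => h.
    by apply: no; exists w; rewrite wr hr r1.
  by rewrite leNgt hz.
have [w hw] := choice ex.
have [xi xi1 [s hs cs]] := circle_cluster (fun n => (hw n).1).
exists xi, (fun n => w (s n)); split => // n; first by case: (hw (s n)) => /andP[].
apply: le_lt_trans (hw (s n)).2.
by rewrite lerD2l lerN2 lef_pV2 ?posrE// ler_nat ltnS.
Qed.

End BoundaryMaximum.

(** * The complex integral over the unit interval *)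

Section ComplexIntegral.
Variable R : realType.
Local Notation C := R[i].
Local Notation lam := (@lebesgue_measure R).
Local Notation T := (measurableTypeR R).
Local Notation I := (`]0%R, 1%R[%classic : set T).
Implicit Types (h k : R -> C) (b : R -> R).

Let mI : measurable I. Proof. exact: measurable_itv. Qed.

Lemma ReM (x y : C) : complex.Re (x * y) =
  complex.Re x * complex.Re y - complex.Im x * complex.Im y.
Proof. by case: x; case: y. Qed.

Lemma ImM (x y : C) : complex.Im (x * y) =
  complex.Re x * complex.Im y + complex.Im x * complex.Re y.
Proof. by case: x; case: y. Qed.

Lemma ReD (x y : C) : complex.Re (x + y) = complex.Re x + complex.Re y.
Proof. by case: x; case: y. Qed.

Lemma ImD (x y : C) : complex.Im (x + y) = complex.Im x + complex.Im y.
Proof. by case: x; case: y. Qed.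

Definition cintegrable h : Prop :=
  lam.-integrable I (fun t => (complex.Re (h t))%:E) /\
  lam.-integrable I (fun t => (complex.Im (h t))%:E).

Lemma cintegrable_dom h b : @cmeasurable _ T R I h -> lam.-integrable I (EFin \o b) ->
  (forall t, I t -> cabs (h t) <= b t) -> cintegrable h.
Proof.
move=> [m1 m2] ib hb; split; apply: (le_integrable mI _ _ ib) => /=.
- exact/measurable_EFinP.
- move=> t It; rewrite lee_fin; apply: le_trans (Re_le_cabs _) _.
  exact: le_trans (hb t It) (ler_norm _).
- exact/measurable_EFinP.
- move=> t It; rewrite lee_fin; apply: le_trans (Im_le_cabs _) _.
  exact: le_trans (hb t It) (ler_norm _).
Qed.

Lemma cintegrableD h k : cintegrable h -> cintegrable k -> cintegrable (fun t => h t + k t).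
Proof.
move=> [h1 h2] [k1 k2]; split.
- apply: (@eq_integrable _ _ _ _ _ mI _ _ _ (integrableD mI h1 k1)) => t _ /=.
  by rewrite ReD EFinD.
- apply: (@eq_integrable _ _ _ _ _ mI _ _ _ (integrableD mI h2 k2)) => t _ /=.
  by rewrite ImD EFinD.
Qed.

Lemma cintegrableZ h (c : C) : cintegrable h -> cintegrable (fun t => c * h t).
Proof.
move=> [h1 h2]; split.
- have := integrableB mI (integrableZl mI (complex.Re c) h1) (integrableZl mI (complex.Im c) h2).
  by apply: eq_integrable => // t _ /=; rewrite ReM EFinB !EFinM.
- have := integrableD mI (integrableZl mI (complex.Re c) h2) (integrableZl mI (complex.Im c) h1).
  by apply: eq_integrable => // t _ /=; rewrite ImM EFinD !EFinM.
Qed.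

Lemma cint01D h k : cintegrable h -> cintegrable k ->
  cint01 (fun t => h t + k t) = cint01 h + cint01 k.
Proof.
move=> [h1 h2] [k1 k2]; rewrite /cint01.
under eq_Rintegral do rewrite ReD.
under [in X in (_ +i* X)%C]eq_Rintegral do rewrite ImD.
by rewrite !RintegralD.
Qed.

Lemma cint01Z h (c : C) : cintegrable h -> cint01 (fun t => c * h t) = c * cint01 h.
Proof.
move=> [h1 h2]; rewrite /cint01.
under eq_Rintegral do rewrite ReM.
under [in X in (_ +i* X)%C]eq_Rintegral do rewrite ImM.
have Z r (f : R -> R) : lam.-integrable I (fun t => (f t)%:E) ->
  lam.-integrable I (EFin \o (fun t => r * f t)).
  move=> if_; apply: (@eq_integrable _ _ _ _ _ mI _ _ _ (integrableZl mI r if_)) => t _ /=.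
  by rewrite EFinM.
rewrite RintegralB ?RintegralD//; try exact: Z.
rewrite !RintegralZl//.
by case: c {Z}.
Qed.

Lemma cint01_sum n (h : 'I_n -> R -> C) : (forall i, cintegrable (h i)) ->
  cintegrable (fun t => \sum_(i < n) h i t) /\
  cint01 (fun t => \sum_(i < n) h i t) = \sum_(i < n) cint01 (h i).
Proof.
elim: n h => [|n IH] h ih.
  have z : (fun t : R => \sum_(i < 0) h i t) = fun=> 0.
    by apply/funext => t; rewrite big_ord0.
  rewrite z big_ord0; split; first by split; exact: integrable0.
  by rewrite /cint01 /Rintegral /= integral0.
have [i1 e1] := IH _ (fun i => ih (widen_ord (leqnSn n) i)).
have -> : (fun t => \sum_(i < n.+1) h i t) = fun t =>
    \sum_(i < n) h (widen_ord (leqnSn n) i) t + h ord_max t.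
  by apply/funext => t; rewrite big_ord_recr.
by split; [exact: cintegrableD|rewrite cint01D// e1 big_ord_recr].
Qed.

(** After rotation by the phase of the integral, its modulus is the integral of a real part, to
    which monotonicity applies. *)
Lemma cint01_le h b : @cmeasurable _ T R I h -> lam.-integrable I (EFin \o b) ->
  (forall t, I t -> cabs (h t) <= b t) -> cabs (cint01 h) <= Rintegral lam I b.
Proof.
move=> mh ib hb; have ih := cintegrable_dom mh ib hb.
have [u u1 hu] := phase_exists (cint01 h).
have : complex.Re (u * cint01 h) = cabs (cint01 h) by rewrite hu.
rewrite -(cint01Z _ ih) /= => <-.
apply: le_Rintegral => //; first exact: (cintegrableZ u ih).1.
move=> t It; apply: le_trans (ler_norm _) _; apply: le_trans (Re_le_cabs _) _.
by rewrite cabsM u1 mul1r; apply: hb.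
Qed.

Lemma cint01_dct (h : nat -> R -> C) k b : (forall n, @cmeasurable _ T R I (h n)) ->
  lam.-integrable I (EFin \o b) -> (forall n t, I t -> cabs (h n t) <= b t) ->
  (forall t, I t -> ccvg (h ^~ t) (k t)) ->
  ccvg (fun n => cint01 (h n)) (cint01 k).
Proof.
move=> mh ib hb hk.
have one (P : C -> R) : (forall z, `|P z| <= cabs z) ->
    (forall n, @measurable_fun _ _ T R I (fun t => P (h n t))) ->
    (forall t, I t -> (fun n => P (h n t)) @ \oo --> P (k t)) ->
    (fun n => Rintegral lam I (fun t => P (h n t))) @ \oo --> Rintegral lam I (fun t => P (k t)).
  move=> Pc mP cP.
  have mk : @measurable_fun _ _ T R I (fun t => P (k t)) by exact: measurable_fun_cvg mP cP.
  have [ik cv] : lam.-integrable I (fun t => (P (k t))%:E) /\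
      ((fun n => \int[lam]_(t in I) (P (h n t))%:E)%E @ \oo -->
      (\int[lam]_(t in I) (P (k t))%:E)%E).
    have fst_third : forall A B D : Prop, [/\ A, B & D] -> A /\ D by move=> A B D [].
    apply: fst_third.
    apply: (@dominated_convergence _ _ _ lam I mI _ _ (EFin \o b)) => //.
    - by move=> n; exact/measurable_EFinP.
    - exact/measurable_EFinP.
    - apply: aeW => t It; apply: cvg_EFin; first by apply: nearW.
      exact: cP.
    - apply: aeW => t n It /=; rewrite lee_fin.
      exact: le_trans (Pc _) (hb n t It).
  apply: fine_cvg; rewrite /Rintegral fineK//.
  exact: integrable_fin_num.
have [m1 m2] := (fun n => (mh n).1, fun n => (mh n).2).
apply: ccvg_ReIm => /=.
- by apply: one => [z|n|t It]; [exact: Re_le_cabs|exact: m1|apply: ccvg_Re; exact: hk].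
- by apply: one => [z|n|t It]; [exact: Im_le_cabs|exact: m2|apply: ccvg_Im; exact: hk].
Qed.

End ComplexIntegral.

(** * Families of multipliers *)

Section DiskAlgebra.
Variable R : realType.
Local Notation C := R[i].
Variable h : C -> C.
Hypothesis dh : disk_algebra h.

Lemma supnorm_ub z : cabs z < 1 -> cabs (h z) <= supnorm h.
Proof.
have [_ [[M hM] _]] := dh => z1; apply: sup_ubound; last by exists z.
by exists M => _ [w w1 <-]; exact: hM.
Qed.

Lemma supnorm_adherent (e : R) : 0 < e ->
  exists2 z, cabs z < 1 & supnorm h - e < cabs (h z).
Proof.
move=> e0; have [_ [[M hM] _]] := dh.
have hs : has_sup [set cabs (h z) | z in @disk R].
  split; first by exists (cabs (h 0)), 0 => //; rewrite /disk /= cabs0.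
  by exists M => _ [w w1 <-]; exact: hM.
by have [_ [z z1 <-] hz] := sup_adherent e0 hs; exists z.
Qed.

Lemma supnorm_ge0 : 0 <= supnorm h.
Proof. by apply: le_trans (cabs_ge0 (h 0)) (supnorm_ub _); rewrite cabs0. Qed.

Lemma disk_algebra_cvg (w : nat -> C) xi : cabs xi = 1 -> (forall n, cabs (w n) < 1) ->
  ccvg w xi -> ccvg (fun n => h (w n)) (h xi).
Proof.
move=> xi1 w1 /ccvgP cw; apply/ccvgP => e e0.
have [d d0 hd] := dh.2.2 xi ltac:(by rewrite xi1) e e0.
have [n0 hn] := cw d d0.
by exists n0 => n nn; apply: hd; [exact: ltW|exact: hn].
Qed.

End DiskAlgebra.

Lemma ccvg_lim_ge (R : realType) (u : nat -> R[i]) c (S : R) : ccvg u c ->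
  (forall n, S - n.+1%:R^-1 < cabs (u n)) -> S <= cabs c.
Proof.
move=> /ccvgP uc hu; rewrite leNgt; apply/negP => lt_.
have d0 : 0 < (S - cabs c) / 2 by lra.
have [n0 hn0] := inv_nat_small d0; have [n1 hn1] := uc _ d0.
pose n := maxn n0 n1.
have h1 := hn0 n (leq_maxl _ _); have h2 := hn1 n (leq_maxr _ _).
have h3 := hu n; have h4 := ler_cabsB (u n) c.
move: h1 h2 h3 h4; set v := _^-1 => *; lra.
Qed.

Lemma radial_cvg (R : realType) (xi : R[i]) : cabs xi = 1 ->
  exists2 w : nat -> R[i], (forall n, cabs (w n) < 1) & ccvg w xi.
Proof.
move=> xi1; pose q n : R := n.+1%:R^-1.
have q0 n : 0 < q n by rewrite invr_gt0.
have q1 n : q n <= 1 by rewrite invf_le1// ler1n.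
exists (fun n => ((1 - q n)%:C)%C * xi) => [n|].
  by rewrite cabsM xi1 mulr1 cabs_real ger0_norm ?subr_ge0// ltrBlDr ltrDl.
apply: ccvg_le (@cvg_harmonic R) _ => n.
have -> : ((1 - q n)%:C)%C * xi - xi = ((- q n)%:C)%C * xi.
  by rewrite rmorphB rmorphN /= mulrBl mulNr mul1r addrAC subrr add0r.
by rewrite cabsM xi1 mulr1 cabs_real normrN ger0_norm // ltW.
Qed.

(** * The family of multipliers and its mean *)

Section MultiplierFamily.
Variables (R : realType) (p : R) (N : (R[i] -> R[i]) -> \bar R) (X : fspace R).
Local Notation C := R[i].
Local Notation lam := (@lebesgue_measure R).
Local Notation T := (measurableTypeR R).
Local Notation I := (`]0%R, 1%R[%classic : set T).
Hypotheses (p1 : 1 < p) (gN : gauge p N).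
Hypothesis mono_lb : forall r : R, 0 < r -> r < 1 ->
  exists2 c : R, 0 < c & forall k, (((c * r ^+ k) `^ p)%:E <= N (fun z => (z ^+ k)%R))%E.
Hypothesis peak_small : forall e : R, 0 < e -> exists m0, forall m, (m0 <= m)%N ->
  (N (fun z => (((1 + z) / 2) ^+ m)%R) <= e%:E)%E.
Hypothesis memX : forall f, fmem X f <-> gmem N f.
Hypothesis normX : forall f, gmem N f -> fnorm X f = gnorm p N f.
Variable g : R -> C -> C.
Hypothesis dg : forall t, I t -> disk_algebra (g t).
Hypothesis W : condW X (fun t => Mop (g t)).

Let mI : measurable I. Proof. exact: measurable_itv. Qed.
Let one : C -> C := fun=> 1.
Let one_mem : gmem N one. Proof. exact: gmem_one gN. Qed.

(** For the lower bound, near-maximizers accumulate at a point [xi] of the circle, and continuity on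
    the closed disk gives [|g_t xi|] at least the sup norm. *)
Lemma EN_multiplier t : I t -> EN X (Mop (g t)) = (supnorm (g t))%:E.
Proof.
move=> It; have ht := dg It; have [ah [_ ch]] := ht.
apply/eqP; rewrite eq_le; apply/andP; split.
  apply: (EN_le p1 gN memX normX ah) => // z z1; exact: supnorm_ub.
have [xi [w [xi1 w1 cw hw]]] := boundary_maximizer ah (supnorm_adherent ht).
have cg := disk_algebra_cvg ht xi1 w1 cw.
have hc := ccvg_lim_ge cg hw.
apply: (@le_trans _ _ (cabs (g t xi))%:E); first by rewrite lee_fin.
apply: (EN_ge p1 gN mono_lb peak_small memX normX xi1 ah (supnorm_ub ht)) => //.
move=> e e0; have [d d0 hd] := ch xi ltac:(by rewrite xi1) e e0.
by exists d => // z z1 zd; apply: hd => //; exact: ltW.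
Qed.

Lemma family_mem f t : gmem N f -> I t -> gmem N (fun z => g t z * f z).
Proof. by move=> /memX fm It; apply/memX; exact: (W fm).1. Qed.

Lemma family_near f t0 (e : R) : gmem N f -> I t0 -> 0 < e ->
  \forall t \near t0, I t /\
    gnorm p N (fun z => g t z * f z - g t0 z * f z) < e.
Proof.
move=> fm It0 e0.
have nI : \forall t \near t0, I t by apply: open_nbhs_nbhs; split => //; exact: interval_open.
have /memX fx := fm.
have /cvgrPdist_lt/(_ e e0) h := (W fx).2.1 t0 It0.
near=> t; have It : I t by near: t.
split => //; have : `|0 - fnorm X (fun z => Mop (g t) f z - Mop (g t0) f z)| < e by near: t.
rewrite sub0r normrN normX; first exact: le_lt_trans (ler_norm _).
exact: (gnormB p1 gN (family_mem fm It) (family_mem fm It0)).1.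
Unshelve. all: by end_near. Qed.

(** Norm continuity of [t -> g_t f] passes to [F], and continuity on an open interval gives
    measurability. Point values, norms and Taylor coefficients are all handled this way. *)
Lemma family_cmeasurable (F : R -> C) f (K : R) : gmem N f -> 0 < K ->
  (forall t s, I t -> I s ->
     cabs (F t - F s) <= K * gnorm p N (fun z => g t z * f z - g s z * f z)) ->
  @cmeasurable _ T R I F.
Proof.
move=> fm K0 hF.
have one_ (P : C -> R) : (forall z w, `|P z - P w| <= cabs (z - w)) ->
    @measurable_fun _ _ T R I (fun t => P (F t)).
  move=> hP; apply: open_continuous_measurable_fun; first exact: interval_open.
  move=> t0; rewrite inE => It0; apply/cvgrPdist_lt => e e0.
  have h := family_near fm It0 (divr_gt0 e0 K0).
  near=> t; have [It ht] : I t /\ gnorm p N (fun z => g t z * f z - g t0 z * f z) < e / K.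
    by near: t.
  rewrite distrC; apply: le_lt_trans (hP _ _) _; apply: le_lt_trans (hF _ _ It It0) _.
  by rewrite -ltr_pdivlMl// mulrC.
split; apply: one_ => z w.
- by rewrite (_ : complex.Re z - complex.Re w = complex.Re (z - w)) ?Re_le_cabs//; case: z; case: w.
- by rewrite (_ : complex.Im z - complex.Im w = complex.Im (z - w)) ?Im_le_cabs//; case: z; case: w.
Unshelve. all: by end_near. Qed.

Lemma family_point_measurable z : cabs z < 1 -> @cmeasurable _ T R I (fun t => g t z).
Proof.
move=> z1; have [K K0 hK] := point_eval p1 gN mono_lb (cabs_ge0 z) z1.
apply: (family_cmeasurable one_mem K0) => t s It Is.
have := hK _ z (gnormB p1 gN (family_mem one_mem It) (family_mem one_mem Is)).1 (lexx _).
by rewrite /one !mulr1.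
Qed.

Lemma family_norm_integrable f : gmem N f ->
  lam.-integrable I (fun t => (gnorm p N (fun z => g t z * f z))%:E).
Proof.
move=> fm; have /memX fx := fm.
have m : @measurable_fun _ _ T R I (fun t => gnorm p N (fun z => g t z * f z)).
  apply: (@family_cmeasurable (fun t => ((gnorm p N (fun z => g t z * f z))%:C)%C) f 1 fm ltr01 _).1.
  move=> t s It Is; rewrite mul1r -rmorphB /= cabs_real.
  exact: gnorm_dist p1 gN _ _ (family_mem fm It) (family_mem fm Is).
apply/integrableP; split; first exact/measurable_EFinP.
apply: le_lt_trans (W fx).2.2.
rewrite le_eqVlt; apply/orP; left; apply/eqP; apply: eq_integral => t; rewrite inE => It.
by rewrite abse_EFin ger0_norm ?gnorm_ge0// normX//; exact: family_mem.
Qed.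

Lemma family_point_le z : cabs z < 1 -> exists2 K : R, 0 < K & forall t, I t ->
  cabs (g t z) <= K * gnorm p N (fun z => g t z * one z).
Proof.
move=> z1; have [K K0 hK] := point_eval p1 gN mono_lb (cabs_ge0 z) z1.
exists K => // t It; have := hK _ z (family_mem one_mem It) (lexx _).
by rewrite /one mulr1.
Qed.

Lemma family_point_integrable z : cabs z < 1 ->
  lam.-integrable I (fun t => (cabs (g t z))%:E).
Proof.
move=> z1; have [K K0 hK] := family_point_le z1.
apply: (le_integrable mI _ _ (integrableZl mI K (family_norm_integrable one_mem))).
  by apply/measurable_EFinP; apply: measurable_cabs => //; exact: family_point_measurable.
move=> t It /=; rewrite lee_fin ger0_norm ?cabs_ge0//.
exact: le_trans (hK t It) (ler_norm _).
Qed.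

Lemma family_uniform_bound : exists2 K : R, 0 <= K & forall z, cabs z < 1 ->
  (\int[lam]_(t in I) (cabs (g t z))%:E <= K%:E)%E.
Proof.
apply: contrapT => no.
(* The factor [4 * 3 ^ n] is the constant of the gliding hump. After cancelling it, [n] would be
   less than the integral of the norms of [g_t f] for every [n], with one [f] chosen before [t]. *)
have ex n : exists z, cabs z < 1 /\
    ((4 * 3 ^+ n * n%:R)%:E < \int[lam]_(t in I) (cabs (g t z))%:E)%E.
  apply: contrapT => no'; apply: no; exists (4 * 3 ^+ n * n%:R).
    by rewrite mulr_ge0// mulr_ge0// exprn_ge0.
  by move=> z z1; rewrite leNgt; apply/negP => h; apply: no'; exists z.
have [x hx] := choice ex.
have [f fm hf] := gliding_hump p1 gN mono_lb (fun n => (hx n).1).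
have ib := family_norm_integrable fm.
pose B := fine (\int[lam]_(t in I) (gnorm p N (fun z => g t z * f z))%:E)%E.
have EB : (\int[lam]_(t in I) (gnorm p N (fun z => g t z * f z))%:E = B%:E)%E.
  by rewrite /B fineK//; exact: integrable_fin_num.
have [n hn] : exists n : nat, B < n%:R.
  by exists (Num.bound `|B|); apply: le_lt_trans (ler_norm _) (archi_boundP _).
have := (hx n).2; apply/negP; rewrite -leNgt.
apply: (@le_trans _ _ (\int[lam]_(t in I) ((4 * 3 ^+ n)%:E * (gnorm p N (fun z => g t z * f z)%R)%:E))%E).
  apply: ge0_le_integral => //.
  - by move=> t It; rewrite lee_fin cabs_ge0.
  - exact: measurable_int (family_point_integrable (hx n).1).
  - exact: measurable_int (integrableZl mI (4 * 3 ^+ n) ib).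
  - by move=> t It; rewrite -EFinM lee_fin; apply: hf; exact: family_mem.
by rewrite integralZl// EB -EFinM lee_fin ler_wpM2l ?(ltW hn)// mulr_ge0 ?exprn_ge0.
Qed.

Let G z : C := cint01 (fun t => g t z).

Lemma family_point_cintegrable z : cabs z < 1 -> cintegrable (fun t => g t z).
Proof.
by move=> z1; apply: cintegrable_dom (family_point_measurable z1) (family_point_integrable z1) _.
Qed.

Lemma mean_multiplier f z : cabs z < 1 -> int_op (fun t => Mop (g t)) f z = G z * f z.
Proof.
move=> z1; rewrite mulrC -(cint01Z _ (family_point_cintegrable z1)).
by congr cint01; apply/funext => t; rewrite /Mop mulrC.
Qed.

Lemma mean_bounded (M : R) z : cabs z < 1 ->
  (\int[lam]_(t in I) (cabs (g t z))%:E <= M%:E)%E -> cabs (G z) <= M.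
Proof.
move=> z1 hM; apply: le_trans (cint01_le (family_point_measurable z1)
  (family_point_integrable z1) (fun t _ => lexx _)) _.
rewrite -lee_fin /Rintegral fineK//.
exact: (integrable_fin_num mI (family_point_integrable z1)).
Qed.

(** The coefficients of [G] are the integrals of those of [g_t]. The tail of [g_t] is bounded by the
    norm of [g_t], integrable in [t], times a factor free of [t], so the integrated tails tend to
    0. *)
Lemma mean_analytic : analytic_D G.
Proof.
have ex t : exists a, I t -> has_series a (g t).
  (* Outside the interval nothing is known about [g t]; zero coefficients are a placeholder. *)
  have [It|nIt] := pselect (I t); last by exists (fun=> 0).
  by have /analyticP[a ha] := (dg It).1; exists a.
have [a ha] := choice ex.
have ma k : @cmeasurable _ T R I (fun t => a t k).
  have [K K0 hK] := coef_bound p1 gN mono_lb (r := 1 / 2) ltac:(lra) ltac:(lra).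
  have h0 : 0 < (1 / 2 : R) ^+ k by rewrite exprn_gt0// ltr_pdivlMr// mul0r.
  apply: (family_cmeasurable one_mem (divr_gt0 K0 h0)) => t s It Is.
  have hs : has_series (fun k => 1 * a t k + (-1) * a s k)
      (fun z => g t z * one z - g s z * one z).
    apply: series_eq (series_lin 1 (-1) (ha t It) (ha s Is)) _ => z z1.
    by rewrite /one !mulr1 mul1r mulN1r.
  have := hK _ _ k hs (gnormB p1 gN (family_mem one_mem It) (family_mem one_mem Is)).1.
  by rewrite mul1r mulN1r -ler_pdivlMr// mulrAC.
have ib := family_norm_integrable one_mem.
pose b t := gnorm p N (fun z => g t z * one z).
have ca k : cintegrable (fun t => a t k).
  have [K K0 hK] := coef_bound p1 gN mono_lb (r := 1 / 2) ltac:(lra) ltac:(lra).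
  have h0 : 0 < (1 / 2 : R) ^+ k by rewrite exprn_gt0// ltr_pdivlMr// mul0r.
  apply: (cintegrable_dom (ma k) (integrableZl mI (K / (1 / 2) ^+ k) ib)) => t It.
  have hs : has_series (a t) (fun z => g t z * one z).
    by apply: series_eq (ha t It) _ => z z1; rewrite /one mulr1.
  have := hK _ _ k hs (family_mem one_mem It).
  by rewrite -ler_pdivlMr// mulrAC.
apply/analyticP; exists (fun k => cint01 (fun t => a t k)) => z z1.
pose r := (1 + cabs z) / 2.
have z0 := cabs_ge0 z.
have r0 : 0 < r by rewrite /r; lra.
have r1 : r < 1 by rewrite /r; lra.
have zr : cabs z < r by rewrite /r; lra.
have [K K0 hK] := coef_bound p1 gN mono_lb r0 r1.
pose q := cabs z / r.
have q0 : 0 <= q by rewrite /q divr_ge0// ltW.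
have q1 : q < 1 by rewrite /q ltr_pdivrMr// mul1r.
pose B := Rintegral lam I b.
have B0 : 0 <= B by apply: Rintegral_ge0 => t _; exact: gnorm_ge0.
have est n : cabs (psum (fun k => cint01 (fun t => a t k)) n z - G z) <=
    (K * B / (1 - q)) * q ^+ n.
  have [ip ep] := @cint01_sum R n (fun k t => z ^+ k * a t k)
    (fun k => cintegrableZ (z ^+ k) (ca k)).
  have -> : psum (fun k => cint01 (fun t => a t k)) n z =
      cint01 (fun t => \sum_(k < n) z ^+ k * a t k).
    rewrite ep /psum; apply: eq_bigr => k _.
    by rewrite cint01Z ?(mulrC (z ^+ k)).
  have ig := cintegrableZ (-1) (family_point_cintegrable z1).
  have -> : cint01 (fun t => \sum_(k < n) z ^+ k * a t k) - G z =
      cint01 (fun t => \sum_(k < n) z ^+ k * a t k + (-1) * g t z).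
    by rewrite cint01D// cint01Z ?mulN1r//; exact: family_point_cintegrable.
  have -> : K * B / (1 - q) * q ^+ n =
      Rintegral lam I (fun t => (K * q ^+ n / (1 - q)) * b t).
    by rewrite RintegralZl// -/B; ring.
  apply: cint01_le.
  - apply: cmeasurableD.
      elim: n {ip ep} => [|n IH].
        rewrite (_ : (fun t => _) = fun=> 0); first exact: cmeasurable_cst.
        by apply/funext => t; rewrite big_ord0.
      rewrite (_ : (fun t => _) = fun t => \sum_(k < n) z ^+ k * a t k + z ^+ n * a t n).
        by apply: cmeasurableD => //; apply: cmeasurableM => //; exact: cmeasurable_cst.
      by apply/funext => t; rewrite big_ord_recr.
    by apply: cmeasurableM; [exact: cmeasurable_cst|exact: family_point_measurable].
  - exact: (integrableZl mI (K * q ^+ n / (1 - q)) ib).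
  - move=> t It.
    have -> : \sum_(k < n) z ^+ k * a t k + (-1) * g t z = - (g t z - psum (a t) n z).
      rewrite mulN1r opprB /psum; congr (_ - _).
      by apply: eq_bigr => k _; rewrite mulrC.
    rewrite cabsN.
    have hs : has_series (a t) (fun z => g t z * one z).
      by apply: series_eq (ha t It) _ => w w1; rewrite /one mulr1.
    apply: le_trans (series_tail n (ha t It) r0 (ltW r1)
      (fun k => hK _ _ k hs (family_mem one_mem It)) zr) _.
    rewrite -/q -/(b t) le_eqVlt; apply/orP; left; apply/eqP; ring.
apply/ccvgP => e e0.
have c0 : 0 <= K * B / (1 - q).
  by rewrite divr_ge0 ?subr_ge0 ?(ltW q1)// mulr_ge0 // ltW.
have [n0 hn0] := expr_small q0 q1 c0 e0.
by exists n0 => n nn; apply: le_lt_trans (est n) (hn0 n nn).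
Qed.

(** A supremum of functions continuous in [t] is lower semicontinuous: a point [z] with
    [|g_t0 z| > a] still witnesses the bound for [t] close to [t0]. *)
Lemma supnorm_measurable : @measurable_fun _ _ T R I (fun t => supnorm (g t)).
Proof.
(* The value 0 off the open interval is the minimum of [F], so the extension remains lower
   semicontinuous at the endpoints. *)
pose F (t : R) : \bar R := if t \in `]0%R, 1%R[ then (supnorm (g t))%:E else 0%E.
have F0 t : (0 <= F t)%E.
  rewrite /F; case: ifPn => // It; rewrite lee_fin; exact: supnorm_ge0 (dg It).
have lF : lower_semicontinuous F.
  move=> t0 a haF; have [a0|a0] := ltP a 0.
    exists setT => [|t _]; first exact: filterT.
    by apply: lt_le_trans (F0 t); rewrite lte_fin.
  move: haF; rewrite {1}/F; case: ifPn => [It0|_]; last by rewrite lte_fin ltNge a0.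
  rewrite lte_fin => ha.
  have e0 : 0 < supnorm (g t0) - a by rewrite subr_gt0.
  have [z z1 hz] := supnorm_adherent (dg It0) e0.
  have [K K0 hK] := point_eval p1 gN mono_lb (cabs_ge0 z) z1.
  have d0 : 0 < (cabs (g t0 z) - a) / K by rewrite divr_gt0//; lra.
  exists [set t | I t /\ gnorm p N (fun z => g t z * one z - g t0 z * one z) <
                          (cabs (g t0 z) - a) / K].
    exact: family_near one_mem It0 d0.
  move=> t [It ht]; have It' : t \in `]0%R, 1%R[ by [].
  rewrite /F It' lte_fin; apply: lt_le_trans (supnorm_ub (dg It) z1).
  have := hK _ z (gnormB p1 gN (family_mem one_mem It) (family_mem one_mem It0)).1 (lexx _).
  rewrite /= {1 2}/one !mulr1 => h1.
  have h2 : K * gnorm p N (fun z => g t z * one z - g t0 z * one z) < cabs (g t0 z) - a.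
    by rewrite -ltr_pdivlMl// mulrC.
  have h3 := ler_cabsB (g t0 z) (g t z); rewrite cabsC in h3.
  lra.
apply/measurable_EFinP.
apply: (@eq_measurable_fun _ _ T _ I F).
  by move=> t; rewrite inE /F => It; rewrite ifT.
exact: measurable_funTS (lower_semicontinuous_measurable lF).
Qed.

Lemma circle_measurable xi : cabs xi = 1 -> @cmeasurable _ T R I (fun t => g t xi).
Proof.
move=> xi1; have [w w1 cw] := radial_cvg xi1.
apply: (@cmeasurable_lim _ T R I (fun n t => g t (w n))).
  by move=> n; exact: family_point_measurable.
by move=> t It; exact: (disk_algebra_cvg (dg It) xi1 w1 cw).
Qed.

Lemma circle_le t xi : I t -> cabs xi = 1 -> cabs (g t xi) <= supnorm (g t).
Proof.
move=> It xi1; have [w w1 cw] := radial_cvg xi1.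
apply: ccvg_lim_le (disk_algebra_cvg (dg It) xi1 w1 cw) _.
by exists 0%N => n _; exact: (supnorm_ub (dg It) (w1 n)).
Qed.

Lemma mean_boundary (w : nat -> C) xi :
  lam.-integrable I (fun t => (supnorm (g t))%:E) -> cabs xi = 1 ->
  (forall n, cabs (w n) < 1) -> ccvg w xi ->
  ccvg (fun n => G (w n)) (cint01 (fun t => g t xi)).
Proof.
move=> is_ xi1 w1 cw; apply: (cint01_dct (b := fun t => supnorm (g t))) => //.
- by move=> n; exact: family_point_measurable.
- by move=> n t It; exact: (supnorm_ub (dg It) (w1 n)).
- by move=> t It; exact: (disk_algebra_cvg (dg It) xi1 w1 cw).
Qed.

(** The sequential limit given by dominated convergence becomes a limit over all approaches inside
    the disk, by choosing a sequence of counterexamples. *)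
Lemma mean_boundary_limit xi :
  lam.-integrable I (fun t => (supnorm (g t))%:E) -> cabs xi = 1 ->
  forall e : R, 0 < e -> exists2 d : R, 0 < d & forall z, cabs z < 1 ->
    cabs (z - xi) < d -> cabs (G z - cint01 (fun t => g t xi)) < e.
Proof.
move=> is_ xi1 e e0; apply: contrapT => no.
have ex n : exists z, [/\ cabs z < 1, cabs (z - xi) < n.+1%:R^-1 &
    e <= cabs (G z - cint01 (fun t => g t xi))].
  apply: contrapT => no'; apply: no; exists n.+1%:R^-1; first by rewrite invr_gt0.
  move=> z z1 zd; rewrite ltNge; apply/negP => h; apply: no'.
  by exists z.
have [w hw] := choice ex.
have cw : ccvg w xi.
  by apply: ccvg_le (@cvg_harmonic R) _ => n; case: (hw n) => _ /ltW.
have w1 n : cabs (w n) < 1 by case: (hw n).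
have /ccvgP/(_ e e0)[n hn] := mean_boundary is_ xi1 w1 cw.
by have := hn n (leqnn n); rewrite ltNge; case: (hw n) => _ _ ->.
Qed.

Lemma EN_mean_le (K : R) : (forall z, cabs z < 1 -> cabs (G z) <= K) ->
  (EN X (int_op (fun t => Mop (g t))) <= K%:E)%E.
Proof.
move=> hK; apply: (EN_le p1 gN memX normX mean_analytic hK) => f _ z z1.
exact: mean_multiplier.
Qed.

Lemma supnorm_integrable : (\int[lam]_(t in I) (supnorm (g t))%:E < +oo)%E ->
  lam.-integrable I (fun t => (supnorm (g t))%:E).
Proof.
move=> fin; apply/integrableP; split.
  by apply/measurable_EFinP; exact: supnorm_measurable.
apply: le_lt_trans fin; rewrite le_eqVlt; apply/orP; left; apply/eqP.
apply: eq_integral => t; rewrite inE => It.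
by rewrite abse_EFin ger0_norm// (supnorm_ge0 (dg It)).
Qed.

Lemma aligned_of_equality :
  EN X (int_op (fun t => Mop (g t))) = (\int[lam]_(t in I) (supnorm (g t))%:E)%E ->
  exists xi theta : C, cabs xi = 1 /\ cabs theta = 1 /\
    {ae lam, forall t, I t -> theta * g t xi = ((supnorm (g t))%:C)%C}.
Proof.
move=> eqEN.
have [K K0 hK] := family_uniform_bound.
have ENK := EN_mean_le (fun z z1 => mean_bounded z1 (hK z z1)).
(* Equality is what makes the right side finite: the left side is at most the uniform bound [K]. *)
have is_ : lam.-integrable I (fun t => (supnorm (g t))%:E).
  by apply: supnorm_integrable; rewrite -eqEN; apply: le_lt_trans ENK (ltry _).
pose S := Rintegral lam I (fun t => supnorm (g t)).
have ES : (\int[lam]_(t in I) (supnorm (g t))%:E)%E = S%:E.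
  by rewrite /S /Rintegral fineK//; exact: (integrable_fin_num mI is_).
(* Otherwise [|G| <= S - e] on the disk, and the essential norm would be at most [S - e]. *)
have adh (e : R) : 0 < e -> exists2 z, cabs z < 1 & S - e < cabs (G z).
  move=> e0; apply: contrapT => no.
  have : (S%:E <= (S - e)%:E)%E.
    rewrite -ES -eqEN; apply: EN_mean_le => z z1; rewrite leNgt; apply/negP => h.
    by apply: no; exists z.
  by rewrite lee_fin; lra.
have [xi [w [xi1 w1 cw hw]]] := boundary_maximizer mean_analytic adh.
pose c := cint01 (fun t => g t xi).
have Sc : S <= cabs c := ccvg_lim_ge (mean_boundary is_ xi1 w1 cw) hw.
have [theta th1 hth] := phase_exists c.
exists xi, theta; split => //; split => //.
have ic : cintegrable (fun t => g t xi).
  by apply: cintegrable_dom (circle_measurable xi1) is_ _ => t It; exact: circle_le.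
have iR := (cintegrableZ theta ic).1.
have ER : Rintegral lam I (fun t => complex.Re (theta * g t xi)) = cabs c.
  by have /(congr1 (@complex.Re R)) := cint01Z theta ic; rewrite hth.
(* The defect of alignment: nonnegative, with integral [S - |c| <= 0], hence zero almost
   everywhere. *)
pose k t := supnorm (g t) - complex.Re (theta * g t xi).
have Re_le t : I t -> cabs (theta * g t xi) <= supnorm (g t).
  by move=> It; rewrite cabsM th1 mul1r; exact: circle_le.
have k0 t : I t -> 0 <= k t.
  move=> It; rewrite /k subr_ge0; apply: le_trans (ler_norm _) _.
  exact: le_trans (Re_le_cabs _) (Re_le t It).
have ik : lam.-integrable I (fun t => (k t)%:E).
  by apply: (eq_integrable mI _ _ _ (integrableB mI is_ iR)) => t _ /=; rewrite -EFinB.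
have Ik : Rintegral lam I k <= 0 by rewrite RintegralB// ER subr_le0.
have Ik0 : (\int[lam]_(t in I) `|(k t)%:E| = 0)%E.
  have -> : (\int[lam]_(t in I) `|(k t)%:E| = \int[lam]_(t in I) (k t)%:E)%E.
    apply: eq_integral => t; rewrite inE => It.
    by rewrite abse_EFin ger0_norm// k0.
  apply/eqP; rewrite eq_le; apply/andP; split; last first.
    by apply: integral_ge0 => t It; rewrite lee_fin k0.
  by rewrite -(fineK (integrable_fin_num mI ik)) lee_fin.
have mk := measurable_int lam ik.
have /(ae_eq_integral_abs lam mI mk) := Ik0.
apply: filterS => t ht It.
have /= [kt] := ht It.
have Rt : complex.Re (theta * g t xi) = supnorm (g t).
  by apply/esym/eqP; rewrite -subr_eq0; apply/eqP.
(* A number whose real part equals a bound on its modulus has zero imaginary part. *)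
have := Re_le t It; have := cabs_sqr (theta * g t xi).
rewrite Rt; case: (theta * g t xi) Rt => a b /= -> hs hle.
have b0 : b ^+ 2 <= 0.
  have := supnorm_ge0 (dg It); move: hs hle; set x := cabs _; set y := supnorm _.
  move=> hs hle y0; have x0 : 0 <= x by exact: cabs_ge0.
  have : x ^+ 2 <= y ^+ 2 by rewrite ler_pXn2r.
  lra.
by have /eqP : b ^+ 2 = 0 by [apply/eqP; rewrite eq_le b0 sqr_ge0]; rewrite sqrf_eq0 => /eqP ->.
Qed.

Lemma equality_of_aligned (xi theta : C) : cabs xi = 1 -> cabs theta = 1 ->
  {ae lam, forall t, I t -> theta * g t xi = ((supnorm (g t))%:C)%C} ->
  EN X (int_op (fun t => Mop (g t))) = (\int[lam]_(t in I) (supnorm (g t))%:E)%E.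
Proof.
move=> xi1 th1 ae_.
have [K K0 hK] := family_uniform_bound.
have ms := supnorm_measurable; have mx := circle_measurable xi1.
have mcx : @measurable_fun _ _ T R I (fun t => cabs (g t xi)) by exact: measurable_cabs.
have eqx : (\int[lam]_(t in I) (supnorm (g t))%:E = \int[lam]_(t in I) (cabs (g t xi))%:E)%E.
  apply: ge0_ae_eq_integral => //.
  - exact/measurable_EFinP.
  - exact/measurable_EFinP.
  - by move=> t It; rewrite lee_fin (supnorm_ge0 (dg It)).
  - by move=> t It; rewrite lee_fin cabs_ge0.
  - apply: filterS ae_ => t ht It; congr (_%:E).
    have := congr1 (@cabs R) (ht It); rewrite cabsM th1 mul1r cabs_real => ->.
    by rewrite ger0_norm// (supnorm_ge0 (dg It)).
(* By alignment the sup norm is [|g_t xi|], a radial limit of interior values whose integrals are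
   all bounded by [K]; Fatou's lemma applies before any integrable majorant is known. *)
have fin : (\int[lam]_(t in I) (supnorm (g t))%:E <= K%:E)%E.
  rewrite eqx; have [w w1 cw] := radial_cvg xi1.
  have := @fatou _ _ _ lam I mI (fun n t => (cabs (g t (w n)))%:E)
    (fun n => measurable_int lam (family_point_integrable (w1 n)))
    (fun n t _ => cabs_ge0 (g t (w n))).
  set L := (Y in (Y <= _)%E); set L' := (Y in (_ <= Y)%E) => h.
  have -> : (\int[lam]_(t in I) (cabs (g t xi))%:E)%E = L.
    apply: eq_integral => t; rewrite inE => It; apply/esym.
    apply: (cvg_limn_einf_sup _).1; apply: cvg_EFin; first exact: nearW.
    by apply: ccvg_cabs; exact: (disk_algebra_cvg (dg It) xi1 w1 cw).
  apply: le_trans h _; apply: le_trans (limn_einf_sup _) _.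
  by apply: limn_esup_le => n; apply: hK.
have is_ := supnorm_integrable (le_lt_trans fin (ltry _)).
pose S := Rintegral lam I (fun t => supnorm (g t)).
have ES : (\int[lam]_(t in I) (supnorm (g t))%:E)%E = S%:E.
  by rewrite /S /Rintegral fineK//; exact: (integrable_fin_num mI is_).
have hG z : cabs z < 1 -> cabs (G z) <= S.
  move=> z1; apply: (mean_bounded z1); rewrite -ES; apply: ge0_le_integral => //.
  - by move=> t It; rewrite lee_fin cabs_ge0.
  - exact: measurable_int (family_point_integrable z1).
  - exact/measurable_EFinP.
  - by move=> t It; rewrite lee_fin; exact: (supnorm_ub (dg It) z1).
apply/eqP; rewrite eq_le; apply/andP; split; rewrite ES.
  exact: EN_mean_le.
pose c := cint01 (fun t => g t xi).
have ic : cintegrable (fun t => g t xi).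
  by apply: cintegrable_dom mx is_ _ => t It; exact: circle_le.
have Sc : S <= cabs c.
  (* Integrating the alignment: [theta] takes the boundary integral [c] to the integral of the sup
     norms. *)
  have -> : S = complex.Re (theta * c).
    rewrite -(cint01Z theta ic) /= /S /Rintegral; congr fine.
    apply: ae_eq_integral => //.
    - exact/measurable_EFinP.
    - exact: measurable_int (cintegrableZ theta ic).1.
    - by apply: filterS ae_ => t ht It; rewrite ht.
  apply: le_trans (ler_norm _) _; apply: le_trans (Re_le_cabs _) _.
  by rewrite cabsM th1 mul1r.
apply: (@le_trans _ _ (cabs c)%:E); first by rewrite lee_fin.
apply: (EN_ge p1 gN mono_lb peak_small memX normX xi1 mean_analytic hG).
  exact: mean_boundary_limit.
by move=> f _ z z1; exact: mean_multiplier.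
Qed.

Lemma EN_integral_multiplier :
  EN X (int_op (fun t => Mop (g t))) = (\int[lam]_(t in I) EN X (Mop (g t)))%E <->
  exists xi theta : C, cabs xi = 1 /\ cabs theta = 1 /\
    {ae lam, forall t, I t -> theta * g t xi = ((supnorm (g t))%:C)%C}.
Proof.
have -> : (\int[lam]_(t in I) EN X (Mop (g t)) = \int[lam]_(t in I) (supnorm (g t))%:E)%E.
  by apply: eq_integral => t; rewrite inE => It; exact: EN_multiplier.
split; first exact: aligned_of_equality.
by move=> [xi [theta [xi1 [th1 ae_]]]]; exact: equality_of_aligned xi1 th1 ae_.
Qed.

End MultiplierFamily.

Theorem theorem4p2 (R : realType) (p alpha : R) (X : fspace R)
  (g : R -> R[i] -> R[i]) :
  1 < p -> -1 < alpha ->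
  X = Hardy p \/ X = Bergman p alpha ->
  (forall t, t \in `]0%R, 1%R[ -> disk_algebra (g t)) ->
  condW X (fun t => Mop (g t)) ->
  (EN X (int_op (fun t => Mop (g t))) =
     (\int[lebesgue_measure]_(t in `]0%R, 1%R[) EN X (Mop (g t)))%E
   <->
   exists xi theta : R[i], cabs xi = 1 /\ cabs theta = 1 /\
     {ae (@lebesgue_measure R), forall t, t \in `]0%R, 1%R[ ->
        theta * g t xi = ((supnorm (g t))%:C)%C}).
Proof.
move=> p1 al1 [->|->] dg W.
- apply: (EN_integral_multiplier p1 (hardy_gaugeP p1) _ _ _ _ dg W).
  + by move=> r r0 r1; exact: hardy_mono_lb.
  + by move=> e e0; exact: hardy_peak_small.
  + by move=> f; exact: hardy_memP.
  + by move=> f; exact: hardy_normP.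
- apply: (EN_integral_multiplier p1 (bergman_gaugeP p1 al1) _ _ _ _ dg W).
  + by move=> r r0 r1; exact: bergman_mono_lb.
  + by move=> e e0; exact: bergman_peak_small.
  + by move=> f; exact: bergman_memP.
  + by move=> f _; exact: bergman_normP.
Qed.
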